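(* Let $n\ge 1$ and let $\mathbf r=(r_1\ge\dots\ge r_{n+1})$ be a signature of $\mathrm{GL}(n+1,\mathbb C)$. Let $\mathfrak V_{\mathbf r}=\bigoplus_{\mathbf q} V^n_{\mathbf q}$ (sum over integer vectors $\mathbf q=(q_1,\dots,q_n)$ with $r_j\ge q_j\ge r_{j+1}$), and let $F_{kl}$ denote the operators on $\mathfrak V_{\mathbf r}$ by which the generators $E_{kl}$ of $\mathfrak{gl}(n+1)$ act on $\mathfrak V_{\mathbf r}$ under the identification of $\mathfrak V_{\mathbf r}$ with the irreducible $\mathfrak{gl}(n+1)$-module of signature $\mathbf r$ determined by the kernel $L$ (see context). Then: (a) $$F_{1(n+1)}=\sum_{m=1}^n A_m\Bigl(\sum_{I\triangleleft[1,m]}\ \prod_{l\in[1,m]\setminus I}(q_m-q_l+l-m)\cdot R_I\Bigr)T_m^-,\qquad A_m=\frac{\prod_{j=m+1}^{n+1}(q_m-r_j+j-m-1)}{\prod_{\alpha\ne m}(q_m-q_\alpha+\alpha-m)}.$$ (b) $$F_{(n+1)n}=-\sum_{m=1}^n B_m\Bigl(\sum_{I\triangleleft[m,n]}\ \prod_{l\in[m,n]\setminus I}(q_m-q_l-m+l+1)\cdot R_I\Bigr)T_m^+,\qquad B_m=\frac{\prod_{j=1}^{m}(q_m-r_j+j-m)}{\prod_{\alpha\ne m}(q_m-q_\alpha-m+\alpha)}.$$ Here the products over $\alpha\neq m$ are over $\alpha\in\{1,\dots,n\}\setminus\{m\}$.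
   Context: **Representations.** $N_n^+$ is the group of upper triangular complex $n\times n$ matrices $Z=(z_{ij})$ with unit diagonal; $B_n^-$ is the group of invertible lower triangular matrices. A signature of $\mathrm{GL}(n,\mathbb C)$ is an integer vector $\mathbf p=(p_1\ge\dots\ge p_n)$. $V^n_{\mathbf p}$ is the space of polynomials on $N_n^+$ that are restrictions to $N_n^+$ of functions $f$ on $\mathrm{GL}(n,\mathbb C)$, polynomial in the matrix entries and $\det(g)^{-1}$, with $f(bg)=\prod_j b_{jj}^{p_j}f(g)$ for all $b\in B_n^-$. $\mathrm{GL}(n,\mathbb C)$ acts on it by right shifts $f(g)\mapsto f(gh)$; in coordinates $(\rho_{\mathbf p}(g)f)(Z)=f(Z^{[g]})\prod_{j=1}^n b_{jj}(Z,g)^{p_j}$, where $Zg=b(Z,g)Z^{[g]}$, $b(Z,g)\in B_n^-$, $Z^{[g]}\in N_n^+$. This is the irreducible representation with highest weight $\mathbf p$. $E_{kl}$ denotes the matrix units of $\mathfrak{gl}$ and also their derived action on $V_{\mathbf p}$. **Kernel.** Put $\mathbf p=\mathbf r^*:=(-r_{n+1},\dots,-r_1)$. Let $Z\in N_{n+1}^+$, $U=(u_{kl})\in N_n^+$. For a matrix $X$, $[X]_{\alpha\beta}$ is its upper-left $\alpha\times\beta$ corner. Let $Z^{cut}$ be $Z$ with its last column removed, and $U^{ext}$ the $n\times(n+1)$ matrix obtained from $U$ by appending a zero last column. Put $$\Phi_\alpha=\det\begin{pmatrix}[Z]_{(n+1-\alpha)(n+1)}\\ [U^{ext}]_{\alpha(n+1)}\end{pmatrix}\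 (1\le\alpha\le n),\qquad \Psi_\alpha=\det\begin{pmatrix}[Z^{cut}]_{(n-\alpha)n}\\ [U]_{\alpha n}\end{pmatrix}\ (1\le\alpha\le n-1),$$ $$L_{\mathbf q}=L^{\mathbf r}_{\mathbf q}(U,Z)=\Phi_1^{q_1-r_2}\Psi_1^{r_2-q_2}\Phi_2^{q_2-r_3}\Psi_2^{r_3-q_3}\cdots\Phi_n^{q_n-r_{n+1}}\in V^{n+1}_{\mathbf p}\otimes V^n_{\mathbf q}$$ ($V^{n+1}_{\mathbf p}$ in the variable $Z$, $V^n_{\mathbf q}$ in $U$). **Identification and operators $F_{kl}$.** Elements of $\mathfrak V_{\mathbf r}$ are written $F(U,\mathbf q)$: for fixed $\mathbf q$, a polynomial in $U$ lying in $V^n_{\mathbf q}$. The family $L=(L_{\mathbf q})_{\mathbf q}$ is viewed as an element of $V^{n+1}_{\mathbf p}\otimes\mathfrak V_{\mathbf r}$; it gives the linear isomorphism $(V^{n+1}_{\mathbf p})^*\to\mathfrak V_{\mathbf r}$, $\xi\mapsto(\xi\otimes 1)L$, and $(V_{\mathbf p}^{n+1})^*$ with the dual action is the irreducible representation of signature $\mathbf r$. $F_{kl}$ is the action of $E_{kl}$ transported to $\mathfrak V_{\mathbf r}$ by this isomorphism; equivalently $F_{kl}$ is the unique operator on $\mathfrak V_{\mathbf r}$ with $(E_{kl}\otimes1+1\otimes F_{kl})L=0$. **Notation in the formulas.** $T_m^{\pm}F(U,\dots,q_m,\dots)=F(U,\dots,q_m\pm1,\dots)$, other variables unchanged; $A_m,B_m$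 and the other coefficients are evaluated at $\mathbf q$ (to the left of $T_m^\pm$). Terms in which $q_m\pm1$ leaves the range $[r_{m+1},r_m]$ have vanishing coefficient $A_m$ resp. $B_m$ and are taken to be $0$. $[k,l]=\{k,k+1,\dots,l\}$. $I\triangleleft[k,l]$ means $I\subset[k,l]$, $\min I=k$, $\max I=l$. Zhelobenko operators in $U$: $R_{kl}=\frac{\partial}{\partial u_{kl}}+\sum_{l<j\le n}u_{lj}\frac{\partial}{\partial u_{kj}}$ for $1\le k<l\le n$. For $I=\{i_1<\dots<i_s\}$, $R_I=R_{i_1i_2}R_{i_2i_3}\cdots R_{i_{s-1}i_s}$ (composition), and $R_I=1$ if $I$ has one element. *)

(* Defs.v *)
From HB Require Import structures.
From mathcomp Require Import all_boot all_order all_algebra.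
From mathcomp Require Import mpoly complex.
From mathcomp Require Import boolp classical_sets reals topology normedtype derive.

Set Implicit Arguments.
Unset Strict Implicit.
Unset Printing Implicit Defensive.

Import Order.TTheory GRing.Theory Num.Theory.
Import numFieldNormedType.Exports.

Local Open Scope ring_scope.

(* All ordinal indices are 0-based.  The index shifts in the classical 1-based
   formulas are differences of indices (such as j - m), hence are unchanged. *)

Definition upos (n : nat) := {kl : 'I_n * 'I_n | (kl.1 < kl.2)%N}.
HB.instance Definition _ n := Finite.on (upos n).

Definition nvars (n : nat) : nat := #|{: upos n}|.

Definition uvar_index (n : nat) (k l : 'I_n) : option 'I_(nvars n) :=
  omap (@enum_rank (upos n)) (insub (k, l)).

Section Coordinates.
Variables (K : comNzRingType) (n : nat).

(* The polynomial functions on N_n^+: one variable for each entry strictly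
   above the diagonal, and no other. *)
Definition Npoly := {mpoly K[nvars n]}.

(* The tautological point of N_n^+ over its coordinate ring. *)
Definition generic : 'M[Npoly]_n :=
  \matrix_(k, l) if uvar_index k l is Some i then 'X_i else (k == l)%:R.

Definition eval_at (f : Npoly) (Z : 'M[K]_n) : K :=
  f.@[fun i => Z (val (enum_val i)).1 (val (enum_val i)).2].

Definition partial (k l : 'I_n) (f : Npoly) : Npoly :=
  if uvar_index k l is Some i then mderiv i f else 0.

Definition Rop (k l : 'I_n) (f : Npoly) : Npoly :=
  partial k l f + \sum_(j < n | (l < j)%N) generic l j * partial k j f.

Fixpoint Rchain (i : 'I_n) (s : seq 'I_n) : Npoly -> Npoly :=
  if s is j :: s' then Rop i j \o Rchain j s' else id.

(* [enum I] lists I in increasing order. *)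
Definition Rset (I : {set 'I_n}) : Npoly -> Npoly :=
  if enum I is i :: s then Rchain i s else id.

End Coordinates.

Definition segment (n k l : nat) : {set 'I_n} :=
  [set i : 'I_n | (k <= i <= l)%N].

(* I is contained in [k, l], with min I = k and max I = l. *)
Definition spans (n k l : nat) (I : {set 'I_n}) : bool :=
  [&& I \subset segment n k l, [exists i in I, i == k :> nat]
    & [exists i in I, i == l :> nat]].

Definition unitri (K : nzRingType) (n : nat) (Z : 'M[K]_n) : bool :=
  is_trig_mx Z^T && [forall i, Z i i == 1].

Definition signature (n : nat) (p : 'I_n -> int) : Prop :=
  forall i j : 'I_n, (i <= j)%N -> p j <= p i.

Section Representation.
Variables (C : numFieldType) (n : nat) (p : 'I_n -> int).

Definition in_Bminus (b : 'M[C]_n) : bool := is_trig_mx b && (b \in unitmx).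

(* The indeterminate of P stands for the inverse determinant, the variables of
   its coefficients for the matrix entries. *)
Definition regular_on_GL (phi : 'M[C]_n -> C) : Prop :=
  exists P : {poly {mpoly C[n * n]}}, forall g, g \in unitmx ->
    phi g = (map_poly (meval (fun i => mxvec g 0 i)) P).[(\det g)^-1].

Definition Bminus_equivariant (phi : 'M[C]_n -> C) : Prop :=
  forall b g, in_Bminus b -> g \in unitmx ->
    phi (b *m g) = (\prod_j b j j ^ p j) * phi g.

Definition in_Vsp (f : Npoly C n) : Prop :=
  exists phi : 'M[C]_n -> C,
    [/\ regular_on_GL phi, Bminus_equivariant phi
      & forall Z, unitri Z -> eval_at f Z = phi Z].

Definition Vsp_pred : {pred Npoly C n} := fun f => `[< in_Vsp f >].

Lemma Vsp_submod_closed : submod_closed Vsp_pred.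
Proof.
split=> [|a f1 f2 /asboolP[phi [[P rP] eP sP]] /asboolP[psi [[Q rQ] eQ sQ]]];
  apply/asboolP.
  exists (fun=> 0); split=> [|b g _ _|Z _]; last by rewrite /eval_at meval0.
    by exists 0 => g _; rewrite map_poly0 horner0.
  by rewrite mulr0.
exists (fun Z => a * phi Z + psi Z); split=> [|b h bB hG|Z ZN].
- exists ((a%:MP)%:P * P + Q) => g gG; rewrite rP // rQ //.
  by rewrite rmorphD rmorphM /= map_polyC /= mevalC hornerD hornerM hornerC.
- by rewrite eP // eQ // mulrDr mulrCA.
- by rewrite -sP // -sQ // /eval_at mevalD mevalZ.
Qed.

HB.instance Definition _ :=
  GRing.isSubmodClosed.Build C (Npoly C n) Vsp_pred Vsp_submod_closed.

Record Vsp := MkVsp { Vsp_val :> Npoly C n; _ : Vsp_val \in Vsp_pred }.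

HB.instance Definition _ := [isSub for Vsp_val].
HB.instance Definition _ := [Choice of Vsp by <:].
HB.instance Definition _ := [SubChoice_isSubLmodule of Vsp by <:].

(* The (unique, if it exists) pair (b, Z) in B_n^- x N_n^+ with g = b Z. *)
Definition gauss (g : 'M[C]_n) : 'M[C]_n * 'M[C]_n :=
  xget (1%:M, 1%:M)
    (fun bZ => [/\ in_Bminus bZ.1, unitri bZ.2 & g = bZ.1 *m bZ.2]).

Definition rho (g : 'M[C]_n) (f : Npoly C n) (Z : 'M[C]_n) : C :=
  eval_at f (gauss (Z *m g)).2 * \prod_j (gauss (Z *m g)).1 j j ^ p j.

(* The derived action of E_kl: differentiate rho along t |-> 1 + t E_kl, a curve
   with velocity E_kl at t = 0 (it is exp (t E_kl) when k != l).  The element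
   of V_p^n so obtained is determined by its values on N_n^+. *)
Definition Eact (k l : 'I_n) (f : Vsp) : Vsp :=
  xget 0 (fun h : Vsp => forall Z : 'M[C]_n, unitri Z ->
    is_derive (0 : C) (1 : C)
      (fun t : C => rho (1%:M + t *: delta_mx k l) f Z) (eval_at h Z)).

Definition Vdual := {linear Vsp -> C^o}.

Definition Edual (k l : 'I_n) (xi : Vsp -> C) : Vsp -> C :=
  fun f => - xi (Eact k l f).

End Representation.

Section Kernel.
Variables (C : numFieldType) (n : nat) (r : 'I_n.+1 -> int).

Definition interlaces (q : 'I_n -> int) : bool :=
  [forall j : 'I_n, r (lift ord0 j) <= q j <= r (widen_ord (leqnSn n) j)].

Definition rstar : 'I_n.+1 -> int := fun j => - r (rev_ord j).

(* Polynomials in U whose coefficients are polynomials in Z. *)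
Definition Kpoly := Npoly (Npoly C n.+1) n.

Definition Zgen : 'M[Kpoly]_n.+1 :=
  map_mx (@mpolyC _ _) (generic C n.+1).
Definition Ugen : 'M[Kpoly]_n := generic (Npoly C n.+1) n.

Definition Zcut : 'M[Kpoly]_(n.+1, n) := col' ord_max Zgen.
Definition Uext : 'M[Kpoly]_(n, n.+1) :=
  \matrix_(i, j) if unlift ord_max j is Some j' then Ugen i j' else 0.

Definition entry m N (A : 'M[Kpoly]_(m, N)) (i : nat) (j : 'I_N) : Kpoly :=
  if insub i is Some i' then A i' j else 0.

(* The first a rows of A followed by the first N - a rows of B. *)
Definition stack m m' N (a : nat) (A : 'M_(m, N)) (B : 'M_(m', N)) :
    'M[Kpoly]_N :=
  \matrix_(i, j) if (i < a)%N then entry A i j else entry B (i - a) j.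

Definition Phi (a : nat) : Kpoly := \det (stack (n.+1 - a) Zgen Uext).
Definition Psi (a : nat) : Kpoly := \det (stack (n - a) Zcut Ugen).

(* The arguments of Phi and Psi are the 1-based alpha: with j = alpha - 1
   the first product runs over Phi_alpha ^ (q_alpha - r_(alpha+1)), and with
   j = alpha the second one over Psi_alpha ^ (r_(alpha+1) - q_(alpha+1)).
   The exponents are nonnegative when q interlaces r. *)
Definition Lker (q : {ffun 'I_n -> int}) : Kpoly :=
  (\prod_(j < n) Phi j.+1 ^+ absz (q j - r (lift ord0 j))) *
  (\prod_(j < n | (0 < j)%N)
      Psi j ^+ absz (r (widen_ord (leqnSn n) j) - q j)).

(* F(U, q) is represented by a function of all integer vectors q, which is zero
   when q does not interlace r. *)
Definition qfamily := {ffun 'I_n -> int} -> Npoly C n.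

Definition GTspace (F : qfamily) : Prop :=
  forall q : {ffun 'I_n -> int},
    if interlaces q then in_Vsp q (F q) else F q = 0.

(* (xi (x) 1) L: xi is applied to the coefficients of L_q as a polynomial in U;
   these coefficients belong to V_p^{n+1} with p = r^*. *)
Definition pairL (xi : Vsp C rstar -> C) : qfamily := fun q =>
  if interlaces q then map_mpoly (fun c => xi (insubd 0 c)) (Lker q) else 0.

Definition pairL_inv (F : qfamily) : Vdual C rstar :=
  xget (\0 : {classic Vdual C rstar}) (fun xi : Vdual C rstar => pairL xi = F).

Definition Fop (k l : 'I_n.+1) (F : qfamily) : qfamily :=
  pairL (Edual k l (pairL_inv F)).

Definition Tminus (m : 'I_n) (F : qfamily) : qfamily :=
  fun q => F [ffun j => q j - (j == m)%:R].
Definition Tplus (m : 'I_n) (F : qfamily) : qfamily :=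
  fun q => F [ffun j => q j + (j == m)%:R].

Definition Acoef (q : {ffun 'I_n -> int}) (m : 'I_n) : C :=
  (\prod_(j < n.+1 | (m < j)%N) (q m - r j + j%:Z - m%:Z - 1)%:~R) /
  (\prod_(a < n | a != m) (q m - q a + a%:Z - m%:Z)%:~R).

Definition Bcoef (q : {ffun 'I_n -> int}) (m : 'I_n) : C :=
  (\prod_(j < n.+1 | (j <= m)%N) (q m - r j + j%:Z - m%:Z)%:~R) /
  (\prod_(a < n | a != m) (q m - q a - m%:Z + a%:Z)%:~R).

End Kernel.

(* Main.v *)
From HB Require Import structures.
Require Import Defs.
From mathcomp Require Import all_boot all_order all_algebra.
From mathcomp Require Import fingroup perm mpoly complex.
From mathcomp Require Import boolp classical_sets functions reals topology normedtype derive.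
From mathcomp Require Import fintype finset.
From mathcomp Require Import zify ring.

Set Implicit Arguments.
Unset Strict Implicit.
Unset Printing Implicit Defensive.
Import Order.TTheory GRing.Theory Num.Theory.
Import numFieldNormedType.Exports.
Local Open Scope ring_scope.

Section Blockdet.
Variables (A : comNzRingType) (N : nat).
Implicit Types (z u : nat -> 'rV[A]_N) (x e : 'rV[A]_N).

Definition block_rows (a : nat) z u : 'M[A]_N :=
  \matrix_(i < N) (if (i < a)%N then z i else u (i - a)%N).

Definition blockdet (a : nat) z u : A := \det (block_rows a z u).

Definition upd u (j : nat) x : nat -> 'rV[A]_N :=
  fun k => if k == j then x else u k.

Lemma upd_same u j x : upd u j x j = x.
Proof. by rewrite /upd eqxx. Qed.

Lemma upd_neq u j x k : k != j -> upd u j x k = u k.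
Proof. by rewrite /upd => /negPf->. Qed.

Lemma eq_blockdet a z u v :
  (forall j, (a + j < N)%N -> u j = v j) -> blockdet a z u = blockdet a z v.
Proof.
move=> euv; congr (\det _); apply/row_matrixP => i; rewrite !rowK.
by case: ltnP => // lai; apply: euv; rewrite subnKC.
Qed.

Lemma blockdet_upd_id a z u j : blockdet a z (upd u j (u j)) = blockdet a z u.
Proof. by apply: eq_blockdet => k _; rewrite /upd; case: eqP => // ->. Qed.

Lemma blockdet_zu a z u l j :
  (l < a)%N -> (a + j < N)%N -> z l = u j -> blockdet a z u = 0.
Proof.
move=> la aj zu; have lN : (l < N)%N by lia.
apply: (@determinant_alternate _ _ _ (Ordinal lN) (Ordinal aj)).
  by apply/eqP => -[]; lia.
move=> c; rewrite !mxE /= la zu.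
by rewrite ltnNge leq_addr /= addKn.
Qed.

Lemma blockdet_uu a z u j k :
  (a + j < N)%N -> (a + k < N)%N -> j != k -> u j = u k -> blockdet a z u = 0.
Proof.
move=> aj ak jk ujk.
apply: (@determinant_alternate _ _ _ (Ordinal aj) (Ordinal ak)).
  by apply/eqP => -[]; lia.
by move=> c; rewrite !mxE /= !ltnNge !leq_addr /= !addKn ujk.
Qed.

(** Replacing one row of a determinant gives a linear form in that row; its
    coefficients are the cofactors. *)
Lemma blockdet_linear a z u j : (a + j < N)%N ->
  exists l : 'cV[A]_N, forall x, blockdet a z (upd u j x) = (x *m l) 0 0.
Proof.
move=> aj; pose i := Ordinal aj.
exists (\col_c cofactor (block_rows a z u) i c) => x.
rewrite /blockdet (expand_det_row _ i) mxE; apply: eq_bigr => c _.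
rewrite !mxE /= ltnNge leq_addr /= addKn upd_same; congr (_ * _).
rewrite /cofactor; congr (_ * \det _); apply/matrixP => s t; rewrite !mxE.
case: ltnP => // las; rewrite upd_neq //; apply/eqP => E.
have /eqP := neq_lift i s; apply; apply: val_inj.
by rewrite -[RHS](subnKC las) E.
Qed.

(** Cramer's rule: x is the combination of the rows of a matrix whose
    coefficients are the determinants with x substituted for a row; the first
    a rows drop out under a linear form that kills them. *)
Lemma blockdet_cramer a z u x (l : 'cV[A]_N) : (a <= N)%N ->
  (forall i, (i < a)%N -> (z i *m l) 0 0 = 0) ->
  \sum_(0 <= j < N - a) blockdet a z (upd u j x) * (u j *m l) 0 0 =
  blockdet a z u * (x *m l) 0 0.
Proof.
move=> aN zl; set M := block_rows a z u.
have <- : \sum_i (x *m \adj M) 0 i * (M *m l) i 0 = \det M * (x *m l) 0 0.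
  transitivity ((x *m \adj M *m (M *m l)) 0 0); first by rewrite [RHS]mxE.
  by rewrite mulmxA -[x *m _ *m _]mulmxA mul_adj_mx mul_mx_scalar -scalemxAl mxE.
have rowl (i : 'I_N) : (M *m l) i 0 = (row i M *m l) 0 0.
  by rewrite -row_mul [RHS]mxE.
rewrite [RHS](bigID (fun i : 'I_N => (i < a)%N)) /= [X in _ = X + _]big1 ?add0r; last first.
  by move=> i ia; rewrite rowl rowK ia zl ?mulr0.
have -> : \sum_(0 <= j < N - a) blockdet a z (upd u j x) * (u j *m l) 0 0 =
  \sum_(a <= i < N) blockdet a z (upd u (i - a) x) * (u (i - a)%N *m l) 0 0.
  by have := big_addn 0 N a xpredT
       (fun i => blockdet a z (upd u (i - a) x) * (u (i - a)%N *m l) 0 0);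
     rewrite add0n => ->; apply: eq_bigr => j _; rewrite addnK.
rewrite big_geq_mkord; apply: eq_big => [i|i /= ai]; first by rewrite /= -leqNgt.
rewrite rowl rowK ltnNge ai /=; congr (_ * _).
rewrite /blockdet (expand_det_row _ i) mxE; apply: eq_bigr => c _.
rewrite !mxE ltnNge ai /= upd_same; congr (_ * _).
rewrite /cofactor; congr (_ * \det _); apply/matrixP => s t; rewrite !mxE.
case: ltnP => // las; rewrite upd_neq //; apply/eqP => E.
have /eqP := neq_lift i s; apply; apply: val_inj.
by rewrite -[RHS](subnKC las) E subnKC.
Qed.

End Blockdet.

(** Quadratic relations between the determinants whose rows are an initial
    piece of a fixed sequence z and an initial piece of a sequence u, possibly
    with one entry of u replaced. *)
Section Quadratic.
Variables (A : comNzRingType) (n : nat) (z u : nat -> 'rV[A]_n.+1) (e : 'rV[A]_n.+1).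

Definition Phid (i : nat) : A := blockdet (n - i) z u.
Definition Dd (i j : nat) : A := blockdet (n - i) z (upd u j e).
Definition Psid (i : nat) : A := Dd i i.
Definition Phis (i k : nat) x : A := blockdet (n - i) z (upd u k x).
Definition Psis (i k : nat) x : A := blockdet (n - i) z (upd (upd u i e) k x).

Lemma sum_Dd_Phis k al i : (k <= al < i)%N -> (i < n)%N ->
  \sum_(al.+1 <= j < i.+1) Dd i j * Phis al k (u j) =
  Phid i * Dd al k - Dd i k * Phid al.
Proof.
move=> /andP[kal ali] ltin.
have [|l lE] := @blockdet_linear A n.+1 (n - al) z u k; first by lia.
have := @blockdet_cramer A n.+1 (n - i) z u e l.
rewrite -[(e *m l) 0 0]lE -/(Phid i) -/(Dd al k) => <-; [|by lia|]; last first.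
  move=> s si; rewrite -lE; apply: (@blockdet_zu _ _ _ _ _ s k); try lia.
  by rewrite upd_same.
have -> : (n.+1 - (n - i) = i.+1)%N by lia.
rewrite [X in _ = X - _](big_cat_nat (n := al.+1)) /=; try lia.
have kin : k \in index_iota 0 al.+1 by rewrite mem_index_iota; lia.
rewrite [X in _ = X + _ - _](bigD1_seq k kin (iota_uniq _ _)) /=.
rewrite [X in _ = _ + X + _ - _]big_seq_cond [X in _ = _ + X + _ - _]big1 => [|j]; last first.
  rewrite mem_index_iota => /andP[jal njk]; rewrite -lE.
  rewrite [X in _ * X](@blockdet_uu _ _ _ _ _ j k) ?mulr0 //; try lia.
  by rewrite upd_neq // upd_same.
rewrite addr0 -lE blockdet_upd_id -/(Phid al) -/(Dd i k) addrAC subrr add0r.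
by apply: eq_bigr => j _; rewrite -lE.
Qed.

Lemma sum_Dd_Psis k al i : (k < al <= i)%N -> (i < n)%N ->
  \sum_(al <= j < i.+1) Dd i j * Psis al k (u j) = - (Dd i k * Psid al).
Proof.
move=> /andP[kal ali] ltin.
have [|l lE] := @blockdet_linear A n.+1 (n - al) z (upd u al e) k; first by lia.
have := @blockdet_cramer A n.+1 (n - i) z u e l.
rewrite -[X in _ -> _ -> _ = _ * X]lE.
rewrite [X in _ -> _ -> _ = _ * X](@blockdet_uu _ _ _ _ _ k al); try lia; last first.
  by rewrite upd_same upd_neq ?upd_same //; lia.
move=> Hc; apply/eqP; rewrite -addr_eq0 -[X in _ == X](mulr0 (blockdet (n - i) z u)).
rewrite -Hc; [|by lia|]; last first.
  move=> s si; rewrite -lE; apply: (@blockdet_zu _ _ _ _ _ s k); try lia.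
  by rewrite upd_same.
have -> : (n.+1 - (n - i) = i.+1)%N by lia.
rewrite [X in _ == X](big_cat_nat (n := al)) /=; try lia.
have kin : k \in index_iota 0 al by rewrite mem_index_iota; lia.
rewrite [X in _ == X + _](bigD1_seq k kin (iota_uniq _ _)) /=.
rewrite [X in _ == _ + X + _]big_seq_cond [X in _ == _ + X + _]big1 => [|j]; last first.
  rewrite mem_index_iota => /andP[jal njk]; rewrite -lE.
  rewrite [X in _ * X](@blockdet_uu _ _ _ _ _ j k) ?mulr0 //; try lia.
  by rewrite upd_neq // upd_same upd_neq //; lia.
rewrite addr0 -lE addrC.
have -> : u k = upd u al e k by rewrite upd_neq //; lia.
rewrite blockdet_upd_id -/(Psid al) -/(Dd i k); apply/eqP; congr (_ + _).
by apply: eq_bigr => j _; rewrite -lE.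
Qed.

Lemma sum_Phis_Phis i al k : (i <= al < k)%N -> (k < n)%N ->
  \sum_(i <= j < al.+1) Phis i i (u j) * Phis al j (u k) =
  Phis i i (u k) * Phid al.
Proof.
move=> /andP[ial alk] ltkn.
have [|l lE] := @blockdet_linear A n.+1 (n - i) z u i; first by lia.
have := @blockdet_cramer A n.+1 (n - al) z u (u k) l.
rewrite -[X in _ -> _ -> _ = _ * X]lE [RHS]mulrC => <-; [|by lia|]; last first.
  move=> s si; rewrite -lE; apply: (@blockdet_zu _ _ _ _ _ s i); try lia.
  by rewrite upd_same.
have -> : (n.+1 - (n - al) = al.+1)%N by lia.
rewrite [RHS](big_cat_nat (n := i)) /=; try lia.
rewrite [X in _ = X + _]big_seq_cond [X in _ = X + _]big1 => [|j]; last first.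
  rewrite mem_index_iota => /andP[jal _]; rewrite -lE.
  rewrite [X in _ * X](@blockdet_uu _ _ _ _ _ j i) ?mulr0 //; try lia.
  by rewrite upd_same upd_neq //; lia.
by rewrite add0r; apply: eq_bigr => j _; rewrite -lE mulrC.
Qed.

Lemma sum_Phis_Psis i al k : (i < al <= k)%N -> (k < n)%N ->
  \sum_(i <= j < al) Phis i i (u j) * Psis al j (u k) =
  Phis i i (u k) * Psid al - Psid i * Phis al al (u k).
Proof.
move=> /andP[ial alk] ltkn.
have [|l lE] := @blockdet_linear A n.+1 (n - i) z u i; first by lia.
have := @blockdet_cramer A n.+1 (n - al) z (upd u al e) (u k) l.
rewrite -[X in _ -> _ -> _ = _ * X]lE [Phis i i _ * _]mulrC => <-; [|by lia|]; last first.
  move=> s si; rewrite -lE; apply: (@blockdet_zu _ _ _ _ _ s i); try lia.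
  by rewrite upd_same.
have -> : (n.+1 - (n - al) = al.+1)%N by lia.
rewrite big_nat_recr //= upd_same -lE -/(Dd i i) -/(Psid i).
have -> : blockdet (n - al) z (upd (upd u al e) al (u k)) = Phis al al (u k).
  by apply: eq_blockdet => j _; rewrite /upd; case: eqP.
rewrite mulrC addrK.
rewrite [RHS](big_cat_nat (n := i)) /=; try lia.
rewrite [X in _ = X + _]big_seq_cond [X in _ = X + _]big1 => [|j]; last first.
  rewrite mem_index_iota => /andP[jal _]; rewrite -lE.
  rewrite [X in _ * X](@blockdet_uu _ _ _ _ _ j i) ?mulr0 //; try lia.
  by rewrite upd_same !upd_neq //; lia.
rewrite add0r big_seq_cond [RHS]big_seq_cond; apply: eq_bigr => j.
rewrite mem_index_iota => /andP[jal _]; rewrite -lE mulrC /Psis; congr (_ * _).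
by congr blockdet; congr upd; rewrite upd_neq //; lia.
Qed.

End Quadratic.

Section NatSums.
Variable V : nmodType.

Lemma big_nat_subrange (a a' b' b : nat) (F : nat -> V) :
  (a <= a')%N -> (b' <= b)%N ->
  (forall i, (a <= i < b)%N -> ~~ (a' <= i < b')%N -> F i = 0) ->
  \sum_(a <= i < b) F i = \sum_(a' <= i < b') F i.
Proof.
move=> aa bb F0; rewrite -!(@big_filter _ _ _ _ (index_iota _ _) xpredT) !filter_predT.
rewrite (bigID (fun i => a' <= i < b')%N) /= addrC big_seq_cond big1 ?add0r.
  rewrite -big_filter; congr bigop; apply: (irr_sorted_eq ltn_trans ltnn) => [||i].
  - by apply: (sorted_filter ltn_trans); apply: iota_ltn_sorted.
  - exact: iota_ltn_sorted.
  by rewrite mem_filter !mem_index_iota; lia.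
by move=> i /andP[]; rewrite mem_index_iota; apply: F0.
Qed.

Lemma sum_triangle_lt k i (F : nat -> nat -> V) :
  \sum_(k.+1 <= j < i.+1) \sum_(k <= al < j) F j al =
  \sum_(k <= al < i) \sum_(al.+1 <= j < i.+1) F j al.
Proof.
transitivity (\sum_(k.+1 <= j < i.+1) \sum_(k <= al < i)
    if (al < j)%N then F j al else 0).
  apply: eq_big_nat => j ji; rewrite [RHS](@big_nat_subrange k k j i) //; try lia.
    by apply: eq_big_nat => al /andP[_ ->].
  by move=> al H H'; case: ifP => //; lia.
rewrite exchange_big /=; apply: eq_big_nat => al ali.
rewrite (@big_nat_subrange _ al.+1 i.+1) //; try lia.
  by apply: eq_big_nat => j /andP[-> _].
by move=> j H H'; case: ifP => //; lia.
Qed.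

Lemma sum_triangle_le k i (F : nat -> nat -> V) :
  \sum_(k <= j < i) \sum_(k <= al < j.+1) F j al =
  \sum_(k <= al < i) \sum_(al <= j < i) F j al.
Proof.
transitivity (\sum_(k <= j < i) \sum_(k <= al < i)
    if (al < j.+1)%N then F j al else 0).
  apply: eq_big_nat => j ji; rewrite [RHS](@big_nat_subrange k k j.+1 i) //; try lia.
    by apply: eq_big_nat => al /andP[_ ->].
  by move=> al H H'; case: ifP => //; lia.
rewrite exchange_big /=; apply: eq_big_nat => al ali.
rewrite (@big_nat_subrange _ al i) //; try lia.
  by apply: eq_big_nat => j /andP[]; rewrite ltnS => -> _.
by move=> j H H'; case: ifP => //; lia.
Qed.

End NatSums.

Section Derivations.
Variables (A B : comNzRingType) (f : {rmorphism A -> B}) (d : {additive A -> B}).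
Hypothesis dM : forall x y, d (x * y) = d x * f y + f x * d y.

Lemma deriv1 : d 1 = 0.
Proof.
have := dM 1 1; rewrite !mulr1 rmorph1 mulr1 mul1r => /eqP.
by rewrite -subr_eq0 opprD addrA subrr sub0r oppr_eq0 => /eqP.
Qed.

Lemma deriv_nat (m : nat) : d m%:R = 0.
Proof. by rewrite raddfMn deriv1 mul0rn. Qed.

Lemma deriv_int (m : int) : d m%:~R = 0.
Proof. by rewrite raddfMz deriv1 mul0rz. Qed.

Lemma derivMint (m : int) x : d (m%:~R * x) = m%:~R * d x.
Proof. by rewrite dM deriv_int mul0r add0r rmorph_int. Qed.

Lemma deriv_exp x m : d (x ^+ m) = f x ^+ m.-1 * d x *+ m.
Proof.
elim: m => [|m IH]; first by rewrite expr0 deriv1.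
rewrite exprS dM IH rmorphXn /= mulrC; case: m {IH} => [|m] /=.
  by rewrite mulr0n mulr0 addr0.
by rewrite mulrnAr mulrA -exprS -mulrS.
Qed.

Lemma deriv_prod_exp n (x : nat -> A) (e : nat -> nat) :
  d (\prod_(i < n) x i ^+ e i) =
  \sum_(i < n) (\prod_(j < n) f (x j) ^+ (e j - (j == i :> nat))) * d (x i) *+ e i.
Proof.
elim: n => [|n IH]; first by rewrite !big_ord0 deriv1.
rewrite !big_ord_recr /= dM IH deriv_exp; congr (_ + _).
  rewrite mulr_suml; apply: eq_bigr => i _; rewrite big_ord_recr /=.
  have /negPf -> : (n != i :> nat) by have := ltn_ord i; lia.
  by rewrite subn0 rmorphXn /= mulrnAl mulrAC.
rewrite eqxx subn1 mulrnAr; congr (_ *+ _).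
rewrite mulrA rmorph_prod; congr (_ * _ * _); apply: eq_bigr => i _.
have /negPf -> : (i != n :> nat) by have := ltn_ord i; lia.
by rewrite subn0 rmorphXn.
Qed.

End Derivations.

(** A derivation that kills every row but the k-th one acts on the determinant
    through that row only. *)
Section DetDerivation.
Variables (A : comNzRingType) (d : {additive A -> A}).
Hypothesis dM : forall x y, d (x * y) = d x * y + x * d y.

Let d1 : d 1 = 0 := deriv1 (f := idfun) dM.

Let deriv_sign (m : nat) : d ((-1) ^+ m) = 0.
Proof. by rewrite -signr_odd; case: odd; rewrite /= ?raddfN d1 ?oppr0. Qed.

Lemma deriv_det_const m (M : 'M[A]_m) : (forall i j, d (M i j) = 0) -> d (\det M) = 0.
Proof.
move=> M0; rewrite raddf_sum big1 // => s _.
rewrite dM deriv_sign mul0r add0r.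
suff -> : d (\prod_i M i (s i)) = 0 by rewrite mulr0.
elim/big_ind: _ => [|x y dx dy|i _] //.
by rewrite dM dx dy mul0r mulr0 addr0.
Qed.

Lemma deriv_det_row m (M M' : 'M[A]_m) (k : 'I_m) :
  (forall i j, i != k -> d (M i j) = 0) ->
  (forall i j, M' i j = if i == k then d (M k j) else M i j) ->
  d (\det M) = \det M'.
Proof.
move=> M0 M'E; rewrite !(expand_det_row _ k) raddf_sum; apply: eq_bigr => j _.
rewrite dM M'E eqxx.
have -> : cofactor M' k j = cofactor M k j.
  rewrite /cofactor; congr (_ * \det _); apply/matrixP => s t; rewrite !mxE M'E.
  by rewrite eq_sym (negPf (neq_lift _ _)).
suff -> : d (cofactor M k j) = 0 by rewrite mulr0 addr0.
rewrite /cofactor dM deriv_det_const ?mulr0 ?addr0 => [|s t]; last first.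
  by rewrite !mxE M0 // eq_sym neq_lift.
by rewrite deriv_sign mul0r.
Qed.

Lemma deriv_blockdet0 N a (z u : nat -> 'rV[A]_N) :
  (forall l c, (l < a)%N -> d (z l 0 c) = 0) ->
  (forall l c, (a + l < N)%N -> d (u l 0 c) = 0) ->
  d (blockdet a z u) = 0.
Proof.
move=> z0 u0; apply: deriv_det_const => i j; rewrite mxE.
by case: ltnP => [/z0|ai] //; apply: u0; rewrite subnKC.
Qed.

Lemma deriv_blockdet N a (z u : nat -> 'rV[A]_N) k (x : 'rV[A]_N) :
  (a + k < N)%N ->
  (forall l c, (l < a)%N -> d (z l 0 c) = 0) ->
  (forall l c, (a + l < N)%N -> l != k -> d (u l 0 c) = 0) ->
  (forall c, d (u k 0 c) = x 0 c) ->
  d (blockdet a z u) = blockdet a z (upd u k x).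
Proof.
move=> ak z0 u0 ux; apply: (@deriv_det_row _ _ _ (Ordinal ak)) => i j.
  move=> ik; rewrite mxE; case: ltnP => [/z0|ai] //; apply: u0; first by rewrite subnKC.
  by apply: contraNneq ik => E; apply/eqP/val_inj; rewrite /= -E subnKC.
rewrite !mxE /= [(a + k < a)%N]ltnNge leq_addr /= addKn ux.
case: eqP => [->|ik] /=; first by rewrite ltnNge leq_addr /= addKn upd_same.
case: ltnP => // ai; rewrite upd_neq //; apply/eqP => E; case: ik; apply: val_inj.
by rewrite /= -E subnKC.
Qed.

End DetDerivation.

Lemma blockdet_swap (A : comNzRingType) N a (z u v : nat -> 'rV[A]_N) j k :
  (a + j < N)%N -> (a + k < N)%N -> j != k ->
  v j = u k -> v k = u j -> (forall l, l != j -> l != k -> v l = u l) ->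
  blockdet a z v = - blockdet a z u.
Proof.
move=> aj ak jk vj vk vl; rewrite /blockdet.
have -> : block_rows a z v = xrow (Ordinal aj) (Ordinal ak) (block_rows a z u).
  apply/row_matrixP => i; rewrite rowK; apply/rowP => c; rewrite !mxE.
  case: tpermP => [->|->|/eqP ij /eqP ik] /=.
  - by rewrite !ltnNge !leq_addr /= !addKn vj.
  - by rewrite !ltnNge !leq_addr /= !addKn vk.
  case: ltnP => // ai; rewrite vl //.
    by apply: contraNneq ij => E; apply/eqP/val_inj; rewrite /= -E subnKC.
  by apply: contraNneq ik => E; apply/eqP/val_inj; rewrite /= -E subnKC.
rewrite xrowE det_mulmx det_perm odd_tperm.
have -> : Ordinal aj != Ordinal ak by apply: contraNneq jk => -[/addnI ->].
by rewrite expr1 mulN1r.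
Qed.

Definition decr (e : nat -> nat) (i : nat) : nat -> nat :=
  fun j => (e j - (j == i))%N.

Definition incr (e : nat -> nat) (i : nat) : nat -> nat :=
  fun j => (e j + (j == i))%N.

Lemma incrK e i : decr (incr e i) i =1 e.
Proof. by move=> j; rewrite /decr /incr addnK. Qed.

Section KernelMonomial.
Variables (A : comNzRingType) (n : nat) (z u : nat -> 'rV[A]_n.+1) (e : 'rV[A]_n.+1).

(** The kernel L of the representation; ea and eb are the exponents of the
    two families of determinants. *)
Definition Lmon (ea eb : nat -> nat) : A :=
  (\prod_(i < n) Phid z u i ^+ ea i) * (\prod_(i < n) Psid z u e i ^+ eb i).

Lemma prod_exp_decr (x : nat -> A) (ex : nat -> nat) i : (i < n)%N -> (0 < ex i)%N ->
  \prod_(j < n) x j ^+ ex j = x i * \prod_(j < n) x j ^+ decr ex i j.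
Proof.
move=> lt_in ex0; rewrite (bigD1 (Ordinal lt_in)) //= [in RHS](bigD1 (Ordinal lt_in)) //=.
rewrite mulrA /decr eqxx subn1 -exprS prednK //; congr (_ * _).
apply: eq_bigr => j; rewrite -val_eqE /= => /negPf ->; by rewrite subn0.
Qed.

Lemma Lmon_decr_Phi ea eb i : (i < n)%N -> (0 < ea i)%N ->
  Lmon ea eb = Phid z u i * Lmon (decr ea i) eb.
Proof. by move=> lt_in ei; rewrite /Lmon (prod_exp_decr _ lt_in ei) mulrA. Qed.

Lemma Lmon_decr_Psi ea eb i : (i < n)%N -> (0 < eb i)%N ->
  Lmon ea eb = Psid z u e i * Lmon ea (decr eb i).
Proof. by move=> lt_in ei; rewrite /Lmon (prod_exp_decr _ lt_in ei) mulrCA. Qed.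

Lemma eq_Lmon ea ea' eb eb' : ea =1 ea' -> eb =1 eb' -> Lmon ea eb = Lmon ea' eb'.
Proof.
by move=> Ea Eb; congr (_ * _); apply: eq_bigr => i _; rewrite ?Ea ?Eb.
Qed.

Lemma Lmon_shift_lower ea eb m : (m < n)%N ->
  Lmon (decr ea m) (incr eb m) = Lmon (decr ea m) eb * Dd z u e m m.
Proof.
move=> mn; rewrite (@Lmon_decr_Psi _ _ m mn) ?/incr ?eqxx ?addn1 // mulrC.
by congr (_ * _); apply: eq_Lmon => // j; rewrite -[RHS](incrK eb m).
Qed.

Lemma Lmon_shift_upper ea eb m : (m < n)%N ->
  Lmon (incr ea m) (decr eb m) = Lmon ea (decr eb m) * Phis z u m m (u m).
Proof.
move=> mn; rewrite (@Lmon_decr_Phi _ _ m mn) ?/incr ?eqxx ?addn1 // mulrC.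
rewrite /Phis blockdet_upd_id; congr (_ * _).
by apply: eq_Lmon => // j; rewrite -[RHS](incrK ea m).
Qed.

End KernelMonomial.

Section RowOperators.
Variables (A : idomainType) (n : nat) (z u : nat -> 'rV[A]_n.+1) (e : 'rV[A]_n.+1).
Variable R : nat -> nat -> {additive A -> A}.
Hypothesis RM : forall k j x y, R k j (x * y) = R k j x * y + x * R k j y.
Hypothesis Rz : forall k j l c, R k j (z l 0 c) = 0.
Hypothesis Re : forall k j c, R k j (e 0 c) = 0.
Hypothesis Ru : forall k j i c, (k < j < n)%N -> (i < n)%N ->
  R k j (u i 0 c) = if i == k then u j 0 c else 0.

Local Notation Phi := (Phid z u).
Local Notation D := (Dd z u e).
Local Notation Psi := (Psid z u e).
Local Notation Phis := (Phis z u).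
Local Notation Psis := (Psis z u e).

Lemma R_Phi k j i : (k < j < n)%N -> (i < n)%N ->
  R k j (Phi i) = if (k <= i < j)%N then Phis i k (u j) else 0.
Proof.
move=> kj lt_in; case: (leqP k i) => [ki|ik] /=; last first.
  apply: deriv_blockdet0 => [x y|l c _|l c ll]; rewrite ?Rz // Ru //; try lia.
  by case: eqP => //; lia.
have -> : R k j (Phi i) = Phis i k (u j).
  apply: deriv_blockdet => [x y||l c _|l c ll lk|c]; rewrite ?Rz // ?Ru //; try lia.
    by rewrite (negPf lk).
  by rewrite eqxx.
case: ltnP => // ji.
by apply: (@blockdet_uu _ _ _ _ _ k j); rewrite ?upd_same ?upd_neq //; lia.
Qed.

Lemma R_Psi k j i : (k < j < n)%N -> (i < n)%N ->
  R k j (Psi i) = if (k < i <= j)%N then Psis i k (u j) else 0.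
Proof.
move=> kj lt_in; case: (ltnP k i) => [ki|ik] /=; last first.
  apply: deriv_blockdet0 => [x y|l c _|l c ll]; rewrite ?Rz // /upd.
  by case: eqP => // /eqP li; rewrite Ru //; try case: eqP => //; lia.
have -> : R k j (Psi i) = Psis i k (u j).
  apply: deriv_blockdet => [x y||l c _|l c ll lk|c]; rewrite ?Rz //; try lia.
    by rewrite /upd; case: eqP => // /eqP li; rewrite Ru ?(negPf lk) //; lia.
  by rewrite upd_neq ?Ru ?eqxx //; lia.
case: leqP => // ji.
apply: (@blockdet_uu _ _ _ _ _ k j); rewrite ?upd_same //; try lia.
by rewrite !upd_neq //; lia.
Qed.

Lemma R_D k j i : (k < j <= i)%N -> (i < n)%N -> R k j (D i j) = - D i k.
Proof.
move=> kj lt_in.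
have -> : R k j (D i j) = blockdet (n - i) z (upd (upd u j e) k (u j)).
  apply: deriv_blockdet => [x y||l c _|l c ll lk|c]; rewrite ?Rz //; try lia.
    by rewrite /upd; case: eqP => // lj; rewrite Ru ?(negPf lk) //; lia.
  by rewrite upd_neq ?Ru ?eqxx //; lia.
apply: (@blockdet_swap _ _ _ _ _ _ j k); try lia.
- by rewrite upd_neq ?upd_same //; lia.
- by rewrite upd_same upd_neq //; lia.
- by move=> l lj lk; rewrite !upd_neq.
Qed.

Lemma R_Phis i j k : (i <= j < k)%N -> (k < n)%N ->
  R j k (Phis i i (u j)) = Phis i i (u k).
Proof.
move=> ij ltkn.
have -> : R j k (Phis i i (u j)) = blockdet (n - i) z (upd (upd u i (u j)) i (u k)).
  apply: deriv_blockdet => [x y||l c _|l c ll lk|c]; rewrite ?Rz //; try lia.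
    rewrite upd_neq // Ru //; try lia.
    by case: eqP => //; lia.
  by rewrite upd_same Ru ?eqxx //; lia.
by apply: eq_blockdet => l _; rewrite /upd; case: eqP.
Qed.

Variables ea eb : nat -> nat.

Local Notation L := (Lmon z u e ea eb).
Local Notation LPhi := (fun i => Lmon z u e (decr ea i) eb).
Local Notation LPsi := (fun i => Lmon z u e ea (decr eb i)).

Lemma R_Lmon k j : (k < j < n)%N ->
  R k j L = \sum_(k <= al < j) LPhi al * Phis al k (u j) *+ ea al +
            \sum_(k.+1 <= al < j.+1) LPsi al * Psis al k (u j) *+ eb al.
Proof.
move=> kj; rewrite /Lmon RM.
rewrite !(@deriv_prod_exp _ _ idfun (R k j) (RM k j)) /=; congr (_ + _).
  rewrite mulr_suml.
  transitivity (\sum_(0 <= al < n) LPhi al * R k j (Phi al) *+ ea al).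
    by rewrite big_mkord; apply: eq_bigr => i _; rewrite mulrnAl mulrAC.
  rewrite (@big_nat_subrange _ 0 k j n) //; try lia.
    by apply: eq_big_nat => al H; rewrite R_Phi ?H //; lia.
  by move=> al H H'; rewrite R_Phi ?(negPf H') ?mulr0 ?mul0rn //; lia.
rewrite mulr_sumr.
transitivity (\sum_(0 <= al < n) LPsi al * R k j (Psi al) *+ eb al).
  by rewrite big_mkord; apply: eq_bigr => i _; rewrite mulrnAr mulrA.
rewrite (@big_nat_subrange _ 0 k.+1 j.+1 n) //; try lia.
  by apply: eq_big_nat => al; rewrite ltnS => H; rewrite R_Psi ?H //; lia.
by move=> al H H'; rewrite R_Psi ?(negPf H') ?mulr0 ?mul0rn //; lia.
Qed.

Hypothesis Phi_neq0 : forall i, (i < n)%N -> Phi i != 0.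
Hypothesis Psi_neq0 : forall i, (i < n)%N -> Psi i != 0.

Variable y : nat -> int.
Hypothesis yE : forall i, (i.+1 < n)%N ->
  y i - y i.+1 = (ea i)%:Z + (eb i.+1)%:Z + 1.

Lemma sum_yE i k : (i <= k < n)%N ->
  \sum_(i <= al < k) (ea al)%:R + \sum_(i.+1 <= al < k.+1) (eb al)%:R + (k - i)%:R
  = (y i - y k)%:~R :> A.
Proof.
move=> ikn; have ik : (i <= k)%N by lia.
rewrite big_add1 /= -[(k - i)%N]muln1 -sum_nat_const_nat natr_sum -!big_split /=.
rewrite -opprB -(telescope_sumr y) // -sumrN raddf_sum /=.
apply: eq_big_nat => al H; rewrite opprB yE; last lia.
by rewrite !intrD.
Qed.

Local Notation G := (fun i j => LPhi i * D i j).

Lemma sum_R_G i k : (k <= i < n)%N -> (0 < ea i)%N ->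
  \sum_(k.+1 <= j < i.+1) R k j (G i j) =
  (y i - y k)%:~R * G i k + \sum_(k <= al < i) (ea al)%:R * G al k.
Proof.
move=> ki ei; have lt_in : (i < n)%N by lia.
have LE : L = Phi i * LPhi i by exact: Lmon_decr_Phi.
have PhiL al : (al < n)%N -> (ea al)%:R * LPhi al * Phi al = (ea al)%:R * L.
  move=> ln; case: (posnP (ea al)) => [->|ep]; first by rewrite !mul0r.
  by rewrite (Lmon_decr_Phi z u e eb ln ep) -mulrA; congr (_ * _); rewrite mulrC.
have PsiL al : (al < n)%N -> (eb al)%:R * LPsi al * Psi al = (eb al)%:R * L.
  move=> ln; case: (posnP (eb al)) => [->|ep]; first by rewrite !mul0r.
  by rewrite (Lmon_decr_Psi z u e ea ln ep) -mulrA; congr (_ * _); rewrite mulrC.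
apply: (mulfI (Phi_neq0 lt_in)).
have RG j : (k < j < i.+1)%N -> Phi i * R k j (G i j) = D i j * R k j L - L * D i k.
  move=> kj; have := RM k j (Phi i) (G i j).
  rewrite R_Phi; try lia.
  have -> : (k <= i < j)%N = false by lia.
  rewrite mul0r add0r => <-; rewrite mulrA -LE RM R_D; try lia.
  by rewrite mulrN mulrC.
rewrite mulr_sumr (eq_big_nat _ _ RG) sumrB sumr_const_nat subSS.
have -> : \sum_(k.+1 <= j < i.+1) D i j * R k j L =
    \sum_(k <= al < i) ((ea al)%:R * LPhi al) * (Phi i * D al k - D i k * Phi al)
  - \sum_(k.+1 <= al < i.+1) ((eb al)%:R * LPsi al) * (D i k * Psi al).
  transitivity (\sum_(k.+1 <= j < i.+1) \sum_(k <= al < j)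
       ((ea al)%:R * LPhi al) * (D i j * Phis al k (u j))
     + \sum_(k.+1 <= j < i.+1) \sum_(k.+1 <= al < j.+1)
       ((eb al)%:R * LPsi al) * (D i j * Psis al k (u j))).
    rewrite -big_split /=; apply: eq_big_nat => j H; rewrite R_Lmon; last lia.
    rewrite mulrDr !mulr_sumr; congr (_ + _); apply: eq_bigr => al _.
      by rewrite -mulr_natl; ring.
    by rewrite -mulr_natl; ring.
  rewrite sum_triangle_lt sum_triangle_le -sumrN; congr (_ + _);
    apply: eq_big_nat => al H; rewrite -mulr_sumr ?sum_Dd_Phis ?sum_Dd_Psis //;
    try lia.
  by rewrite mulrN.
have -> : \sum_(k <= al < i) (ea al)%:R * LPhi al * (Phi i * D al k - D i k * Phi al)
   = Phi i * (\sum_(k <= al < i) (ea al)%:R * G al k)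
     - L * D i k * \sum_(k <= al < i) (ea al)%:R.
  move: (D i k) => d; rewrite !mulr_sumr -sumrB; apply: eq_big_nat => al H.
  rewrite mulrBr; congr (_ - _); first by rewrite /=; ring.
  by rewrite mulrCA PhiL /=; [ring | lia].
have -> : \sum_(k.+1 <= al < i.+1) (eb al)%:R * LPsi al * (D i k * Psi al)
   = L * D i k * \sum_(k.+1 <= al < i.+1) (eb al)%:R.
  move: (D i k) => d; rewrite !mulr_sumr; apply: eq_big_nat => al H.
  by rewrite mulrCA PsiL /=; [ring | lia].
rewrite mulrDr -[y i - y k]opprB intrN -sum_yE // [Phi i * (- _ * _)]mulrCA mulrA.
rewrite -mulr_natr; set SA := \sum_(k <= al < i) (ea al)%:R.
set SB := \sum_(k.+1 <= al < i.+1) (eb al)%:R; set SG := \sum_(k <= al < i) _.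
rewrite LE; ring.
Qed.

Local Notation H := (fun i k => LPsi i * Phis i i (u k)).

Lemma sum_R_H i k : (i <= k < n)%N -> (0 < eb i)%N ->
  \sum_(i <= j < k) R j k (H i j) =
  (y i - y k)%:~R * H i k - \sum_(i.+1 <= al < k.+1) (eb al)%:R * H al k.
Proof.
move=> ik ei; have lt_in : (i < n)%N by lia.
have LE : L = Psi i * LPsi i by exact: Lmon_decr_Psi.
have PhiL al : (al < n)%N -> (ea al)%:R * LPhi al * Phi al = (ea al)%:R * L.
  move=> ln; case: (posnP (ea al)) => [->|ep]; first by rewrite !mul0r.
  by rewrite (Lmon_decr_Phi z u e eb ln ep) -mulrA; congr (_ * _); rewrite mulrC.
have PsiL al : (al < n)%N -> (eb al)%:R * LPsi al * Psi al = (eb al)%:R * L.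
  move=> ln; case: (posnP (eb al)) => [->|ep]; first by rewrite !mul0r.
  by rewrite (Lmon_decr_Psi z u e ea ln ep) -mulrA; congr (_ * _); rewrite mulrC.
apply: (mulfI (Psi_neq0 lt_in)).
have RH j : (i <= j < k)%N ->
    Psi i * R j k (H i j) = Phis i i (u j) * R j k L + L * Phis i i (u k).
  move=> ij; have := RM j k (Psi i) (H i j).
  rewrite R_Psi; try lia.
  have -> : (j < i <= k)%N = false by lia.
  rewrite mul0r add0r => <-; rewrite mulrA -LE RM R_Phis; try lia.
  by rewrite mulrC.
rewrite mulr_sumr (eq_big_nat _ _ RH) big_split sumr_const_nat /=.
have -> : \sum_(i <= j < k) Phis i i (u j) * R j k L =
    \sum_(i <= al < k) ((ea al)%:R * LPhi al) * (Phis i i (u k) * Phi al)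
  + \sum_(i.+1 <= al < k.+1) ((eb al)%:R * LPsi al) *
      (Phis i i (u k) * Psi al - Psi i * Phis al al (u k)).
  transitivity (\sum_(i <= j < k) \sum_(j <= al < k)
       ((ea al)%:R * LPhi al) * (Phis i i (u j) * Phis al j (u k))
     + \sum_(i <= j < k) \sum_(j.+1 <= al < k.+1)
       ((eb al)%:R * LPsi al) * (Phis i i (u j) * Psis al j (u k))).
    rewrite -big_split /=; apply: eq_big_nat => j jH; rewrite R_Lmon; last lia.
    rewrite mulrDr !mulr_sumr; congr (_ + _); apply: eq_bigr => al _.
      by rewrite -mulr_natl; ring.
    by rewrite -mulr_natl; ring.
  rewrite -(sum_triangle_lt i k (fun al j => (eb al)%:R * LPsi al *
      (Phis i i (u j) * Psis al j (u k)))).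
  rewrite -(sum_triangle_le i k (fun al j => (ea al)%:R * LPhi al *
      (Phis i i (u j) * Phis al j (u k)))).
  congr (_ + _); apply: eq_big_nat => al alH;
    by rewrite -mulr_sumr ?sum_Phis_Phis ?sum_Phis_Psis //; lia.
have -> : \sum_(i <= al < k) (ea al)%:R * LPhi al * (Phis i i (u k) * Phi al)
   = L * Phis i i (u k) * \sum_(i <= al < k) (ea al)%:R.
  move: (Phis i i (u k)) => d; rewrite !mulr_sumr; apply: eq_big_nat => al alH.
  by rewrite mulrCA PhiL /=; [ring | lia].
have -> : \sum_(i.+1 <= al < k.+1) (eb al)%:R * LPsi al *
      (Phis i i (u k) * Psi al - Psi i * Phis al al (u k))
   = L * Phis i i (u k) * (\sum_(i.+1 <= al < k.+1) (eb al)%:R)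
     - Psi i * \sum_(i.+1 <= al < k.+1) (eb al)%:R * H al k.
  move: (Phis i i (u k)) => d; rewrite !mulr_sumr -sumrB; apply: eq_big_nat => al alH.
  rewrite mulrBr; congr (_ - _); last by rewrite /=; ring.
  by rewrite mulrCA PsiL /=; [ring | lia].
rewrite mulrBr -sum_yE // [Psi i * (_ * _)]mulrCA mulrA.
rewrite -mulr_natr; set SA := \sum_(i <= al < k) (ea al)%:R.
set SB := \sum_(i.+1 <= al < k.+1) (eb al)%:R; set SG := \sum_(i.+1 <= al < _) _.
rewrite LE; ring.
Qed.

End RowOperators.

Section ChainRecursion.
Variables (A : comNzRingType) (R : nat -> nat -> {additive A -> A}).
Hypothesis RM : forall k j x y, R k j (x * y) = R k j x * y + x * R k j y.
Variables (G : nat -> nat -> A) (y : nat -> int) (m : nat).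

Definition gap (a b : nat) : int := \prod_(a <= l < b) (y m - y l).

Lemma gap_cat a b c : (a <= b <= c)%N -> gap a b * gap b c = gap a c.
Proof. by move=> /andP[ab bc]; rewrite /gap -big_cat_nat. Qed.

Lemma gapl a b : (a < b)%N -> gap a b = (y m - y a) * gap a.+1 b.
Proof. by move=> ab; rewrite /gap big_ltn. Qed.

Lemma gapr a b : (a <= b)%N -> gap a b.+1 = gap a b * (y m - y b).
Proof. by move=> ab; rewrite /gap big_nat_recr. Qed.

Let Rint k j (c : int) x : R k j (c%:~R * x) = c%:~R * R k j x.
Proof. exact: (derivMint (f := idfun) (RM k j)). Qed.

Section Lower.
Variables (ea : nat -> nat) (c : nat -> int) (P : nat -> A).
Hypothesis cE : forall k, (k < m)%N -> c k.+1 = (ea k)%:Z + (y m - y k).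

Definition lower_coef i : int :=
  if i == m then 1 else (ea i)%:Z * \prod_(i.+2 <= t < m.+1) c t.

Hypothesis Pm : P m = G m m.
Hypothesis Pk : forall k, (k < m)%N ->
  P k = \sum_(k.+1 <= j < m.+1) (gap k.+1 j)%:~R * R k j (P j).
Hypothesis RG : forall i k, (k <= i <= m)%N -> (i < m -> 0 < ea i)%N ->
  \sum_(k.+1 <= j < i.+1) R k j (G i j) =
  (y i - y k)%:~R * G i k + \sum_(k <= al < i) (ea al)%:R * G al k.

Lemma sum_lower_coef k : (k < m)%N ->
  \sum_(k.+1 <= i < m.+1) gap k.+1 i * lower_coef i = \prod_(k.+2 <= t < m.+1) c t.
Proof.
move: {2}(m - k)%N (leqnn (m - k)) => d; elim: d k => [|d IH] k dk km; first lia.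
rewrite [LHS]big_ltn; last lia.
have -> : gap k.+1 k.+1 = 1 by rewrite /gap big_geq.
rewrite mul1r /lower_coef; case: (ltngtP k.+1 m) => [km1|km1|km1]; try lia; last first.
  by rewrite !big_geq ?addr0 //; lia.
rewrite [in RHS]big_ltn; last lia.
rewrite cE // mulrDl; congr (_ + _).
rewrite -IH; try lia.
rewrite big_distrr /=; apply: eq_big_nat => i iH.
by rewrite gapl ?mulrA //; lia.
Qed.

Lemma chain_lower k : (k <= m)%N ->
  P k = \sum_(k <= i < m.+1) (gap k i * lower_coef i)%:~R * G i k.
Proof.
move: {2}(m - k)%N (leqnn (m - k)) => d; elim: d k => [|d IH] k dk km.
  have -> : k = m by lia.
  by rewrite big_nat1 Pm /gap big_geq // /lower_coef eqxx mul1r mul1r.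
case: (ltngtP k m) => [km1||->]; try lia; last first.
  by rewrite big_nat1 Pm /gap big_geq // /lower_coef eqxx mul1r mul1r.
rewrite Pk //.
transitivity (\sum_(k.+1 <= i < m.+1) \sum_(k.+1 <= j < i.+1)
    (gap k.+1 i * lower_coef i)%:~R * R k j (G i j)).
  rewrite [RHS](sum_triangle_le k.+1 m.+1
     (fun i j => (gap k.+1 i * lower_coef i)%:~R * R k j (G i j))).
  apply: eq_big_nat => j jH; rewrite IH; try lia.
  rewrite raddf_sum mulr_sumr; apply: eq_big_nat => i iH; rewrite Rint.
  by rewrite mulrA -intrM mulrA gap_cat //; lia.
transitivity (\sum_(k.+1 <= i < m.+1) (gap k.+1 i * lower_coef i)%:~R *
   ((y i - y k)%:~R * G i k + \sum_(k <= al < i) (ea al)%:R * G al k)).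
  apply: eq_big_nat => i iH; rewrite -mulr_sumr.
  have [e0|e0] := boolP ((i < m)%N && (ea i == 0%N)).
    rewrite /lower_coef; case: eqP => [|_]; first lia.
    by case/andP: e0 => _ /eqP ->; rewrite mul0r mulr0 !mul0r.
  by rewrite RG //; lia.
under eq_bigr => i _ do rewrite mulrDr mulr_sumr.
rewrite big_split /= [X in _ + X]
  (sum_triangle_lt k m (fun i al => (gap k.+1 i * lower_coef i)%:~R * ((ea al)%:R * G al k))).
have inner al : (k <= al < m)%N ->
    \sum_(al.+1 <= i < m.+1) (gap k.+1 i * lower_coef i)%:~R * ((ea al)%:R * G al k) =
    (gap k.+1 al.+1 * lower_coef al)%:~R * G al k.
  move=> alH.
  transitivity ((\sum_(al.+1 <= i < m.+1) gap k.+1 al.+1 * (gap al.+1 i * lower_coef i))%:~R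
     * (ea al)%:~R * G al k).
    rewrite rmorph_sum !mulr_suml; apply: eq_big_nat => i iH.
    rewrite -mulrA; congr (_ * _); rewrite mulrA gap_cat //; lia.
  rewrite -mulr_sumr sum_lower_coef; last lia.
  congr (_ * _); rewrite -intrM; congr (_%:~R); rewrite -mulrA; congr (_ * _).
  by rewrite /lower_coef; case: eqP => [|_]; [lia | rewrite mulrC].
rewrite (eq_big_nat _ _ inner) [X in _ + X]big_ltn // [RHS]big_ltn; last lia.
rewrite addrCA; congr (_ + _).
  by rewrite /gap !big_geq.
have -> : \sum_(k.+1 <= i < m) (gap k.+1 i.+1 * lower_coef i)%:~R * G i k =
          \sum_(k.+1 <= i < m.+1) (gap k.+1 i.+1 * lower_coef i)%:~R * G i k.
  rewrite [RHS]big_nat_recr //= gapr // subrr mulr0 mul0r mul0r addr0 //.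
rewrite -big_split /=; apply: eq_big_nat => i iH.
rewrite mulrA -mulrDl; congr (_ * _); rewrite -intrM -intrD; congr (_%:~R).
by rewrite gapr ?[gap k i]gapl; [ring | lia | lia].
Qed.

End Lower.

Section Upper.
Variables (t : nat) (eb : nat -> nat) (c : nat -> int) (P : nat -> A).
Hypothesis cE : forall k, (m < k <= t)%N -> c k = y m - y k - (eb k)%:Z.

Definition upper_coef i : int :=
  if i == m then 1 else - (eb i)%:Z * \prod_(m.+1 <= s < i) c s.

Hypothesis Pm : P m = G m m.
Hypothesis Pk : forall k, (m < k <= t)%N ->
  P k = \sum_(m <= j < k) (gap j.+1 k)%:~R * R j k (P j).
Hypothesis RG : forall i k, (m <= i <= k)%N -> (k <= t)%N -> (m < i -> 0 < eb i)%N ->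
  \sum_(i <= j < k) R j k (G i j) =
  (y i - y k)%:~R * G i k - \sum_(i.+1 <= al < k.+1) (eb al)%:R * G al k.

Lemma sum_upper_coef k : (m < k <= t.+1)%N ->
  \sum_(m <= i < k) gap i.+1 k * upper_coef i = \prod_(m.+1 <= s < k) c s.
Proof.
elim: k => [|k IH] kH; first lia.
case: (ltngtP m k) => [mk|mk|mk]; try lia; last first.
  by rewrite mk big_nat1 /upper_coef -mk eqxx /gap !big_geq // mulr1.
rewrite [RHS]big_nat_recr; last lia.
rewrite big_nat_recr /=; last lia.
rewrite -IH; last lia.
rewrite cE; last lia.
rewrite mulrBr mulr_suml; congr (_ + _).
  by apply: eq_big_nat => i iH; rewrite gapr; [ring | lia].
rewrite /gap big_geq // mul1r /upper_coef; case: eqP => [|_]; first lia.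
by rewrite -IH ?mulNr; [rewrite mulrC | lia].
Qed.

Lemma chain_upper k : (m <= k <= t)%N ->
  P k = \sum_(m <= i < k.+1) (gap i.+1 k.+1 * upper_coef i)%:~R * G i k.
Proof.
elim/ltn_ind: k => k IH kH; case: (ltngtP m k) => [mk||<-]; try lia; last first.
  by rewrite big_nat1 Pm /gap big_geq // /upper_coef eqxx mul1r mul1r.
rewrite Pk //; last lia.
transitivity (\sum_(m <= i < k) \sum_(i <= j < k)
    (gap i.+1 k * upper_coef i)%:~R * R j k (G i j)).
  rewrite -(sum_triangle_le m k
     (fun j i => (gap i.+1 k * upper_coef i)%:~R * R j k (G i j))).
  apply: eq_big_nat => j jH; rewrite IH; try lia.
  rewrite raddf_sum mulr_sumr; apply: eq_big_nat => i iH; rewrite Rint.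
  by rewrite mulrA -intrM mulrA [gap j.+1 k * _]mulrC gap_cat //; lia.
transitivity (\sum_(m <= i < k) (gap i.+1 k * upper_coef i)%:~R *
   ((y i - y k)%:~R * G i k - \sum_(i.+1 <= al < k.+1) (eb al)%:R * G al k)).
  apply: eq_big_nat => i iH; rewrite -mulr_sumr.
  have [e0|e0] := boolP ((m < i)%N && (eb i == 0%N)).
    rewrite /upper_coef; case: eqP => [|_]; first lia.
    by case/andP: e0 => _ /eqP ->; rewrite oppr0 mul0r mulr0 !mul0r.
  by rewrite RG //; lia.
under eq_bigr => i _ do rewrite mulrBr mulr_sumr.
rewrite sumrB /= -[X in _ - X]
  (sum_triangle_lt m k (fun al i => (gap i.+1 k * upper_coef i)%:~R * ((eb al)%:R * G al k))).
have inner al : (m.+1 <= al < k.+1)%N ->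
    \sum_(m <= i < al) (gap i.+1 k * upper_coef i)%:~R * ((eb al)%:R * G al k) =
    - ((gap al k * upper_coef al)%:~R * G al k).
  move=> alH.
  transitivity ((\sum_(m <= i < al) gap al k * (gap i.+1 al * upper_coef i))%:~R
     * (eb al)%:~R * G al k).
    rewrite rmorph_sum !mulr_suml; apply: eq_big_nat => i iH.
    by rewrite -mulrA; congr (_ * _); rewrite mulrA [gap al k * _]mulrC gap_cat //; lia.
  rewrite -mulr_sumr sum_upper_coef; last lia.
  rewrite -mulNr; congr (_ * _); rewrite -intrM -intrN; congr (_%:~R).
  rewrite -mulrA -mulrN; congr (_ * _).
  by rewrite /upper_coef; case: eqP => [|_]; [lia | rewrite mulNr opprK mulrC].
rewrite (eq_big_nat _ _ inner) sumrN opprK.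
have -> : \sum_(m.+1 <= i < k.+1) (gap i k * upper_coef i)%:~R * G i k =
          \sum_(m <= i < k.+1) (gap i k * upper_coef i)%:~R * G i k.
  rewrite [RHS]big_ltn; last lia.
  by rewrite gapl // subrr !mul0r add0r.
rewrite big_nat_recr; last lia.
rewrite [RHS]big_nat_recr /=; last lia.
rewrite addrA -big_split /=; congr (_ + _).
  apply: eq_big_nat => i iH.
  rewrite mulrA -mulrDl; congr (_ * _); rewrite -intrM -intrD; congr (_%:~R).
  by rewrite gapr ?[gap i k]gapl; [ring | lia | lia].
by rewrite /gap !big_geq.
Qed.

End Upper.

End ChainRecursion.

(** A derivation along a ring morphism is determined by its values on the
    constants and on the variables. *)
Lemma mpoly_derivation_eq0 (K A : comNzRingType) k
    (phi : {rmorphism {mpoly K[k]} -> A}) (d : {mpoly K[k]} -> A) :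
  additive d -> (forall f g, d (f * g) = d f * phi g + phi f * d g) ->
  (forall c, d c%:MP = 0) -> (forall v, d 'X_v = 0) -> forall f, d f = 0.
Proof.
move=> dA dM dC dX0.
have d0 : d 0 = 0 by have := dA 0 0; rewrite !subrr.
have dD f g : d (f + g) = d f + d g.
  have dN h : d (- h) = - d h by have := dA 0 h; rewrite !sub0r d0 sub0r.
  by rewrite -[g in LHS]opprK dA dN opprK.
have dXm m : d 'X_[m] = 0.
  rewrite mpolyXE_id; elim/big_ind: _ => [|f g df dg|v _].
  - by rewrite -mpolyC1 dC.
  - by rewrite dM df dg mul0r mulr0 addr0.
  elim: (m v) => [|s IH]; first by rewrite expr0 -mpolyC1 dC.
  by rewrite exprS dM IH dX0 mul0r mulr0 addr0.
elim/mpolyind => [|c m f mf c0 IH] //.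
by rewrite dD IH addr0 -mul_mpolyC dM dC dXm mul0r mulr0 addr0.
Qed.

Section GenericMatrix.
Variables (K : comNzRingType) (n : nat).
Implicit Types (f g : Npoly K n) (i j k l : 'I_n).

Lemma uvar_index_lt k l (kl : (k < l)%N) :
  uvar_index k l = Some (enum_rank (Sub (k, l) kl : upos n)).
Proof. by rewrite /uvar_index insubT. Qed.

Lemma uvar_index_ge k l : (l <= k)%N -> uvar_index k l = None.
Proof. by move=> lk; rewrite /uvar_index insubF //= ltnNge lk. Qed.

Lemma genericX (v : 'I_(nvars n)) :
  generic K n (val (enum_val v)).1 (val (enum_val v)).2 = 'X_v.
Proof.
rewrite mxE; case E: (enum_val v) => [[k l] kl] /=.
by rewrite (uvar_index_lt kl) -[Sub _ _]/(exist _ (k, l) kl) -E enum_valK.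
Qed.

Lemma generic_lt k l : (l < k)%N -> generic K n k l = 0.
Proof.
move=> lk; rewrite mxE uvar_index_ge; last exact: ltnW.
by rewrite -val_eqE gtn_eqF.
Qed.

Lemma generic_diag k : generic K n k k = 1.
Proof. by rewrite mxE uvar_index_ge ?eqxx. Qed.

Lemma partial_generic k j i c :
  partial k j (generic K n i c) = ((k < j)%N && (i == k) && (c == j))%:R.
Proof.
rewrite /partial; case: (ltnP k j) => [kj|jk]; last by rewrite uvar_index_ge.
rewrite (uvar_index_lt kj) mxE; case: (ltnP i c) => [ic|ci].
  rewrite (uvar_index_lt ic) mderivX mnm1E.
  set a := enum_rank _; set b := enum_rank _.
  have E : (a == b) = (i == k) && (c == j).
    by rewrite (inj_eq enum_rank_inj) -(inj_eq val_inj) /= xpair_eqE.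
  rewrite /= -E; case: eqP => [->|_]; last by rewrite scale0r.
  rewrite scale1r (_ : (_ - _)%MM = 0%MM) ?mpolyX0 //.
  by apply/mnmP => s; rewrite mnmBE mnm0E subnn.
rewrite uvar_index_ge // -mpolyC_nat mderivC.
by case: eqP => //= ik; case: eqP => //= cj; move: ci kj; rewrite ik cj; lia.
Qed.

Lemma RopE k l f : Rop k l f = \sum_j generic K n l j * partial k j f.
Proof.
rewrite /Rop [RHS](bigID (fun j : 'I_n => (l <= j)%N)) /= [X in _ = _ + X]big1 => [|j jl].
  rewrite addr0 [RHS](bigD1 l) //= generic_diag mul1r; congr (_ + _).
  by apply: eq_bigl => j; rewrite ltn_neqAle eq_sym andbC.
by rewrite generic_lt ?mul0r // ltnNge.
Qed.

Lemma partial_is_additive k l : additive (@partial K n k l).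
Proof. by move=> f g; rewrite /partial; case: uvar_index => [v|]; rewrite ?raddfB ?subrr. Qed.

Lemma partialM k l f g : partial k l (f * g) = partial k l f * g + f * partial k l g.
Proof.
by rewrite /partial; case: uvar_index => [v|]; rewrite ?mderivM ?mul0r ?mulr0 ?addr0.
Qed.

Lemma partialC k l c : partial k l (c%:MP) = 0 :> Npoly K n.
Proof. by rewrite /partial; case: uvar_index => [v|] //; rewrite mderivC. Qed.

Lemma Rop_is_additive k l : additive (@Rop K n k l).
Proof.
move=> f g; rewrite !RopE -sumrB; apply: eq_bigr => j _.
by rewrite partial_is_additive mulrBr.
Qed.

HB.instance Definition _ k l :=
  GRing.isAdditive.Build (Npoly K n) (Npoly K n) (Rop k l) (Rop_is_additive k l).

Lemma RopD k l f g : Rop k l (f + g) = Rop k l f + Rop k l g.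
Proof. exact: raddfD. Qed.

Lemma RopB k l f g : Rop k l (f - g) = Rop k l f - Rop k l g.
Proof. exact: raddfB. Qed.

Lemma Rop0 k l : Rop k l (0 : Npoly K n) = 0.
Proof. exact: raddf0. Qed.

Lemma RopM k l f g : Rop k l (f * g) = Rop k l f * g + f * Rop k l g.
Proof.
rewrite !RopE mulr_suml mulr_sumr -big_split; apply: eq_bigr => j _ /=.
by rewrite partialM; ring.
Qed.

Lemma RopC k l c : Rop k l c%:MP = 0 :> Npoly K n.
Proof. by rewrite RopE big1 // => j _; rewrite partialC mulr0. Qed.

Lemma Rop_generic k l i c : (k < l)%N ->
  Rop k l (generic K n i c) = if i == k then generic K n l c else 0.
Proof.
move=> kl; rewrite RopE; under eq_bigr => j _ do rewrite partial_generic.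
rewrite (bigD1 c) //= eqxx andbT big1 ?addr0 => [|j /negPf jc]; last first.
  by rewrite [c == j]eq_sym jc andbF mulr0.
case: eqP => [_|_]; rewrite ?andbF ?mulr0 // andbT.
by case: ltnP => [|ck]; rewrite ?mulr1 ?mulr0 // generic_lt // (leq_ltn_trans ck).
Qed.

Lemma derivation_eq0 (d : Npoly K n -> Npoly K n) :
  additive d -> (forall f g, d (f * g) = d f * g + f * d g) ->
  (forall c, d c%:MP = 0) -> (forall i c : 'I_n, (i < c)%N -> d (generic K n i c) = 0) ->
  forall f, d f = 0.
Proof.
move=> dA dM dC dX; apply: (mpoly_derivation_eq0 (phi := idfun)) => // v.
by rewrite -genericX; apply: dX; exact: (valP (enum_val v)).
Qed.

Lemma Rop_comm i j k f : (i < j < k)%N ->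
  Rop i j (Rop j k f) = Rop j k (Rop i j f) - Rop i k f.
Proof.
move=> /andP[ij jk]; have ik := ltn_trans ij jk.
apply/eqP; rewrite -subr_eq0 opprB addrA; apply/eqP.
pose d (h : Npoly K n) := Rop i j (Rop j k h) + Rop i k h - Rop j k (Rop i j h).
rewrite -[LHS]/(d f); apply: (@derivation_eq0 d).
- by move=> g h; rewrite /d !RopB; ring.
- by move=> g h; rewrite /d !(RopM, RopD); ring.
- by move=> c; rewrite /d !RopC addr0 subr0.
move=> s c sc; rewrite /d !Rop_generic // -!val_eqE.
have [sj|sj] /= := eqVneq (s : nat) j.
  have /negPf-> : (s != i :> nat) by lia.
  rewrite Rop_generic // Rop0 -val_eqE.
  have /negPf-> : (k != i :> nat) by lia.
  by rewrite addr0 subr0.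
rewrite Rop0 /=; case: eqP => si; rewrite ?Rop0 ?Rop_generic -?val_eqE ?eqxx //; ring.
Qed.

Lemma Rop_commute (a b : 'I_n) j k f : (a < b < j)%N -> (j < k)%N ->
  Rop a b (Rop j k f) = Rop j k (Rop a b f).
Proof.
move=> /andP[ab bj] jk; apply/eqP; rewrite -subr_eq0; apply/eqP.
pose d (h : Npoly K n) := Rop a b (Rop j k h) - Rop j k (Rop a b h).
rewrite -[LHS]/(d f); apply: (@derivation_eq0 d).
- by move=> g h; rewrite /d !RopB; ring.
- by move=> g h; rewrite /d !(RopM, RopD); ring.
- by move=> c; rewrite /d !RopC subr0.
move=> s c sc; rewrite /d !Rop_generic // -!val_eqE.
have [sj|sj] /= := eqVneq (s : nat) j.
  have /negPf-> : (s != a :> nat) by lia.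
  rewrite Rop_generic // Rop0 -val_eqE.
  have /negPf-> : (k != a :> nat) by lia.
  by rewrite subrr.
rewrite Rop0 /=; case: eqP => si; rewrite ?Rop0 ?Rop_generic -?val_eqE ?subrr //.
have /negPf-> : (b != j :> nat) by lia.
by rewrite subrr.
Qed.

(** The operators indexed by natural numbers, zero outside of the range. *)
Definition Rnat (k l : nat) : {additive Npoly K n -> Npoly K n} :=
  match insub k, insub l with
  | Some k', Some l' => Rop k' l'
  | _, _ => \0
  end.

Lemma Rnat_ord k l f : Rnat k l f = Rop k l f.
Proof. by rewrite /Rnat !valK. Qed.

Lemma RnatE (k l : nat) (kn : (k < n)%N) (ln : (l < n)%N) f :
  Rnat k l f = Rop (Ordinal kn) (Ordinal ln) f.
Proof. by rewrite -Rnat_ord. Qed.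

Lemma RnatM (k l : nat) f g : Rnat k l (f * g) = Rnat k l f * g + f * Rnat k l g.
Proof.
rewrite /Rnat; case: insub => [k'|]; last by rewrite /= mul0r mulr0 addr0.
by case: insub => [l'|] /=; rewrite ?RopM // mul0r mulr0 addr0.
Qed.

Lemma Rnat_comm (i j k : nat) f : (i < j < k)%N -> (k < n)%N ->
  Rnat i j (Rnat j k f) = Rnat j k (Rnat i j f) - Rnat i k f.
Proof.
move=> ijk kn; have jn : (j < n)%N by lia.
have iN : (i < n)%N by lia.
by rewrite !(RnatE iN jn) !(RnatE jn kn) !(RnatE iN kn) Rop_comm.
Qed.

Lemma Rnat_commute (a b j k : nat) f : (a < b < j)%N -> (j < k < n)%N ->
  Rnat a b (Rnat j k f) = Rnat j k (Rnat a b f).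
Proof.
move=> abj /andP[jk kn]; have jn : (j < n)%N by lia.
have an : (a < n)%N by lia.
have bn : (b < n)%N by lia.
by rewrite !(RnatE an bn) !(RnatE jn kn) Rop_commute.
Qed.

End GenericMatrix.

Section ChainSets.
Variable n : nat.
Implicit Types (I : {set 'I_n}) (i j k m : 'I_n).

Lemma spansP k m I :
  reflect [/\ forall i, i \in I -> (k <= i <= m)%N, k \in I & m \in I] (spans k m I).
Proof.
apply: (iffP and3P) => [[/subsetP Is /exists_inP[k' kI /eqP kk] /exists_inP[m' mI /eqP mm]]|].
  rewrite -(val_inj kk) -(val_inj mm); split=> // i /Is.
  by rewrite inE -kk -mm.
case=> Is kI mI; split; last by apply/exists_inP; exists m.
  by apply/subsetP => i /Is; rewrite inE.
by apply/exists_inP; exists k.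
Qed.

Lemma sorted_enum_ord I : sorted (fun i j : 'I_n => (i < j)%N) (enum I).
Proof.
rewrite {1}/enum_mem; apply: sorted_filter => [i j l|]; first exact: ltn_trans.
rewrite -enumT; have := iota_ltn_sorted 0 n.
by rewrite -val_enum_ord sorted_map.
Qed.

Lemma enum_setU1_lt k I : (forall i, i \in I -> (k < i)%N) ->
  enum (k |: I) = k :: enum I.
Proof.
move=> kI; apply: (@irr_sorted_eq _ (fun i j : 'I_n => (i < j)%N)) => [i j l|i|||i].
- exact: ltn_trans.
- exact: ltnn.
- exact: sorted_enum_ord.
- rewrite /= path_min_sorted ?sorted_enum_ord //; apply/allP => i.
  by rewrite mem_enum => /kI.
by rewrite mem_enum in_cons mem_enum in_setU1.
Qed.

Lemma enum_span k m I : spans k m I -> enum I = k :: enum (I :\ k).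
Proof.
case/spansP => Is kI mI; rewrite -{1}(setD1K kI) enum_setU1_lt // => i.
by rewrite !inE => /andP[ik /Is /andP[]]; rewrite leq_eqVlt eq_sym (inj_eq val_inj) (negPf ik).
Qed.

(** Summing over chains from k to m according to the second element. *)
Lemma sum_spans (V : nmodType) (F : {set 'I_n} -> V) k m : (k < m)%N ->
  \sum_(I | spans k m I) F I =
  \sum_(j : 'I_n | (k < j <= m)%N) \sum_(I | spans j m I) F (k |: I).
Proof.
move=> km; rewrite pair_big_dep /=.
rewrite (reindex_onto (fun p : 'I_n * {set 'I_n} => k |: p.2)
   (fun I => (head k (enum (I :\ k)), I :\ k))) /=; last first.
  by move=> I /spansP[_ kI _]; rewrite setD1K.
apply: eq_bigl => -[j I] /=; apply/andP/andP.
  case=> /spansP[Is kI mI]; rewrite xpair_eqE => /andP[/eqP jE /eqP IE].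
  have kNI : k \notin I by rewrite -IE !inE eqxx.
  have Ilt i : i \in I -> (k < i)%N.
    move=> iI; have := Is i; rewrite in_setU1 iI orbT => /(_ isT) /andP[ki _].
    rewrite ltn_neqAle ki andbT; apply: contraNneq kNI => /val_inj E.
    by rewrite E.
  have mI' : m \in I.
    by move: mI; rewrite in_setU1 => /orP[/eqP E|//]; move: km; rewrite E ltnn.
  have := jE; rewrite IE; have := sorted_enum_ord I; have := mem_enum (mem I).
  case E: (enum I) => [|j' s] memI sI /= jj; first by have := memI m; rewrite mI'.
  have jI : j \in I by rewrite -memI jj mem_head.
  split.
    rewrite Ilt //=; have := Is j; rewrite in_setU1 jI orbT => /(_ isT) /andP[] //.
  apply/spansP; split=> // i iI.
  have := Is i; rewrite in_setU1 iI orbT => /(_ isT) /andP[_ ->]; rewrite andbT.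
  have := memI i; rewrite iI in_cons jj => /orP[/eqP -> //|].
  move: sI; rewrite /= (path_sortedE (fun i j l : 'I_n => @ltn_trans i j l)) => /andP[/allP s1 _] /s1.
  by rewrite -jj; apply: ltnW.
case=> /andP[kj jm] /spansP[Is jI mI].
have kNI : k \notin I by apply/negP => /Is; lia.
split.
  apply/spansP; split=> [i||]; rewrite in_setU1 ?eqxx ?mI ?orbT //.
  by case/orP => [/eqP ->|/Is]; lia.
rewrite setU1K // xpair_eqE eqxx andbT (@enum_span j m) //.
by apply/spansP.
Qed.

Lemma segmentD_chain k j m I : (k < j <= m)%N -> spans j m I ->
  segment n k m :\: (k |: I) =
  [set l : 'I_n | (k < l < j)%N] :|: (segment n j m :\: I).
Proof.
move=> kj /spansP[Is jI mI]; apply/setP => l; rewrite !inE negb_or -val_eqE /=.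
have [/Is|] := boolP (l \in I) => lI; first by lia.
have : l != j :> nat.
  by apply: contraNneq lI => /val_inj ->.
by rewrite /=; lia.
Qed.

End ChainSets.

Section ChainSum.
Variables (K : comNzRingType) (n : nat) (w : nat -> int).

Definition wprod (a b : nat) : int := \prod_(a <= l < b) w l.

Definition chain_sum (k m : nat) (f : Npoly K n) : Npoly K n :=
  \sum_(I : {set 'I_n} | spans k m I)
     (\prod_(l in segment n k m :\: I) w l)%:~R * Rset I f.

Lemma chain_sum_diag (k : nat) f : (k < n)%N -> chain_sum k k f = f.
Proof.
move=> kn; pose k' := Ordinal kn; rewrite /chain_sum (bigD1 [set k']) /=; last first.
  apply/(@spansP _ k' k'); split; rewrite ?inE //.
  by move=> i; rewrite inE => /eqP ->; rewrite leqnn.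
rewrite [X in _ + X]big1 ?addr0 => [|I /andP[/(@spansP _ k' k')[Is kI _] /eqP[]]]; last first.
  apply/setP => i; rewrite inE; apply/idP/eqP => [/Is|->] // /andP[a b].
  by apply/val_inj/eqP; rewrite eqn_leq b.
rewrite /Rset enum_set1 big1 ?mul1r // => i; rewrite !inE -val_eqE /=; lia.
Qed.

Lemma Rset_chain (i j : 'I_n) m I (f : Npoly K n) :
  (i < j)%N -> spans j m I -> Rset (i |: I) f = Rop i j (Rset I f).
Proof.
move=> ij; have [mn|nm] := ltnP m n; last first.
  by case/and3P => _ _ /exists_inP[m' _ /eqP E]; have := ltn_ord m'; rewrite E; lia.
move=> /[dup] sI /(@spansP _ j (Ordinal mn))[Is jI mI].
rewrite /Rset enum_setU1_lt => [|l /Is]; last by lia.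
by rewrite (enum_span (m := Ordinal mn) sI).
Qed.

Lemma chain_sum_first (k m : nat) f : (k < m < n)%N ->
  chain_sum k m f =
  \sum_(k.+1 <= j < m.+1) (wprod k.+1 j)%:~R * Rnat K n k j (chain_sum j m f).
Proof.
move=> /andP[km mn]; have kn := ltn_trans km mn.
pose k' := Ordinal kn; pose m' := Ordinal mn.
rewrite /chain_sum (@sum_spans _ _ _ k' m') //=.
have -> : \sum_(k.+1 <= j < m.+1) (wprod k.+1 j)%:~R * Rnat K n k j (chain_sum j m f) =
   \sum_(j < n | (k < j <= m)%N) (wprod k.+1 j)%:~R * Rnat K n k j (chain_sum j m f).
  rewrite (big_nat_widen _ _ n) // big_geq_mkord /=.
  by apply: eq_bigl => j; rewrite ltnS andbC.
apply: eq_bigr => j kj; rewrite raddf_sum mulr_sumr; apply: eq_bigr => I sI.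
rewrite (@Rset_chain _ j m) //; last by case/andP: kj.
rewrite (derivMint (f := idfun) (@RnatM K n k j)) -[k]/(val k') Rnat_ord mulrA.
congr (_ * _); rewrite -intrM; congr (_%:~R).
rewrite (@segmentD_chain _ k' j m') //.
rewrite (eq_bigl [predU [set l : 'I_n | (k' < l < j)%N] & segment n j m' :\: I]); last first.
  by move=> l; rewrite !inE.
rewrite bigU /=; last first.
  by rewrite disjoints_subset; apply/subsetP => l; rewrite !inE /=; lia.
congr (_ * _); rewrite /wprod (big_nat_widen _ _ n); last by rewrite ltnW.
rewrite big_geq_mkord; apply: eq_bigl => l; rewrite inE /=; lia.
Qed.

Let Rint (k j : nat) (c : int) f : Rnat K n k j (c%:~R * f) = c%:~R * Rnat K n k j f.
Proof. exact: (derivMint (f := idfun) (@RnatM K n k j)). Qed.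

Lemma wprod_cat a b c : (a <= b <= c)%N -> wprod a b * wprod b c = wprod a c.
Proof. by move=> /andP[ab bc]; rewrite /wprod -big_cat_nat. Qed.

Lemma chain_sum_last (m k : nat) f : (m < k < n)%N ->
  chain_sum m k f =
  \sum_(m <= j < k) (wprod j.+1 k)%:~R * chain_sum m j (Rnat K n j k f).
Proof.
move: {2}(k - m)%N (leqnn (k - m)) => d; elim: d m => [|d IH] m dk mk; first lia.
rewrite chain_sum_first // big_nat_recr /=; last lia.
rewrite chain_sum_diag; last lia.
rewrite [RHS]big_ltn; last lia.
rewrite chain_sum_diag; last lia.
rewrite addrC; congr (_ + _).
transitivity (\sum_(m.+1 <= j < k) \sum_(j <= i < k)
   (wprod i.+1 k)%:~R * ((wprod m.+1 j)%:~R * Rnat K n m j (chain_sum j i (Rnat K n i k f)))).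
  apply: eq_big_nat => j jH; rewrite IH; try lia.
  rewrite raddf_sum mulr_sumr; apply: eq_bigr => i _.
  by rewrite Rint mulrCA.
rewrite -(sum_triangle_le m.+1 k (fun i j => (wprod i.+1 k)%:~R *
  ((wprod m.+1 j)%:~R * Rnat K n m j (chain_sum j i (Rnat K n i k f))))).
apply: eq_big_nat => i iH; rewrite -mulr_sumr -chain_sum_first //; lia.
Qed.

Lemma chain_sumB (m k : nat) f g : (m <= k < n)%N ->
  chain_sum m k (f - g) = chain_sum m k f - chain_sum m k g.
Proof.
move: {2}(k - m)%N (leqnn (k - m)) => d; elim: d m => [|d IH] m dk mk.
  have -> : m = k by lia.
  by rewrite !chain_sum_diag //; lia.
case: (ltngtP m k) => [mk'||->]; first last.
- by rewrite !chain_sum_diag //; lia.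
- by lia.
rewrite !chain_sum_first; try lia.
rewrite -sumrB; apply: eq_big_nat => j jH.
by rewrite IH ?raddfB ?mulrBr //; lia.
Qed.

Lemma chain_sum_commute (m i j k : nat) f : (m <= i < j)%N -> (j < k < n)%N ->
  chain_sum m i (Rnat K n j k f) = Rnat K n j k (chain_sum m i f).
Proof.
move: {2}(i - m)%N (leqnn (i - m)) => d; elim: d m => [|d IH] m dk mi jk.
  have -> : m = i by lia.
  by rewrite !chain_sum_diag //; lia.
case: (ltngtP m i) => [mi'||->]; first last.
- by rewrite !chain_sum_diag //; lia.
- by lia.
rewrite !chain_sum_first; try lia.
rewrite raddf_sum; apply: eq_big_nat => a aH.
rewrite Rint IH; try lia.
by rewrite Rnat_commute //; lia.
Qed.

(** Chains may be composed in the opposite order at the price of lowering every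
    weight by one: moving the operators past each other produces the shorter
    chains, because the commutator of two successive steps is minus their
    concatenation. *)
Lemma chain_sum_rev (m k : nat) f : (m < k < n)%N ->
  chain_sum m k f =
  \sum_(m <= j < k) (\prod_(j.+1 <= l < k) (w l - 1))%:~R * Rnat K n j k (chain_sum m j f).
Proof.
move=> mk; rewrite chain_sum_last //.
pose s j := \sum_(m <= i < j) (wprod i.+1 j)%:~R * chain_sum m i (Rnat K n i k f).
suff H j : (m <= j <= k)%N -> s j = \sum_(m <= i < j)
    (\prod_(i.+1 <= l < j) (w l - 1))%:~R * Rnat K n i k (chain_sum m i f).
  by apply: H; lia.
elim: j => [|j IH] jH; first by rewrite /s !big_geq.
case: (ltngtP m j.+1) => [mj||mj]; try lia; last by rewrite /s -mj !big_geq.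
have -> : s j.+1 = (w j)%:~R * s j + chain_sum m j (Rnat K n j k f).
  rewrite /s big_nat_recr /=; last lia.
  have -> : wprod j.+1 j.+1 = 1 by rewrite /wprod big_geq.
  rewrite mul1r mulr_sumr; congr (_ + _).
  apply: eq_big_nat => i iH; rewrite mulrA -intrM; congr (_%:~R * _).
  rewrite mulrC /wprod big_nat_recr //=; lia.
rewrite big_nat_recr /=; last lia.
have -> : \prod_(j.+1 <= l < j.+1) (w l - 1) = 1 by rewrite big_geq.
rewrite mul1r.
have -> : \sum_(m <= i < j) (\prod_(i.+1 <= l < j.+1) (w l - 1))%:~R *
    Rnat K n i k (chain_sum m i f) = (w j - 1)%:~R * s j.
  rewrite IH; last lia.
  rewrite mulr_sumr; apply: eq_big_nat => i iH; rewrite mulrA -intrM.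
  by congr (_%:~R * _); rewrite mulrC big_nat_recr //=; lia.
suff -> : chain_sum m j (Rnat K n j k f) = Rnat K n j k (chain_sum m j f) - s j.
  by rewrite intrD; ring.
case: (ltngtP m j) => [mj'||mj']; try lia; last first.
  by rewrite /s -mj' big_geq // !chain_sum_diag ?subr0 //; lia.
rewrite chain_sum_last ?[in RHS]chain_sum_last; try lia.
rewrite raddf_sum -sumrB; apply: eq_big_nat => i iH.
rewrite Rnat_comm; try lia.
rewrite chain_sumB; last lia.
rewrite chain_sum_commute; try lia.
by rewrite mulrBr Rint.
Qed.

End ChainSum.

Section Rows.
Variables (B : comNzRingType) (n : nat).
Implicit Types (Y : 'M[B]_n.+1) (X : 'M[B]_n).

Definition extmx X : 'M[B]_(n, n.+1) :=
  \matrix_(i, j) if unlift ord_max j is Some j' then X i j' else 0.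

Definition zrow Y (l : nat) : 'rV[B]_n.+1 := if insub l is Some i then row i Y else 0.

Definition urow X (j : nat) : 'rV[B]_n.+1 :=
  if insub j is Some j' then row j' (extmx X) else 0.

Definition elast : 'rV[B]_n.+1 := delta_mx 0 ord_max.

Definition kern Y X (ea eb : nat -> nat) : B := Lmon (zrow Y) (urow X) elast ea eb.

Lemma zrowE Y l (ln : (l < n.+1)%N) : zrow Y l = row (Ordinal ln) Y.
Proof. by rewrite /zrow insubT. Qed.

Lemma urowE X j (jn : (j < n)%N) : urow X j = row (Ordinal jn) (extmx X).
Proof. by rewrite /urow insubT. Qed.

Lemma urow_max X j : urow X j 0 ord_max = 0.
Proof.
rewrite /urow; case: insub => [i|]; rewrite !mxE //.
by case: unliftP => // k /eqP; rewrite (negPf (neq_lift _ _)).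
Qed.

Lemma urow_lift X j (jn : (j < n)%N) (c : 'I_n) :
  urow X j 0 (lift ord_max c) = X (Ordinal jn) c.
Proof. by rewrite urowE !mxE liftK. Qed.

End Rows.

Arguments elast {B n}.

Section Functoriality.
Variables (B B' : comNzRingType) (f : {rmorphism B -> B'}).

Lemma map_blockdet N a (z u : nat -> 'rV[B]_N) :
  f (blockdet a z u) = blockdet a (fun l => map_mx f (z l)) (fun j => map_mx f (u j)).
Proof.
rewrite /blockdet -det_map_mx; congr (\det _); apply/matrixP => i j.
by rewrite !mxE; case: ifP => _; rewrite mxE.
Qed.

Variable n : nat.
Implicit Types (Y : 'M[B]_n.+1) (X : 'M[B]_n).

Lemma map_zrow Y l : map_mx f (zrow Y l) = zrow (map_mx f Y) l.
Proof. by rewrite /zrow; case: insub => [i|]; rewrite ?map_row // map_mx0. Qed.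

Lemma map_urow X j : map_mx f (urow X j) = urow (map_mx f X) j.
Proof.
rewrite /urow; case: insub => [i|]; rewrite ?map_mx0 // map_row; congr row.
by apply/matrixP => s t; rewrite !mxE; case: unlift => [t'|]; rewrite ?mxE ?rmorph0.
Qed.

Lemma map_elast : map_mx f elast = elast :> 'rV_n.+1.
Proof. exact: map_delta_mx. Qed.

Lemma map_Phid Y X i :
  f (Phid (zrow Y) (urow X) i) = Phid (zrow (map_mx f Y)) (urow (map_mx f X)) i.
Proof.
rewrite /Phid map_blockdet; congr (\det _); apply/matrixP => s t; rewrite !mxE.
by case: ifP => _; rewrite -?map_zrow -?map_urow.
Qed.

Lemma map_Dd Y X i j :
  f (Dd (zrow Y) (urow X) elast i j) =
  Dd (zrow (map_mx f Y)) (urow (map_mx f X)) elast i j.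
Proof.
rewrite /Dd map_blockdet; congr (\det _); apply/matrixP => s t; rewrite !mxE.
by case: ifP => _; rewrite -?map_zrow // /upd; case: ifP => _; rewrite ?map_elast ?map_urow.
Qed.

Lemma map_kern Y X ea eb : f (kern Y X ea eb) = kern (map_mx f Y) (map_mx f X) ea eb.
Proof.
rewrite /kern /Lmon rmorphM !rmorph_prod; congr (_ * _); apply: eq_bigr => i _.
  by rewrite rmorphXn map_Phid.
by rewrite rmorphXn /= /Psid map_Dd.
Qed.

End Functoriality.

(** Right multiplication of all the rows by a matrix of determinant 1. *)
Lemma blockdet_mulr (B : comNzRingType) N a (z u : nat -> 'rV[B]_N) (g : 'M[B]_N) :
  blockdet a (fun l => z l *m g) (fun j => u j *m g) = blockdet a z u * \det g.
Proof.
rewrite /blockdet -det_mulmx; congr (\det _); apply/row_matrixP => i.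
by rewrite row_mul !rowK; case: ifP.
Qed.

Section Elementary.
Variables (B : comNzRingType) (N : nat).

Definition elem (k l : 'I_N) (t : B) : 'M[B]_N := 1%:M + t *: delta_mx k l.

Lemma det_elem k l t : k != l -> \det (elem k l t) = 1.
Proof.
move=> kl.
have diag i : elem k l t i i = 1.
  rewrite !mxE eqxx; suff -> : (i == k) && (i == l) = false by rewrite mulr0 addr0.
  by apply/negP => /andP[/eqP -> /eqP E]; rewrite E eqxx in kl.
have [lk|kl'] := ltnP l k.
  rewrite det_trig; first by rewrite big1 // => i _; apply: diag.
  apply/is_trig_mxP => i j ij; rewrite !mxE.
  have -> : (i == k) && (j == l) = false.
    by apply/negP => /andP[/eqP ik /eqP jl]; move: ij; rewrite ik jl; lia.
  by rewrite mulr0 addr0 -val_eqE ltn_eqF.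
rewrite -det_tr det_trig; first by rewrite big1 // => i _; rewrite mxE; apply: diag.
apply/is_trig_mxP => i j ij; rewrite !mxE.
have -> : (j == k) && (i == l) = false.
  apply/negP => /andP[/eqP ik /eqP jl]; move: ij; rewrite ik jl.
  by have : (k : nat) != l := kl; lia.
by rewrite mulr0 addr0 -val_eqE gtn_eqF.
Qed.

Lemma elemM k l s t : k != l -> elem k l s *m elem k l t = elem k l (s + t).
Proof.
move=> kl; rewrite /elem mulmxDl !mulmxDr !mul1mx mulmx1 -scalemxAl -scalemxAr.
rewrite mul_delta_mx_0 1?eq_sym // !scaler0 addr0 scalerDl -addrA; congr (_ + _).
by rewrite addrC.
Qed.

Lemma row_elem (x : 'rV[B]_N) k l t : x *m elem k l t = x + (t * x 0 k) *: delta_mx 0 l.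
Proof.
rewrite mulmxDr mulmx1 -scalemxAr; congr (_ + _); rewrite -scalerA; congr (_ *: _).
apply/rowP => c; rewrite !mxE (bigD1 k) //= big1 ?addr0 => [|i /negPf ik].
  by rewrite !mxE eqxx.
by rewrite !mxE ik mulr0.
Qed.

End Elementary.

Lemma blockdetDr (B : comNzRingType) N a (z u : nat -> 'rV[B]_N) j x y (c : B) :
  (a + j < N)%N ->
  blockdet a z (upd u j (x + c *: y)) =
  blockdet a z (upd u j x) + c * blockdet a z (upd u j y).
Proof.
move=> aj; have [l lE] := blockdet_linear z u aj.
by rewrite !lE mulmxDl -scalemxAl !mxE.
Qed.

Section ChainsOnKernel.
Variables (K : idomainType) (n : nat) (y : 'M[K]_n.+1).

Local Notation A := (Npoly K n).
Local Notation Yc := (map_mx (@mpolyC (nvars n) K) y : 'M[A]_n.+1).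
Local Notation z := (zrow Yc).
Local Notation u := (urow (generic K n)).
Local Notation kernel := (kern Yc (generic K n)).

Lemma Rnat_zrow k j l c : Rnat K n k j (z l 0 c) = 0.
Proof.
rewrite /zrow; case: insub => [i|]; last by rewrite mxE raddf0.
rewrite !mxE /Rnat; case: insub => [k'|] //; case: insub => [j'|] //=.
exact: RopC.
Qed.

Lemma Rnat_urow (k j i : nat) c : (k < j < n)%N -> (i < n)%N ->
  Rnat K n k j (u i 0 c) = if i == k then u j 0 c else 0.
Proof.
move=> /andP[kj jn] lt_in; have kn := ltn_trans kj jn.
case: (unliftP ord_max c) => [c' ->|->]; last by rewrite !urow_max raddf0 if_same.
rewrite (urow_lift _ lt_in) (urow_lift _ jn) (RnatE kn jn) Rop_generic //.
Qed.

Lemma Rnat_elast k j c : Rnat K n k j ((elast : 'rV[A]_n.+1) 0 c) = 0.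
Proof.
rewrite mxE -mpolyC_nat /Rnat; case: insub => [k'|] //; case: insub => [j'|] //=.
exact: RopC.
Qed.

Variables (ea eb : nat -> nat) (y_ : nat -> int).
Hypothesis Phi_neq0 : forall i, (i < n)%N -> Phid z u i != 0.
Hypothesis Psi_neq0 : forall i, (i < n)%N -> Psid z u elast i != 0.
Hypothesis yE : forall i, (i.+1 < n)%N ->
  y_ i - y_ i.+1 = (ea i)%:Z + (eb i.+1)%:Z + 1.

Lemma chain_sum_kern_lower (c : nat -> int) m : (m < n)%N -> (0 < ea m)%N ->
  (forall k, (k < m)%N -> c k.+1 = (ea k)%:Z + (y_ m - y_ k)) ->
  chain_sum (fun l => y_ m - y_ l) 0 m (kernel (decr ea m) (incr eb m)) =
  \sum_(0 <= i < m.+1) (gap y_ m 0 i * lower_coef m ea c i)%:~R *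
    (kernel (decr ea i) eb * Dd z u elast i 0).
Proof.
move=> mn em cE; rewrite [X in chain_sum _ _ _ X]Lmon_shift_lower //.
apply: (@chain_lower _ (Rnat K n) (@RnatM K n)
  (fun i j => kernel (decr ea i) eb * Dd z u elast i j) y_ m ea c
  (fun k => chain_sum (fun l => y_ m - y_ l) k m _)) => //.
- by rewrite chain_sum_diag.
- by move=> k km; rewrite chain_sum_first //; rewrite km.
move=> i k ki ei; apply: (sum_R_G (@RnatM K n) Rnat_zrow Rnat_elast Rnat_urow) => //.
  by lia.
case: (ltngtP i m) => [/ei||->] //; lia.
Qed.

Lemma chain_sum_kern_upper (c : nat -> int) m : (m < n)%N -> (0 < eb m)%N ->
  (forall k, (m < k < n)%N -> c k = y_ m - y_ k - (eb k)%:Z) ->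
  chain_sum (fun l => y_ m - y_ l + 1) m n.-1 (kernel (incr ea m) (decr eb m)) =
  \sum_(m <= i < n) (gap y_ m i.+1 n * upper_coef m eb c i)%:~R *
    (kernel ea (decr eb i) * Phis z u i i (u n.-1)).
Proof.
move=> mn em cE; rewrite [X in chain_sum _ _ _ X]Lmon_shift_upper //.
have nE : n.-1.+1 = n by lia.
transitivity (\sum_(m <= i < n.-1.+1) (gap y_ m i.+1 n.-1.+1 * upper_coef m eb c i)%:~R *
    (kernel ea (decr eb i) * Phis z u i i (u n.-1))); last by rewrite nE.
apply: (@chain_upper _ (Rnat K n) (@RnatM K n)
  (fun i k => kernel ea (decr eb i) * Phis z u i i (u k)) y_ m n.-1 eb c
  (fun k => chain_sum (fun l => y_ m - y_ l + 1) m k _)) => //.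
- by move=> k kH; apply: cE; lia.
- by rewrite chain_sum_diag.
- move=> k km; rewrite chain_sum_rev; last lia.
  apply: eq_big_nat => j jH; congr (_%:~R * _).
  by apply: eq_bigr => l _; rewrite addrK.
- move=> i k ki kt ei.
  apply: (sum_R_H (@RnatM K n) Rnat_zrow Rnat_elast Rnat_urow) => //; first lia.
  case: (ltngtP m i) => [/ei||<-] //; lia.
lia.
Qed.

End ChainsOnKernel.

Section MatrixPolynomials.
Variables (C : comNzRingType) (N : nat).

Definition Mpoly := {mpoly C[N * N]}.

Definition genmx : 'M[Mpoly]_N := \matrix_(i, j) 'X_(mxvec_index i j).

Section Eval.
Variables (S : comNzRingType) (f : {rmorphism C -> S}).

Definition mx_eval (M : 'M[S]_N) : Mpoly -> S := mmap f (fun v => mxvec M 0 v).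

HB.instance Definition _ M := GRing.RMorphism.on (mx_eval M).

Lemma mx_evalC M c : mx_eval M c%:MP = f c.
Proof. exact: mmapC. Qed.

Lemma mx_eval_gen M : map_mx (mx_eval M) genmx = M.
Proof. by apply/matrixP => i j; rewrite !mxE /mx_eval mmapX mmap1U mxvecE. Qed.

End Eval.

Lemma mx_eval_comp (S S' : comNzRingType) (f : {rmorphism C -> S})
    (g : {rmorphism S -> S'}) (M : 'M[S]_N) P :
  g (mx_eval f M P) = mx_eval (g \o f) (map_mx g M) P.
Proof.
rewrite /mx_eval /mmap rmorph_sum; apply: eq_bigr => m _.
rewrite rmorphM /= /mmap1 rmorph_prod; congr (_ * _); apply: eq_bigr => v _.
by rewrite rmorphXn; case/mxvec_indexP: v => i j; rewrite !mxvecE mxE.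
Qed.

Lemma eq_mx_eval (S : comNzRingType) (f g : {rmorphism C -> S}) (M : 'M[S]_N) P :
  f =1 g -> mx_eval f M P = mx_eval g M P.
Proof. by move=> fg; rewrite /mx_eval /mmap; apply: eq_bigr => m _; rewrite fg. Qed.

Lemma mx_eval_id P : mx_eval (@mpolyC _ C) genmx P = P.
Proof.
rewrite {2}[P]mpolyE /mx_eval /mmap; apply: eq_bigr => m _.
rewrite mul_mpolyC; congr (_ *: _); rewrite /mmap1 mpolyXE_id.
by apply: eq_bigr => v _; case/mxvec_indexP: v => i j; rewrite mxvecE mxE.
Qed.

(** The curve t |-> P (Y (1 + t E_kl)), with Y the generic matrix. *)
Definition shiftp (k l : 'I_N) : Mpoly -> {poly Mpoly} :=
  mx_eval (polyC \o @mpolyC _ C) (map_mx polyC genmx *m elem k l 'X).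

HB.instance Definition _ k l := GRing.RMorphism.on (shiftp k l).

(** The action of E_kl on polynomials in the matrix entries. *)
Definition Edir (k l : 'I_N) (P : Mpoly) : Mpoly := (shiftp k l P)`_1.

Lemma Edir_is_additive k l : additive (Edir k l).
Proof. by move=> P Q; rewrite /Edir rmorphB coefB. Qed.

HB.instance Definition _ k l :=
  GRing.isAdditive.Build Mpoly Mpoly (Edir k l) (Edir_is_additive k l).

Lemma shiftp_eval (k l : 'I_N) P (g : 'M[C]_N) (t : C) :
  (map_poly (mx_eval idfun g) (shiftp k l P)).[t] = mx_eval idfun (g *m elem k l t) P.
Proof.
have E (Q : {poly Mpoly}) : (map_poly (mx_eval idfun g) Q).[t] =
    (horner_eval t \o map_poly (mx_eval idfun g)) Q by [].
rewrite E /shiftp mx_eval_comp (eq_mx_eval (g := idfun)) => [|c /=]; last first.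
  by rewrite map_polyC /= mx_evalC /horner_eval hornerC.
congr (mx_eval idfun _ P); rewrite map_mx_comp map_mxM /= map_mxM /=; congr (_ *m _).
  rewrite -[in RHS](mx_eval_gen idfun g); apply/matrixP => i j; rewrite !mxE.
  by rewrite map_polyC /= /horner_eval hornerC.
apply/matrixP => i j; rewrite !mxE !(rmorphD, rmorphM) /= !rmorph_nat map_polyX.
by rewrite /horner_eval hornerX.
Qed.

Lemma shiftp0 (k l : 'I_N) P : (shiftp k l P)`_0 = P.
Proof.
rewrite -[_`_0]/(coefp 0 _) /shiftp mx_eval_comp.
rewrite (eq_mx_eval (g := @mpolyC _ C)) => [|c /=]; last by rewrite /coefp coefC.
rewrite -[RHS]mx_eval_id; congr (mx_eval _ _ P).
rewrite map_mxM -map_mx_comp /= -[RHS]mulmx1; congr (_ *m _); apply/matrixP => i j.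
  by rewrite !mxE /= coefC.
by rewrite !mxE -horner_coef0 hornerD hornerM hornerX mul0r addr0 hornerMn -polyC1 hornerC.
Qed.

End MatrixPolynomials.

Lemma map_generic (K K' : comNzRingType) (f : {rmorphism K -> K'}) n :
  map_mx (map_mpoly f) (generic K n) = generic K' n.
Proof.
apply/matrixP => i j; rewrite !mxE; case: uvar_index => [v|]; first exact: map_mpolyX.
exact: rmorph_nat.
Qed.

Lemma map_constmx (K K' : comNzRingType) (f : {rmorphism K -> K'}) k n m (M : 'M[K]_(n, m)) :
  map_mx (map_mpoly f) (map_mx (@mpolyC k K) M) = map_mx (@mpolyC k K') (map_mx f M).
Proof. by apply/matrixP => i j; rewrite !mxE map_mpolyC. Qed.

Lemma map_mpoly_kern (K K' : comNzRingType) (f : {rmorphism K -> K'}) n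
    (M : 'M[K]_n.+1) ea eb :
  map_mpoly f (kern (map_mx (@mpolyC (nvars n) K) M) (generic K n) ea eb) =
  kern (map_mx (@mpolyC (nvars n) K') (map_mx f M)) (generic K' n) ea eb.
Proof. by rewrite map_kern map_generic map_constmx. Qed.

(** Dependence of the kernel determinants on a parameter t when the matrix Y
    is moved along 1 + t E: the shift is undone on the rows of U. *)
Section ShiftedKernel.
Variables (B : comNzRingType) (n : nat) (Y : 'M[B]_n.+1) (X : 'M[B]_n) (t : B).
Local Notation z := (zrow Y).
Local Notation u := (urow X).

Lemma blockdet_shift (k l : 'I_n.+1) a (v : nat -> 'rV[B]_n.+1) : k != l ->
  blockdet a (zrow (Y *m elem k l t)) v =
  blockdet a z (fun j => v j *m elem k l (- t)).
Proof.
move=> kl; rewrite -[RHS]mulr1 -(det_elem t kl) -blockdet_mulr.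
congr (\det _); apply/row_matrixP => i; rewrite !rowK.
rewrite -mulmxA elemM // addNr /elem scale0r addr0 mulmx1.
case: ifP => // _; rewrite /zrow; case: insub => [s|]; last by rewrite mul0mx.
by rewrite row_mul.
Qed.

Section FirstColumn.
Hypothesis X0 : forall (j : 'I_n) (c : 'I_n), c = 0%N :> nat -> X j c = (j == c)%:R.
Hypothesis n0 : (0 < n)%N.

Let u0 (j : nat) : (j < n)%N -> u j 0 ord0 = (j == 0%N)%:R.
Proof.
move=> jn; have -> : ord0 = lift ord_max (Ordinal n0).
  by apply: val_inj; rewrite /= /bump leqNgt n0.
by rewrite (urow_lift _ jn) X0 // -val_eqE.
Qed.

Let ord0max : ord0 != ord_max :> 'I_n.+1.
Proof. by apply/eqP => -[]; lia. Qed.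

Let e0 : (elast : 'rV[B]_n.+1) 0 ord0 = 0.
Proof. by rewrite mxE (negPf ord0max) andbF. Qed.

Lemma Phid_shift0 i : (i < n)%N ->
  Phid (zrow (Y *m elem ord0 ord_max t)) u i = Phid z u i - t * Dd z u elast i 0.
Proof.
move=> lt_in; rewrite /Phid blockdet_shift //.
transitivity (blockdet (n - i) z (upd u 0 (u 0%N + (- t) *: elast))).
  apply: eq_blockdet => j jH; rewrite row_elem /upd u0; last lia.
  by case: j jH => [|j] _ /=; rewrite ?mulr1 // mulr0 scale0r addr0.
by rewrite blockdetDr ?blockdet_upd_id ?mulNr //; lia.
Qed.

Lemma Psid_shift0 i : (i < n)%N ->
  Psid (zrow (Y *m elem ord0 ord_max t)) u elast i = Psid z u elast i.
Proof.
move=> lt_in; rewrite /Psid /Dd blockdet_shift //.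
case: i lt_in => [|i] lt_in.
  apply: eq_blockdet => j jH; rewrite row_elem /upd.
  by case: j jH => [|j] jH /=; [rewrite e0 mulr0 scale0r addr0 | lia].
transitivity (blockdet (n - i.+1) z (upd (upd u i.+1 elast) 0 (u 0%N + (- t) *: elast))).
  apply: eq_blockdet => j jH; rewrite row_elem /upd.
  case: j jH => [|j] jH /=; first by rewrite u0 ?mulr1 //; lia.
  case: eqP => _; first by rewrite e0 mulr0 scale0r addr0.
  by rewrite u0 ?mulr0 ?scale0r ?addr0 //; lia.
rewrite blockdetDr; last lia.
rewrite (@blockdet_uu _ _ _ _ (upd (upd u i.+1 elast) 0 elast) 0 i.+1) ?mulr0 ?addr0; try lia.
  by apply: eq_blockdet => j jH; rewrite /upd; case: eqP => // ->.
by rewrite /upd /= eqxx.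
Qed.

End FirstColumn.

Section LastRow.
Hypothesis Xl : forall (j : 'I_n) (c : 'I_n), j = n.-1 :> nat -> X j c = (j == c)%:R.
Hypothesis n0 : (0 < n)%N.

Let prev : 'I_n.+1 := inord n.-1.

Let prevmax : ord_max != prev.
Proof. by apply/eqP => /(congr1 val); rewrite /= inordK; lia. Qed.

Let u_prev : u n.-1 = delta_mx 0 prev.
Proof.
have n1 : (n.-1 < n)%N by lia.
apply/rowP => c; case: (unliftP ord_max c) => [c' ->|->]; last first.
  by rewrite urow_max mxE (negPf prevmax) andbF.
rewrite (urow_lift _ n1) Xl // mxE -!val_eqE /= inordK; last lia.
by rewrite eq_sym /bump leqNgt ltn_ord.
Qed.

Lemma Phid_shift1 i : (i < n)%N ->
  Phid (zrow (Y *m elem ord_max prev t)) u i = Phid z u i.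
Proof.
move=> lt_in; rewrite /Phid blockdet_shift //.
by apply: eq_blockdet => j jH; rewrite row_elem urow_max mulr0 scale0r addr0.
Qed.

Lemma Psid_shift1 i : (i < n)%N ->
  Psid (zrow (Y *m elem ord_max prev t)) u elast i =
  Psid z u elast i - t * Phis z u i i (u n.-1).
Proof.
move=> lt_in; rewrite /Psid /Dd blockdet_shift // /Phis u_prev -mulNr -blockdetDr; last lia.
apply: eq_blockdet => j jH; rewrite row_elem /upd.
case: eqP => _; first by rewrite mxE !eqxx mulr1.
by rewrite urow_max mulr0 scale0r addr0.
Qed.

End LastRow.

End ShiftedKernel.

Section FirstOrder.
Variables (K : comNzRingType) (n : nat).
Local Notation A := (Npoly K n).
Local Notation B := (Npoly {poly K} n).

Definition coef_t (k : nat) : B -> A := map_mpoly (coefp k).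

HB.instance Definition _ k := GRing.Additive.on (coef_t k).
HB.instance Definition _ := GRing.RMorphism.on (coef_t 0).

Lemma coef_t1M f g : coef_t 1 (f * g) = coef_t 1 f * coef_t 0 g + coef_t 0 f * coef_t 1 g.
Proof.
apply/mpolyP => m; rewrite mcoeffD !mcoeffM mcoeff_map_mpoly mcoeffM raddf_sum -big_split.
apply: eq_bigr => k _; rewrite /= !mcoeff_map_mpoly /= coefM big_ord_recl big_ord1 /=.
by rewrite addrC.
Qed.

Definition lift_t : A -> B := map_mpoly polyC.
HB.instance Definition _ := GRing.RMorphism.on lift_t.

Definition var_t : B := 'X%:MP.

Lemma coef_t0_lift f : coef_t 0 (lift_t f) = f.
Proof. by apply/mpolyP => m; rewrite !mcoeff_map_mpoly /= coefC. Qed.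

Lemma coef_t1_lift f : coef_t 1 (lift_t f) = 0.
Proof. by apply/mpolyP => m; rewrite !mcoeff_map_mpoly /= coefC mcoeff0. Qed.

Lemma coef_t0_var : coef_t 0 var_t = 0.
Proof. by rewrite /coef_t /var_t map_mpolyC /= coefX mpolyC0. Qed.

Lemma coef_t1_var : coef_t 1 var_t = 1.
Proof. by rewrite /coef_t /var_t map_mpolyC /= coefX. Qed.

Lemma coef_t1_lin f g : coef_t 1 (lift_t f - var_t * lift_t g) = - g.
Proof.
by rewrite raddfB /= coef_t1M coef_t1_lift coef_t0_lift coef_t1_var coef_t0_var
  mul0r addr0 mul1r sub0r.
Qed.

Lemma coef_t0_lin f g : coef_t 0 (lift_t f - var_t * lift_t g) = f.
Proof. by rewrite rmorphB rmorphM /= coef_t0_var mul0r subr0 coef_t0_lift. Qed.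

End FirstOrder.

Section DerivativeOfKernel.
Variables (K : comNzRingType) (n : nat) (y : 'M[K]_n.+1).
Local Notation A := (Npoly K n).
Local Notation B := (Npoly {poly K} n).
Local Notation Y := (map_mx (@mpolyC (nvars n) K) y).
Local Notation L := (kern Y (generic K n)).
Local Notation z := (zrow Y).
Local Notation u := (urow (generic K n)).

Lemma coef_t1_Lmon (zt ut : nat -> 'rV[B]_n.+1) e ea eb (p s : nat -> A) :
  (forall i, (i < n)%N -> Phid zt ut i = lift_t (Phid z u i) - var_t _ n * lift_t (p i)) ->
  (forall i, (i < n)%N ->
     Psid zt ut e i = lift_t (Psid z u elast i) - var_t _ n * lift_t (s i)) ->
  coef_t 1 (Lmon zt ut e ea eb) =
  - \sum_(0 <= i < n) (ea i)%:R * (L (decr ea i) eb * p i)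
  - \sum_(0 <= i < n) (eb i)%:R * (L ea (decr eb i) * s i).
Proof.
move=> PhiE PsiE; rewrite /Lmon coef_t1M.
have c0 x (ex : nat -> nat) (x0 : nat -> A) : (forall i, (i < n)%N -> coef_t 0 (x i) = x0 i) ->
    coef_t 0 (\prod_(i < n) x i ^+ ex i) = \prod_(i < n) x0 i ^+ ex i.
  by move=> xE; rewrite rmorph_prod; apply: eq_bigr => i _; rewrite rmorphXn /= xE.
have c1 x (ex : nat -> nat) (x0 x1 : nat -> A) : (forall i, (i < n)%N -> coef_t 0 (x i) = x0 i) ->
    (forall i, (i < n)%N -> coef_t 1 (x i) = - x1 i) ->
    coef_t 1 (\prod_(i < n) x i ^+ ex i) =
    - \sum_(i < n) (ex i)%:R * ((\prod_(j < n) x0 j ^+ decr ex i j) * x1 i).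
  move=> xE xE1; rewrite (deriv_prod_exp (@coef_t1M K n)) -sumrN; apply: eq_bigr => i _.
  rewrite /= xE1 // mulrN -mulr_natl mulrN; congr (- (_ * (_ * _))).
  by apply: eq_bigr => j _; rewrite /= xE.
rewrite (c1 _ _ (Phid z u) p) => [|i iH|i iH]; last first.
- by rewrite PhiE // coef_t1_lin.
- by rewrite PhiE // coef_t0_lin.
rewrite (c0 _ _ (Psid z u elast)) => [|i iH]; last by rewrite PsiE // coef_t0_lin.
rewrite (c1 _ _ (Psid z u elast) s) => [|i iH|i iH]; last first.
- by rewrite PsiE // coef_t1_lin.
- by rewrite PsiE // coef_t0_lin.
rewrite (c0 _ _ (Phid z u)) => [|i iH]; last by rewrite PhiE // coef_t0_lin.
rewrite mulNr mulrN mulr_suml mulr_sumr !big_mkord; congr (- _ - _).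
  by apply: eq_bigr => i _; rewrite -mulrA; congr (_ * _); rewrite mulrAC.
by apply: eq_bigr => i _; rewrite mulrCA; congr (_ * _); rewrite mulrA.
Qed.

Let liftY : map_mx (@lift_t K n) Y = map_mx (@mpolyC (nvars n) _) (map_mx polyC y).
Proof. exact: map_constmx. Qed.

Let ut := urow (generic {poly K} n).

Let ut_map : generic {poly K} n = map_mx (@lift_t K n) (generic K n).
Proof. by rewrite map_generic. Qed.

Variables (k l : 'I_n.+1) (f : {rmorphism K -> {poly K}}).
Hypothesis f_shift : map_mx f y = map_mx polyC y *m elem k l 'X.

Lemma map_shift_kern ea eb :
  map_mpoly f (L ea eb) =
  kern (map_mx (@lift_t K n) Y *m elem k l (var_t K n)) (generic {poly K} n) ea eb.
Proof.
rewrite map_mpoly_kern.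
rewrite f_shift.
rewrite liftY.
apply: (congr1 (fun M => kern M (generic {poly K} n) ea eb)).
rewrite (map_mxM (@mpolyC (nvars n) {poly K})).
apply: (congr1 (mulmx _)).
apply/matrixP => i j.
rewrite !mxE.
transitivity ((i == j)%:R%:MP_[nvars n] + ('X * ((i == k) && (j == l))%:R)%:MP_[nvars n]
  : Npoly {poly K} n); first exact: mpolyCD.
congr (_ + _); first exact: mpolyC_nat.
transitivity ('X%:MP_[nvars n] * ((i == k) && (j == l))%:R%:MP_[nvars n]
  : Npoly {poly K} n); first exact: mpolyCM.
congr (_ * _); exact: mpolyC_nat.
Qed.

Lemma deriv_kern_lower ea eb : (0 < n)%N -> k = ord0 -> l = ord_max ->
  coef_t 1 (map_mpoly f (L ea eb)) =
  - \sum_(0 <= i < n) (ea i)%:R * (L (decr ea i) eb * Dd z u elast i 0).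
Proof.
move=> n0 k0 lm; rewrite map_shift_kern k0 lm.
have X0 (j c : 'I_n) : c = 0%N :> nat -> generic {poly K} n j c = (j == c)%:R.
  by move=> c0; rewrite mxE uvar_index_ge // c0.
rewrite (@coef_t1_Lmon _ _ _ _ _ (fun i => Dd z u elast i 0) (fun=> 0)).
- by rewrite [X in _ - X]big1 ?subr0 // => i _; rewrite !mulr0.
- by move=> i iH; rewrite Phid_shift0 // map_Phid map_Dd ut_map.
by move=> i iH; rewrite Psid_shift0 // /Psid map_Dd ut_map rmorph0 mulr0 subr0.
Qed.

Lemma deriv_kern_upper ea eb : (0 < n)%N -> k = ord_max -> l = inord n.-1 ->
  coef_t 1 (map_mpoly f (L ea eb)) =
  - \sum_(0 <= i < n) (eb i)%:R * (L ea (decr eb i) * Phis z u i i (u n.-1)).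
Proof.
move=> n0 km lp; rewrite map_shift_kern km lp.
have Xl (j c : 'I_n) : j = n.-1 :> nat -> generic {poly K} n j c = (j == c)%:R.
  move=> jn; rewrite mxE uvar_index_ge // jn; have := ltn_ord c; lia.
have mapPhis i : lift_t (Phis z u i i (u n.-1)) =
    Phis (zrow (map_mx (@lift_t K n) Y)) ut i i (ut n.-1).
  rewrite /Phis map_blockdet /ut ut_map; congr (\det _); apply/row_matrixP => j.
  rewrite !rowK; case: ifP => _; first by rewrite map_zrow.
  by rewrite /upd; case: ifP => _; rewrite map_urow.
rewrite (@coef_t1_Lmon _ _ _ _ _ (fun=> 0) (fun i => Phis z u i i (u n.-1))).
- by rewrite [X in - X - _]big1 ?oppr0 ?add0r // => i _; rewrite !mulr0.
- by move=> i iH; rewrite Phid_shift1 // map_Phid ut_map rmorph0 mulr0 subr0.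
by move=> i iH; rewrite Psid_shift1 // /Psid map_Dd -ut_map mapPhis.
Qed.

End DerivativeOfKernel.

Section NonVanishing.
Variables (C : idomainType) (n : nat).

Lemma perm_rows_neq0 N (s : 'S_N) (M : 'M[C]_N) :
  (forall r, row r M = delta_mx 0 (s r)) -> \det M != 0.
Proof.
move=> Ms; have -> : M = perm_mx s.
  by apply/row_matrixP => r; rewrite Ms; apply/rowP => c; rewrite !mxE eqxx eq_sym.
by rewrite det_perm signr_eq0.
Qed.

Lemma urow1 j (jn : (j < n.+1)%N) : (j < n)%N ->
  urow (1%:M : 'M[C]_n) j = delta_mx 0 (Ordinal jn).
Proof.
move=> jn'; apply/rowP => c; case: (unliftP ord_max c) => [c' ->|->].
  rewrite (urow_lift _ jn') !mxE -!val_eqE /= /bump leqNgt ltn_ord /=.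
  by rewrite eq_sym.
rewrite urow_max mxE eqxx /=; case: eqP => // /(congr1 val) /=; lia.
Qed.

Let rot_fun (i : nat) (r : 'I_n.+1) : 'I_n.+1 := inord ((r + i.+1) %% n.+1).

Let rot_inj i : injective (rot_fun i).
Proof.
move=> a b /(congr1 val); rewrite /rot_fun /= !inordK ?ltn_pmod // => /eqP.
by rewrite eqn_modDr !modn_small // => /eqP/val_inj.
Qed.

Lemma Phid_exists_neq0 i : (i < n)%N ->
  exists y : 'M[C]_n.+1, Phid (zrow y) (urow 1%:M) i != 0.
Proof.
move=> lt_in; exists (perm_mx (perm (@rot_inj i))).
apply: (@perm_rows_neq0 _ (perm (@rot_inj i))) => r; rewrite rowK.
case: ifP => ri.
  rewrite (zrowE _ (ltn_ord r)) (_ : Ordinal _ = r); last exact: val_inj.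
  by apply/rowP => c; rewrite !mxE eqxx /= eq_sym.
have rn := ltn_ord r; rewrite permE; have jn : (r - (n - i) < n.+1)%N by lia.
rewrite (urow1 jn); last lia.
congr delta_mx; apply: val_inj; rewrite /= inordK ?ltn_pmod //.
have -> : (r + i.+1 = r - (n - i) + n.+1)%N by lia.
by rewrite modnDr modn_small.
Qed.

Let rotl_fun (i : nat) (r : 'I_n.+1) : 'I_n.+1 :=
  inord (if (r < n)%N then (r + i) %% n else n)%N.

Let rotl_lt i (r : 'I_n.+1) : ((if r < n then (r + i) %% n else n) < n.+1)%N.
Proof. by case: (ltnP r n) => // rn; rewrite ltnS ltnW // ltn_pmod //; lia. Qed.

Let rotl_inj i : injective (rotl_fun i).
Proof.
move=> a b /(congr1 val); rewrite /rotl_fun /= !inordK ?rotl_lt //.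
have := ltn_ord a; have := ltn_ord b; case: (ltnP a n) => aN; case: (ltnP b n) => bN bl al.
- by move=> /eqP; rewrite eqn_modDr !modn_small // => /eqP/val_inj.
- by have := ltn_pmod (a + i) (leq_ltn_trans (leq0n _) aN) => + E; rewrite E ltnn.
- by have := ltn_pmod (b + i) (leq_ltn_trans (leq0n _) bN) => + E; rewrite -E ltnn.
by move=> _; apply: val_inj; rewrite /=; lia.
Qed.

Lemma Psid_exists_neq0 i : (i < n)%N ->
  exists y : 'M[C]_n.+1, Psid (zrow y) (urow 1%:M) elast i != 0.
Proof.
move=> lt_in; exists (perm_mx (perm (@rotl_inj i))).
apply: (@perm_rows_neq0 _ (perm (@rotl_inj i))) => r; rewrite rowK.
case: ifP => ri.
  rewrite (zrowE _ (ltn_ord r)) (_ : Ordinal _ = r); last exact: val_inj.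
  by apply/rowP => c; rewrite !mxE eqxx /= eq_sym.
have rn := ltn_ord r; rewrite permE /rotl_fun /upd.
have n0 : (0 < n)%N by lia.
case: eqP => [ji|ji].
  congr delta_mx; apply: val_inj; rewrite /= inordK ?rotl_lt //; case: (ltnP r n) => //; lia.
have jn : (r - (n - i) < n.+1)%N by lia.
rewrite (urow1 jn); last lia.
congr delta_mx; apply: val_inj; rewrite /=.
have -> : (r < n)%N by lia.
have -> : (r + i = r - (n - i) + n)%N by lia.
rewrite modnDr modn_small; last lia.
by rewrite inordK.
Qed.

Lemma generic_at0 (S : comNzRingType) :
  map_mx (meval (fun=> 0)) (generic S n) = 1%:M.
Proof.
apply/matrixP => i j; rewrite !mxE; case E: uvar_index => [v|]; last exact: rmorph_nat.
rewrite mevalXU; case: eqP => // ij; move: E; rewrite ij uvar_index_ge //.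
Qed.

(** A matrix that specializes to every matrix over C is generic enough for the
    kernel determinants to be nonzero. *)
Variables (K : comNzRingType) (y : 'M[K]_n.+1).
Hypothesis y_spec : forall y0 : 'M[C]_n.+1, exists f : {rmorphism K -> C}, map_mx f y = y0.

Let specialize (f : {rmorphism K -> C}) : {rmorphism Npoly K n -> C} :=
  f \o meval (fun=> 0).

Let specializeY f : map_mx (specialize f) (map_mx (@mpolyC (nvars n) K) y) = map_mx f y.
Proof. by apply/matrixP => i j; rewrite !mxE /= mevalC. Qed.

Let specializeU f : map_mx (specialize f) (generic K n) = 1%:M.
Proof.
have -> : map_mx (specialize f) (generic K n) =
  map_mx f (map_mx (meval (fun=> 0)) (generic K n)) by apply/matrixP => i j; rewrite !mxE.
by rewrite generic_at0 map_mx1.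
Qed.

Lemma Phid_generic_neq0 i : (i < n)%N ->
  Phid (zrow (map_mx (@mpolyC (nvars n) K) y)) (urow (generic K n)) i != 0.
Proof.
move=> lt_in; have [y0 yi] := Phid_exists_neq0 lt_in; apply: contraNneq yi => Z.
have [f fy] := y_spec y0; have := congr1 (specialize f) Z.
by rewrite (map_Phid (specialize f)) specializeY specializeU fy rmorph0 => ->.
Qed.

Lemma Psid_generic_neq0 i : (i < n)%N ->
  Psid (zrow (map_mx (@mpolyC (nvars n) K) y)) (urow (generic K n)) elast i != 0.
Proof.
move=> lt_in; have [y0 yi] := Psid_exists_neq0 lt_in; apply: contraNneq yi => Z.
have [f fy] := y_spec y0; have := congr1 (specialize f) Z.
by rewrite /Psid (map_Dd (specialize f)) specializeY specializeU fy rmorph0 => ->.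
Qed.

End NonVanishing.

Section ZeroTest.
Variable C : numFieldType.

Lemma poly_nonroot (p : {poly C}) : p != 0 -> exists t, p.[t] != 0.
Proof.
move=> p0; pose s := [seq i%:R : C | i <- iota 0 (size p)].
have us : uniq s by rewrite map_inj_uniq ?iota_uniq // => i j /eqP; rewrite eqr_nat => /eqP.
have [/(max_poly_roots p0)|] := boolP (all (root p) s).
  by move/(_ us); rewrite size_map size_iota ltnn.
by move/allPn => [t _ pt]; exists t.
Qed.

Lemma poly_eq0 (p : {poly C}) : (forall t, p.[t] = 0) -> p = 0.
Proof. by move=> pt; apply/eqP/negPn/negP => /poly_nonroot[t]; rewrite pt eqxx. Qed.

Lemma base_inj B n (m m' : nat -> nat) :
  (forall i, (i < n)%N -> m i < B)%N -> (forall i, (i < n)%N -> m' i < B)%N ->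
  (\sum_(i < n) m i * B ^ i = \sum_(i < n) m' i * B ^ i)%N ->
  forall i, (i < n)%N -> m i = m' i.
Proof.
elim: n m m' => [|n IH] m m' mB mB' //.
rewrite !big_ord_recl /= !expn0 !muln1.
have shift (f : nat -> nat) : (\sum_(i < n) f (bump 0 i) * B ^ bump 0 i =
    (\sum_(i < n) f i.+1 * B ^ i) * B)%N.
  by rewrite big_distrl; apply: eq_bigr => i _; rewrite /= /bump /= add1n expnSr mulnA.
rewrite !shift => E.
have B0 : (0 < B)%N by have := mB 0%N isT; lia.
have m0 : m 0%N = m' 0%N.
  have := congr1 (modn^~ B) E.
  by rewrite /= addnC modnMDl [(m' 0 + _)%N]addnC modnMDl !modn_small ?mB ?mB'.
case=> [|i] // iH; apply: (IH (m \o S) (m' \o S)) => //= [j jH|j jH|].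
- exact: mB.
- exact: mB'.
by apply/eqP; rewrite -(eqn_pmul2r B0) -(eqn_add2l (m 0%N)) {2}m0; apply/eqP.
Qed.

(** Kronecker's substitution reduces to one variable. *)
Lemma mpoly_nonroot n (P : {mpoly C[n]}) : P != 0 -> exists v, P.@[v] != 0.
Proof.
move=> P0; pose B := msize P.
pose e (m : 'X_{1..n}) := (\sum_(i < n) m i * B ^ i)%N.
pose p : {poly C} := \sum_(m <- msupp P) P@_m *: 'X^(e m).
have mB (m : 'X_{1..n}) i : m \in msupp P -> (m i < B)%N.
  move/msize_mdeg_lt; apply: leq_ltn_trans.
  by rewrite mdegE (bigD1 i) //= leq_addr.
have pm : p`_(e (mlead P)) = mleadc P.
  rewrite /p coef_sum (bigD1_seq (mlead P)) ?msupp_uniq ?mlead_supp //=.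
  rewrite coefZ coefXn eqxx mulr1 big_seq_cond big1 ?addr0 // => m /andP[mP nm].
  rewrite coefZ coefXn eq_sym; case: eqP => [E|_]; last by rewrite mulr0.
  case/eqP: nm; apply/mnmP => i.
  pose f (m : 'X_{1..n}) (j : nat) := if insub j is Some j' then m j' else 0%N.
  have fE (m1 : 'X_{1..n}) (j : 'I_n) : f m1 j = m1 j by rewrite /f valK.
  rewrite -!fE; apply: (@base_inj B n (f m) (f (mlead P))) => //.
  - by move=> j jn; rewrite -[j]/(val (Ordinal jn)) fE mB.
  - by move=> j jn; rewrite -[j]/(val (Ordinal jn)) fE mB // mlead_supp.
  transitivity (e m); first by apply: eq_bigr => j _; rewrite fE.
  by rewrite E; apply: eq_bigr => j _; rewrite fE.
have p0 : p != 0 by apply: contraTneq P0 => pz; rewrite -mleadc_eq0 -pm pz coef0 eqxx.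
have [t pt] := poly_nonroot p0; exists (fun i => t ^+ (B ^ i)).
rewrite mevalE; move: pt; rewrite /p horner_sum; congr (_ != 0).
apply: eq_bigr => m _; rewrite hornerZ hornerXn; congr (_ * _).
rewrite /e; elim/big_rec2: _ => [|i x y _ <-]; first by rewrite expr0.
by rewrite exprD mulnC exprM.
Qed.

Lemma mpoly_eq0 n (P : {mpoly C[n]}) : (forall v, P.@[v] = 0) -> P = 0.
Proof. by move=> pt; apply/eqP/negPn/negP => /mpoly_nonroot[t]; rewrite pt eqxx. Qed.

End ZeroTest.

Section Triangular.
Variables (C : fieldType) (N : nat).

Lemma trig_diag_neq0 (M : 'M[C]_N) i : is_trig_mx M -> M \in unitmx -> M i i != 0.
Proof.
move=> tM; rewrite unitmxE det_trig // unitfE prodf_seq_neq0 => /allP.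
by apply; rewrite mem_index_enum.
Qed.

Lemma is_trig_inv (M : 'M[C]_N) : is_trig_mx M -> M \in unitmx -> is_trig_mx (invmx M).
Proof.
move=> tM uM; apply/is_trig_mxP.
suff H d (i j : 'I_N) : (i < d)%N -> (i < j)%N -> invmx M i j = 0.
  by move=> i j; apply: (H i.+1).
elim: d i j => [|d IH] i j // id ij.
have /matrixP/(_ i j) := mulmxV uM.
rewrite !mxE -val_eqE (ltn_eqF ij) (bigD1 i) //= big1 ?addr0 => [/eqP|k ki].
  by rewrite mulf_eq0 (negPf (trig_diag_neq0 _ tM uM)) => /eqP.
have [kI|ik] := ltnP k i; first by rewrite IH ?mulr0 // (leq_trans kI) // ltnW.
have /is_trig_mxP -> := tM; first by rewrite mul0r.
by rewrite ltn_neqAle ik andbT eq_sym.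
Qed.

Lemma unitri1 : unitri (1%:M : 'M[C]_N).
Proof.
apply/andP; split; first by rewrite trmx1 scalar_mx_is_trig.
by apply/forallP => i; rewrite mxE eqxx.
Qed.

Lemma unitri_unitmx (Z : 'M[C]_N) : unitri Z -> Z \in unitmx.
Proof.
case/andP=> tZ /forallP Z1; rewrite unitmxE -det_tr det_trig // big1 ?unitr1 // => i _.
by rewrite mxE; apply/eqP.
Qed.

Lemma det_unitri (Z : 'M[C]_N) : unitri Z -> \det Z = 1.
Proof.
case/andP=> tZ /forallP Z1; rewrite -det_tr det_trig // big1 // => i _.
by rewrite mxE; apply/eqP.
Qed.

Lemma unitri_inv (Z : 'M[C]_N) : unitri Z -> unitri (invmx Z).
Proof.
move=> ZN; have uZ := unitri_unitmx ZN; case/andP: ZN => tZ /forallP Z1.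
have tI : is_trig_mx (invmx Z)^T.
  by rewrite trmx_inv is_trig_inv // unitmx_tr.
apply/andP; split=> //; apply/forallP => i.
have /matrixP/(_ i i) := mulmxV uZ; rewrite !mxE eqxx (bigD1 i) //= (eqP (Z1 i)) mul1r.
rewrite big1 ?addr0 => [->//|k ki].
have [kI|ik] := ltnP k i.
  by have /is_trig_mxP/(_ _ _ kI) := tZ; rewrite mxE => ->; rewrite mul0r.
have ik' : (i < k)%N by rewrite ltn_neqAle ik andbT eq_sym.
by have /is_trig_mxP/(_ _ _ ik') := tI; rewrite mxE => ->; rewrite mulr0.
Qed.

End Triangular.

Section Gauss.

Definition corner (S : nzRingType) N (l : nat) (M : 'M[S]_N) : 'M[S]_N :=
  \matrix_(i, j) if (i < l)%N && (j < l)%N then M i j else (i == j)%:R.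

Lemma corner1 (S : nzRingType) N l : corner l (1%:M : 'M[S]_N) = 1%:M.
Proof. by apply/matrixP => i j; rewrite !mxE; case: ifP. Qed.

Lemma map_corner (S S' : nzRingType) (f : {rmorphism S -> S'}) N l (M : 'M[S]_N) :
  map_mx f (corner l M) = corner l (map_mx f M).
Proof. by apply/matrixP => i j; rewrite !mxE; case: ifP; rewrite // rmorph_nat. Qed.

Variables (C : numFieldType) (N : nat).

(** A matrix with nonzero leading minors: the columns are cleared above the
    diagonal by solving with the leading corners. *)
Lemma gauss_exists (M : 'M[C]_N) : (forall l, (l <= N)%N -> \det (corner l M) != 0) ->
  exists b Z, [/\ in_Bminus b, unitri Z & M = b *m Z].
Proof.
move=> Mc.
pose v (l : 'I_N) : 'cV[C]_N :=
  invmx (corner l M) *m \col_i (if (i < l)%N then M i l else 0).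
pose V : 'M[C]_N := \matrix_(i, j) if (i < j)%N then - v j i 0 else (i == j)%:R.
have VN : unitri V.
  apply/andP; split; last by apply/forallP => i; rewrite mxE ltnn eqxx.
  apply/is_trig_mxP => i j ij; rewrite !mxE ltnNge (ltnW ij) /=.
  by rewrite -val_eqE gtn_eqF.
have MV : is_trig_mx (M *m V).
  apply/is_trig_mxP => i l il; rewrite mxE.
  have uM : corner l M \in unitmx by rewrite unitmxE unitfE Mc // ltnW.
  have /matrixP/(_ i 0) := mulKVmx uM (\col_i (if (i < l)%N then M i l else 0)).
  rewrite -/(v l) !mxE il => E.
  rewrite (bigID (fun j : 'I_N => (j < l)%N)) /=.
  have -> : \sum_(j < N | (j < l)%N) M i j * V j l = - M i l.
    rewrite -E [in RHS](bigID (fun j : 'I_N => (j < l)%N)) /= [X in _ = - (_ + X)]big1 ?addr0.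
      rewrite -sumrN; apply: eq_bigr => j jl; rewrite !mxE jl il /= mulrN //.
    move=> j jl; rewrite mxE (negPf jl) andbF -val_eqE.
    have -> : (i == j :> nat) = false by move: jl il; lia.
    by rewrite mul0r.
  rewrite (bigD1 l) ?ltnn //= !mxE ltnn eqxx mulr1 big1 ?addr0 ?addNr // => j /andP[jl nj].
  by rewrite mxE (negPf jl) (negPf nj) mulr0.
exists (M *m V), (invmx V); split; last by rewrite mulmxK // unitri_unitmx.
  apply/andP; split=> //; rewrite unitmx_mul (unitri_unitmx VN) andbT.
  have := Mc N (leqnn N); rewrite unitmxE unitfE; congr (\det _ != 0).
  by apply/matrixP => i j; rewrite mxE !ltn_ord.
exact: unitri_inv.
Qed.

Lemma dense_BN (P : Mpoly C N) :
  (forall b Z, in_Bminus b -> unitri Z -> mx_eval idfun (b *m Z) P = 0) -> P = 0.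
Proof.
move=> P0; apply/eqP/negPn/negP => nP.
pose g : Mpoly C N := \prod_(l < N.+1) \det (corner l (genmx C N)).
have g0 : g != 0.
  apply/prodf_neq0 => l _; apply/eqP => /(congr1 (mx_eval idfun 1%:M)).
  rewrite -det_map_mx map_corner mx_eval_gen corner1 det1 rmorph0 => /eqP.
  by rewrite oner_eq0.
have [v] := mpoly_nonroot (mulf_neq0 nP g0).
pose M : 'M[C]_N := vec_mx (\row_i v i).
have -> : (P * g).@[v] = mx_eval idfun M (P * g).
  by apply: mmap1_eq || (apply: meval_eq => i; rewrite vec_mxK mxE).
rewrite rmorphM mulf_eq0 negb_or => /andP[PM].
rewrite rmorph_prod => /prodf_neq0 gM.
have [l lN|b [Z [bB ZN ME]]] := @gauss_exists M.
  have := gM (Ordinal (lN : (l < N.+1)%N)) isT.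
  by rewrite -det_map_mx map_corner mx_eval_gen.
by move: PM; rewrite /= ME P0 // eqxx.
Qed.

End Gauss.

Section HornerCalculus.
Variable C : numFieldType.
Implicit Type p : {poly C}.

Lemma is_derive_horner p (x : C) :
  is_derive (x : C^o) (1 : C^o) (horner p : C^o -> C^o) p^`().[x].
Proof.
elim/poly_ind: p => [|p c IH].
  have -> : horner 0 = cst 0 :> (C -> C) by apply/funext => y; rewrite horner0.
  by rewrite deriv0 horner0; apply: is_derive_cst.
have -> : horner (p * 'X + c%:P) = (horner p * id + cst c)%R :> (C -> C).
  by apply/funext => y; rewrite !hornerE.
apply: is_derive_eq.
rewrite derivD derivM derivX derivC !addr0 mulr1 hornerD hornerM hornerX.
by rewrite /GRing.scale /= mulr1 addrC mulrC.
Qed.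

Lemma continuous_horner_num p : continuous (horner p : C^o -> C^o).
Proof.
elim/poly_ind: p => [|p c IH] x.
  have -> : horner 0 = cst 0 :> (C -> C) by apply/funext => y; rewrite horner0.
  exact: cst_continuous.
have -> : horner (p * 'X + c%:P) = (fun y => horner p y * y + c)%R :> (C -> C).
  by apply/funext => y; rewrite !hornerE.
apply: (@continuousD _ _ _ (fun y : C^o => (horner p y * y : C^o)) (cst c)); last exact: cst_continuous.
by apply: (@continuousM _ _ (horner p) id); [exact: IH | move=> ?].
Qed.

Lemma near_horner_neq0 p : p.[0] != 0 -> \forall t \near (0 : C), p.[t] != 0.
Proof.
move=> p0; have H := @continuous_horner_num p (0 : C^o).
by have := @cvgr_neq0 _ C^o _ _ _ _ _ H p0; apply.
Qed.

Lemma poly_ext (p q : {poly C}) : (forall t, p.[t] = q.[t]) -> p = q.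
Proof.
move=> pq; apply/eqP; rewrite -subr_eq0; apply/eqP/poly_eq0 => t.
by rewrite hornerD hornerN pq subrr.
Qed.

End HornerCalculus.

Section Restriction.
Variables (C : numFieldType) (N : nat).

(** Restriction to the unitriangular matrices. *)
Definition restr : Mpoly C N -> Npoly C N := mx_eval (@mpolyC (nvars N) C) (generic C N).

HB.instance Definition _ := GRing.RMorphism.on restr.

Lemma generic_unitri (v : 'I_(nvars N) -> C) : unitri (map_mx (meval v) (generic C N)).
Proof.
apply/andP; split; last by apply/forallP => i; rewrite mxE generic_diag rmorph1.
by apply/is_trig_mxP => i j ij; rewrite !mxE uvar_index_ge ?(ltnW ij) // -val_eqE gtn_eqF // rmorph0.
Qed.

Lemma eval_at_generic (f : Npoly C N) v :
  eval_at f (map_mx (meval v) (generic C N)) = f.@[v].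
Proof. by apply: meval_eq => i; rewrite mxE genericX mevalXU. Qed.

Lemma Npoly_ext (f g : Npoly C N) :
  (forall Z, unitri Z -> eval_at f Z = eval_at g Z) -> f = g.
Proof.
move=> fg; apply/eqP; rewrite -subr_eq0; apply/eqP/mpoly_eq0 => v.
by rewrite mevalB -!eval_at_generic fg ?subrr // generic_unitri.
Qed.

Lemma map_generic_unitri (Z : 'M[C]_N) : unitri Z ->
  map_mx (meval (fun i => Z (val (enum_val i)).1 (val (enum_val i)).2)) (generic C N) = Z.
Proof.
case/andP=> /is_trig_mxP tZ /forallP Z1; apply/matrixP => k l; rewrite !mxE.
case: (ltngtP k l) => [kl|lk|/val_inj ->].
- by rewrite (uvar_index_lt kl) mevalXU enum_rankK.
- rewrite uvar_index_ge ?(ltnW lk) // -val_eqE gtn_eqF // meval0.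
  by have := tZ _ _ lk; rewrite mxE.
by rewrite uvar_index_ge // eqxx meval1 (eqP (Z1 l)).
Qed.

Lemma eval_at_restr P (Z : 'M[C]_N) : unitri Z -> eval_at (restr P) Z = mx_eval idfun Z P.
Proof.
move=> ZN; rewrite /eval_at /restr mx_eval_comp map_generic_unitri //.
by apply: eq_mx_eval => c /=; rewrite mevalC.
Qed.

Variable p : 'I_N -> int.

(** Polynomials in the matrix entries which, multiplied by det ^ z, transform
    under left translations as the elements of V_p do. *)
Definition Wequiv (z : int) (P : Mpoly C N) : Prop :=
  forall b g, in_Bminus b -> g \in unitmx ->
    mx_eval idfun (b *m g) P = (\prod_j b j j ^ (p j - z)) * mx_eval idfun g P.

Lemma Wequiv_lin z (c : C) P Q : Wequiv z P -> Wequiv z Q -> Wequiv z (c *: P + Q).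
Proof.
move=> WP WQ b g bB gG; rewrite !rmorphD /= -mul_mpolyC !rmorphM /= !mx_evalC WP // WQ //.
by rewrite mulrDr mulrCA.
Qed.

Lemma Wequiv0 z : Wequiv z 0.
Proof. by move=> b g _ _; rewrite !rmorph0 mulr0. Qed.

Lemma Bminus_diag (b : 'M[C]_N) j : in_Bminus b -> b j j != 0.
Proof. by case/andP=> tb ub; apply: trig_diag_neq0. Qed.

Lemma prod_exprzDr (b : 'M[C]_N) (z : int) : in_Bminus b ->
  (\prod_j b j j ^ (p j - z)) * \det b ^ z = \prod_j b j j ^ p j.
Proof.
move=> bB; have /andP[tb ub] := bB; rewrite det_trig //.
rewrite (big_morph (fun x : C => x ^ z) (fun x y => expfzMl x y z) (exp1rz _ z)) -big_split; apply: eq_bigr => j _ /=.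
by rewrite -expfzDr ?subrK // Bminus_diag.
Qed.

Lemma Wequiv_Vsp z P : Wequiv z P -> in_Vsp p (restr P).
Proof.
move=> WP; exists (fun g => mx_eval idfun g P * \det g ^ z); split.
- case: z {WP} => k.
    exists (P * \det (genmx C N) ^+ k)%:P => g gG.
    rewrite map_polyC hornerC -[RHS]/(mx_eval idfun g _) rmorphM rmorphXn /=.
    by rewrite -det_map_mx mx_eval_gen.
  exists (P%:P * 'X ^+ k.+1) => g gG.
  rewrite rmorphM rmorphXn /= map_polyC map_polyX hornerM hornerC hornerXn /= NegzE.
  by rewrite -exprnN exprVn.
- move=> b g bB gG; rewrite WP // det_mulmx expfzMl -(prod_exprzDr z bB).
  by rewrite -!mulrA; congr (_ * _); rewrite mulrCA.
by move=> Z ZN; rewrite eval_at_restr // det_unitri // exp1rz mulr1.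
Qed.

Lemma map_shiftp_coef k l P (g : 'M[C]_N) :
  (map_poly (mx_eval idfun g) (shiftp k l P))`_1 = mx_eval idfun g (Edir k l P).
Proof. by rewrite coef_map. Qed.

Lemma Wequiv_Edir z k l P : k != l -> Wequiv z P -> Wequiv z (Edir k l P).
Proof.
move=> kl WP b g bB gG; rewrite -!map_shiftp_coef -coefZ.
apply: (congr1 (fun q : {poly C} => q`_1)).
apply: poly_ext => t; rewrite hornerZ !shiftp_eval -mulmxA WP //.
by rewrite unitmx_mul gG unitmxE det_elem // unitr1.
Qed.

Lemma near_gauss k l (Z : 'M[C]_N) : unitri Z -> k != l ->
  \forall t \near (0 : C), exists b Z', [/\ in_Bminus b, unitri Z' & Z *m elem k l t = b *m Z'].
Proof.
move=> ZN kl.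
pose M : 'M[{poly C}]_N := map_mx polyC Z *m elem k l 'X.
have Mt t : map_mx (horner_eval t) M = Z *m elem k l t.
  rewrite map_mxM; congr (_ *m _); apply/matrixP => i j; rewrite !mxE.
    by rewrite /= /horner_eval hornerC.
  by rewrite /= /horner_eval hornerD hornerM hornerX !hornerMn -polyC1 !hornerC.
pose q : {poly C} := \prod_(s < N.+1) \det (corner s M).
have qt t : q.[t] = \prod_(s < N.+1) \det (corner s (Z *m elem k l t)).
  rewrite -[q.[t]]/(horner_eval t q) rmorph_prod; apply: eq_bigr => s _.
  by rewrite /= -det_map_mx map_corner Mt.
have q0 : q.[0] != 0.
  rewrite qt; apply/prodf_neq0 => s _; rewrite /elem scale0r addr0 mulmx1.
  suff : unitri (corner s Z) by move/det_unitri ->; rewrite oner_eq0.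
  case/andP: ZN => /is_trig_mxP tZ /forallP Z1; apply/andP; split; last first.
    by apply/forallP => i; rewrite mxE (eqP (Z1 i)) eqxx; case: ifP.
  apply/is_trig_mxP => i j ij; rewrite !mxE; have := tZ _ _ ij; rewrite mxE => ->.
  by rewrite -val_eqE gtn_eqF // if_same.
have := near_horner_neq0 q0; apply: filterS => t.
rewrite qt => /prodf_neq0 qn; apply: gauss_exists => s sN.
exact: (qn (Ordinal (sN : (s < N.+1)%N)) isT).
Qed.

Lemma rho_restr z P k l t (Z : 'M[C]_N) : Wequiv z P -> unitri Z -> k != l ->
  (exists b Z', [/\ in_Bminus b, unitri Z' & Z *m elem k l t = b *m Z']) ->
  rho p (elem k l t) (restr P) Z = mx_eval idfun (Z *m elem k l t) P.
Proof.
move=> WP ZN kl [b [Z' ZE]]; rewrite /rho /gauss.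
case: xgetP => [bZ _ [bB ZB E]|/(_ (b, Z'))]; last by case.
rewrite eval_at_restr // E WP ?unitri_unitmx //.
have det1 : \det bZ.1 = 1.
  have := congr1 determinant E.
  by rewrite !det_mulmx det_elem // (det_unitri ZN) (det_unitri ZB) !mulr1.
by rewrite mulrC -(prod_exprzDr z bB) det1 exp1rz mulr1.
Qed.

Lemma Eact_restr z P k l (f : Vsp C p) : k != l -> Wequiv z P -> val f = restr P ->
  val (Eact k l f) = restr (Edir k l P).
Proof.
move=> kl WP fP.
have hV : restr (Edir k l P) \in Vsp_pred p.
  by apply/asboolP/(@Wequiv_Vsp z)/Wequiv_Edir.
have der Z : unitri Z -> is_derive (0 : C) (1 : C)
    (fun t : C => rho p (1%:M + t *: delta_mx k l) f Z) (eval_at (restr (Edir k l P)) Z).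
  move=> ZN; pose P_ := map_poly (mx_eval idfun Z) (shiftp k l P).
  apply: (@near_eq_is_derive _ _ _ (horner P_)).
    have := near_gauss ZN kl; apply: filterS => t gt.
    by rewrite shiftp_eval -[Vsp_val f]/(val f) fP -(rho_restr WP).
  have -> : eval_at (restr (Edir k l P)) Z = P_^`().[0].
    rewrite eval_at_restr // horner_coef0 coef_deriv mulr1n.
    by rewrite map_shiftp_coef.
  exact: is_derive_horner.
rewrite /Eact; case: xgetP => [h _ hder|/(_ (MkVsp hV))]; last by case.
apply: Npoly_ext => Z ZN.
by have [_ <-] := hder Z ZN; have [_ <-] := der Z ZN.
Qed.

End Restriction.

Lemma big_nat_shift (T : Type) (idx : T) (op : T -> T -> T) a s (F : nat -> T) :
  \big[op/idx]_(a <= i < a + s) F (i - a)%N = \big[op/idx]_(0 <= i < s) F i.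
Proof.
rewrite /index_iota addKn subn0 -{1}[a]addn0 iotaDl big_map.
by apply: eq_bigr => i _; rewrite addKn.
Qed.

Section LowerTriangular.
Variables (B : comNzRingType) (n : nat).

Lemma blockdet_trig_z (b Y : 'M[B]_n.+1) a u : is_trig_mx b ->
  blockdet a (zrow (b *m Y)) u =
  (\prod_(l < n.+1 | (l < a)%N) b l l) * blockdet a (zrow Y) u.
Proof.
move=> /is_trig_mxP tb.
pose b' : 'M[B]_n.+1 := \matrix_(i, j) if (i < a)%N then b i j else (i == j)%:R.
have -> : \prod_(l < n.+1 | (l < a)%N) b l l = \det b'.
  rewrite det_trig; first by rewrite big_mkcond; apply: eq_bigr => i _; rewrite mxE eqxx.
  apply/is_trig_mxP => i j ij; rewrite mxE; case: ifP => _; first exact: tb.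
  by rewrite -val_eqE ltn_eqF.
rewrite /blockdet -det_mulmx; congr (\det _); apply/matrixP => i j; rewrite !mxE.
case: ifP => ia; last first.
  rewrite (bigD1 i) //= big1 ?addr0 => [|k ki]; first by rewrite !mxE ia eqxx mul1r.
  by rewrite !mxE ia eq_sym (negPf ki) mul0r.
rewrite (zrowE _ (ltn_ord i)) !mxE; apply: eq_bigr => k _; rewrite !mxE ia.
rewrite (_ : Ordinal _ = i); last exact: val_inj.
have [ki|ik] := leqP k i; last by rewrite tb ?mul0r.
rewrite (leq_ltn_trans ki ia) (zrowE _ (ltn_ord k)) mxE.
by congr (_ * Y _ _); apply: val_inj.
Qed.

Lemma blockdet_trig_u (b X : 'M[B]_n) a s z (w : nat -> 'rV[B]_n.+1) :
  (a + s <= n.+1)%N -> (s <= n)%N -> is_trig_mx b ->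
  blockdet a z (fun j => if (j < s)%N then urow (b *m X) j else w j) =
  (\prod_(l < n | (l < s)%N) b l l) *
  blockdet a z (fun j => if (j < s)%N then urow X j else w j).
Proof.
move=> as_n sn /is_trig_mxP tb.
pose bn (i j : nat) : B :=
  if (insub i, insub j) is (Some i', Some j') then b i' j' else 0.
have bnE (i j : 'I_n) : bn i j = b i j by rewrite /bn !valK.
pose b' : 'M[B]_n.+1 := \matrix_(i, j)
   if (a <= i < a + s)%N then (if (j < a)%N then 0 else bn (i - a)%N (j - a)%N)
   else (i == j)%:R.
have detb : \prod_(l < n | (l < s)%N) b l l = \det b'.
  rewrite det_trig; last first.
    apply/is_trig_mxP => i j ij; rewrite mxE; case: ifP => ia.
      case: ifP => // ja; have iN : (i - a < n)%N by lia.
      rewrite /bn insubT /=; case: insubP => [j' _ jE|//]; rewrite tb //.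
      by rewrite jE /=; lia.
    by rewrite -val_eqE ltn_eqF.
  transitivity (\prod_(0 <= l < s) bn l l).
    rewrite (big_nat_widen _ _ n) // big_mkord; apply: eq_bigr => l _.
    by rewrite bnE.
  transitivity (\prod_(i < n.+1) if (a <= i < a + s)%N then bn (i - a)%N (i - a)%N else 1).
    rewrite -big_mkcond /=.
    transitivity (\prod_(a <= i < a + s) bn (i - a)%N (i - a)%N).
      by rewrite (big_nat_shift _ _ a s (fun l => bn l l)).
    rewrite (big_nat_widen _ _ n.+1) // big_geq_mkord.
    by apply: eq_bigl => i /=; rewrite andbC.
  apply: eq_bigr => i _; rewrite mxE eqxx; case: ifP => // /andP[ai _].
  by rewrite ltnNge ai.
rewrite detb /blockdet -det_mulmx; congr (\det _); apply/matrixP => i j; rewrite !mxE.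
have [ias|ias] := boolP (a <= i < a + s)%N; last first.
  rewrite (bigD1 i) //= big1 ?addr0 => [|k ki]; last first.
    by rewrite !mxE (negPf ias) eq_sym (negPf ki) mul0r.
  rewrite !mxE (negPf ias) eqxx mul1r; case: ifP => // ia.
  by case: ifP => // is_; lia.
have [ai isa] := andP ias.
have iN : (i - a < n)%N by lia.
rewrite ltnNge ai /= (_ : (i - a < s)%N); last lia.
case: (unliftP ord_max j) => [j' ->|->]; last first.
  rewrite urow_max big1 // => k _; rewrite !mxE ias.
  case: ifP => ka; first by rewrite mul0r.
  case: ifP => ks; first by rewrite urow_max mulr0.
  rewrite /bn insubT /=; case: insubP => [k' _ kE|]; last by rewrite mul0r.
  by rewrite tb ?mul0r // kE /=; lia.
rewrite (urow_lift _ iN) mxE.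
rewrite (bigID (fun k : 'I_n.+1 => (a <= k < a + s)%N)) /= [X in _ = _ + X]big1 ?addr0; last first.
  move=> k ks; rewrite !mxE ias.
  case: ifP => ka; first by rewrite mul0r.
  rewrite /bn insubT /=; case: insubP => [k' _ kE|]; last by rewrite mul0r.
  by rewrite tb ?mul0r // kE /=; lia.
transitivity (\sum_(0 <= k < s) bn (i - a)%N k * urow X k 0 (lift ord_max j')).
  rewrite (bigID (fun k : 'I_n => (k < s)%N)) /= [X in _ + X]big1 ?addr0 => [|k ks]; last first.
    by rewrite tb ?mul0r //=; lia.
  rewrite (big_nat_widen _ _ n) // big_mkord; apply: eq_bigr => k _.
  rewrite (urow_lift _ (ltn_ord k)) -[bn _ _]/(bn (Ordinal iN) k) bnE.
  by congr (_ * X _ _); apply: val_inj.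
transitivity (\sum_(a <= k < a + s) bn (i - a)%N (k - a)%N * urow X (k - a) 0 (lift ord_max j')).
  by rewrite (big_nat_shift _ _ a s
       (fun k => bn (i - a)%N k * urow X k 0 (lift ord_max j'))).
rewrite (big_nat_widen _ _ n.+1) // big_geq_mkord /=.
apply: eq_big => [k|k /andP[ks ak]]; first by rewrite andbC.
by rewrite !mxE ias ltnNge ak /= (_ : (k - a < s)%N) //; lia.
Qed.

Lemma Phid_trig_u (b X : 'M[B]_n) z i : (i < n)%N -> is_trig_mx b ->
  Phid z (urow (b *m X)) i = (\prod_(l < n | (l < i.+1)%N) b l l) * Phid z (urow X) i.
Proof.
move=> lt_in tb.
have E V : Phid z (urow V) i =
    blockdet (n - i) z (fun j => if (j < i.+1)%N then urow V j else 0).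
  by apply: eq_blockdet => j jH; rewrite (_ : (j < i.+1)%N); last lia.
by rewrite !E blockdet_trig_u //; lia.
Qed.

Lemma Psid_trig_u (b X : 'M[B]_n) z e i : (i < n)%N -> is_trig_mx b ->
  Psid z (urow (b *m X)) e i = (\prod_(l < n | (l < i)%N) b l l) * Psid z (urow X) e i.
Proof.
move=> lt_in tb.
have E V : Psid z (urow V) e i =
    blockdet (n - i) z (fun j => if (j < i)%N then urow V j else e).
  apply: eq_blockdet => j jH; rewrite /upd; case: eqP => [->|ji]; first by rewrite ltnn.
  by rewrite (_ : (j < i)%N); last lia.
by rewrite !E blockdet_trig_u //; lia.
Qed.

End LowerTriangular.

Section KernTrig.
Variables (B : comNzRingType) (n : nat) (Y : 'M[B]_n.+1) (X : 'M[B]_n) (ea eb : nat -> nat).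

Let prodMX (x x' c : 'I_n -> B) (e : nat -> nat) : (forall i, x' i = c i * x i) ->
  \prod_(i < n) x' i ^+ e i = (\prod_(i < n) c i ^+ e i) * (\prod_(i < n) x i ^+ e i).
Proof. by move=> E; rewrite -big_split; apply: eq_bigr => i _; rewrite E exprMn. Qed.

Lemma kern_trig_z (b : 'M[B]_n.+1) : is_trig_mx b ->
  kern (b *m Y) X ea eb =
  (\prod_j b j j ^+ (\sum_(i < n | (j < n - i)%N) (ea i + eb i))) * kern Y X ea eb.
Proof.
move=> tb; rewrite /kern /Lmon.
have PhiE (i : 'I_n) : Phid (zrow (b *m Y)) (urow X) i =
    (\prod_(l < n.+1 | (l < n - i)%N) b l l) * Phid (zrow Y) (urow X) i.
  exact: blockdet_trig_z.
have PsiE (i : 'I_n) : Psid (zrow (b *m Y)) (urow X) elast i =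
    (\prod_(l < n.+1 | (l < n - i)%N) b l l) * Psid (zrow Y) (urow X) elast i.
  exact: blockdet_trig_z.
rewrite (prodMX _ PhiE) (prodMX _ PsiE) mulrACA; congr (_ * _); rewrite -big_split /=.
transitivity (\prod_(i < n) \prod_(l < n.+1 | (l < n - i)%N) b l l ^+ (ea i + eb i)).
  by apply: eq_bigr => i _; rewrite -exprD prodrXl.
rewrite (exchange_big_dep xpredT) //=; apply: eq_bigr => j _.
by rewrite expr_sum.
Qed.

Lemma kern_trig_u (b : 'M[B]_n) : is_trig_mx b ->
  kern Y (b *m X) ea eb =
  (\prod_l b l l ^+ (\sum_(i < n | (l <= i)%N) ea i + \sum_(i < n | (l < i)%N) eb i))
  * kern Y X ea eb.
Proof.
move=> tb; rewrite /kern /Lmon.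
have PhiE (i : 'I_n) := Phid_trig_u X (zrow Y) (ltn_ord i) tb.
have PsiE (i : 'I_n) := Psid_trig_u X (zrow Y) elast (ltn_ord i) tb.
rewrite (prodMX _ PhiE) (prodMX _ PsiE) mulrACA; congr (_ * _).
transitivity ((\prod_l b l l ^+ (\sum_(i < n | (l <= i)%N) ea i)) *
  (\prod_l b l l ^+ (\sum_(i < n | (l < i)%N) eb i))); last first.
  by rewrite -big_split; apply: eq_bigr => l _; rewrite /= exprD.
congr (_ * _).
  transitivity (\prod_(i < n) \prod_(l < n | (l < i.+1)%N) b l l ^+ ea i).
    by apply: eq_bigr => i _; rewrite prodrXl.
  rewrite (exchange_big_dep xpredT) //=; apply: eq_bigr => j _.
  by rewrite expr_sum.
transitivity (\prod_(i < n) \prod_(l < n | (l < i)%N) b l l ^+ eb i).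
  by apply: eq_bigr => i _; rewrite prodrXl.
rewrite (exchange_big_dep xpredT) //=; apply: eq_bigr => j _.
by rewrite expr_sum.
Qed.

End KernTrig.

Section Exponents.
Variables (n : nat) (r : 'I_n.+1 -> int) (q : {ffun 'I_n -> int}).

Definition rnat (i : nat) : int := r (inord i).
Definition qnat (i : nat) : int := if insub i is Some i' then q i' else 0.
Definition expA (i : nat) : nat := `|qnat i - rnat i.+1|%N.
Definition expB (i : nat) : nat := `|rnat i - qnat i|%N.

Lemma qnatE (i : 'I_n) : qnat i = q i.
Proof. by rewrite /qnat valK. Qed.

Lemma rnatE (i : 'I_n.+1) : rnat i = r i.
Proof. by rewrite /rnat inord_val. Qed.

Lemma rnat_lift (i : 'I_n) : rnat i.+1 = r (lift ord0 i).
Proof. by rewrite -rnatE. Qed.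

Lemma rnat_widen (i : 'I_n) : rnat i = r (widen_ord (leqnSn n) i).
Proof. by rewrite -rnatE. Qed.

Hypothesis q_int : interlaces r q.

Lemma interlacesE i : (i < n)%N -> rnat i.+1 <= qnat i <= rnat i.
Proof.
move=> lt_in; have /forallP/(_ (Ordinal lt_in)) := q_int.
by rewrite -rnat_lift -rnat_widen -qnatE.
Qed.

Lemma expAE i : (i < n)%N -> (expA i)%:Z = qnat i - rnat i.+1.
Proof. by move=> /interlacesE /andP[a b]; rewrite /expA gez0_abs ?subr_ge0. Qed.

Lemma expBE i : (i < n)%N -> (expB i)%:Z = rnat i - qnat i.
Proof. by move=> /interlacesE /andP[a b]; rewrite /expB gez0_abs ?subr_ge0. Qed.

Lemma sum_expAB (j : nat) : (j <= n)%N ->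
  (\sum_(i < n | (j < n - i)%N) (expA i + expB i))%:Z = rnat 0 - rnat (n - j).
Proof.
move=> jn.
rewrite -[LHS](@natz _) natr_sum.
transitivity (\sum_(0 <= i < n - j) - (rnat i.+1 - rnat i)).
  rewrite (big_nat_widen _ _ n); last by rewrite leq_subr.
  rewrite big_mkord; apply: eq_big => [i|i iH]; first by lia.
  by rewrite natz PoszD expAE // expBE //; ring.
by rewrite sumrN telescope_sumr // opprB.
Qed.

Lemma sum_expA_expB (l : nat) : (l < n)%N ->
  (\sum_(i < n | (l <= i)%N) expA i + \sum_(i < n | (l < i)%N) expB i)%:Z =
  qnat l - rnat n.
Proof.
move=> ln; rewrite -[LHS](@natz _) natrD !natr_sum.
have -> : \sum_(i < n | (l <= i)%N) (expA i)%:R = \sum_(l <= i < n) (qnat i - rnat i.+1).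
  rewrite big_geq_mkord /=; apply: eq_bigr => i _.
  by rewrite natz expAE.
have -> : \sum_(i < n | (l < i)%N) (expB i)%:R = \sum_(l.+1 <= i < n) (rnat i - qnat i).
  by rewrite big_geq_mkord /=; apply: eq_bigr => i _; rewrite natz expBE.
rewrite big_ltn // -addrA -big_split /=.
have -> : \sum_(l.+1 <= i < n) (qnat i - rnat i.+1 + (rnat i - qnat i)) =
   - \sum_(l.+1 <= i < n) (rnat i.+1 - rnat i).
  by rewrite -sumrN; apply: eq_bigr => i _; ring.
by rewrite telescope_sumr //; ring.
Qed.

End Exponents.

Section KernelIdentification.
Variables (C : numFieldType) (n : nat) (r : 'I_n.+1 -> int) (q : {ffun 'I_n -> int}).

Local Notation Zg := (Zgen C n).
Local Notation Ug := (Ugen C n).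

Lemma PhiE (i : 'I_n) : Phi C n i.+1 = Phid (zrow Zg) (urow Ug) i.
Proof.
rewrite /Phi /Phid subSS; congr (\det _); apply/matrixP => s t; rewrite !mxE.
case: ifP => _; rewrite /entry.
  by rewrite /zrow; case: insub => [s'|]; rewrite !mxE.
rewrite /urow; case: insub => [s'|]; rewrite !mxE //.
Qed.

Lemma Psid_expand (B : comNzRingType) (Y : 'M[B]_n.+1) (X : 'M[B]_n) i : (i < n)%N ->
  Psid (zrow Y) (urow X) elast i =
  \det (\matrix_(s < n, t < n) if (s < n - i)%N then zrow Y s 0 (lift ord_max t)
        else urow X (s - (n - i)) 0 (lift ord_max t)).
Proof.
move=> lt_in; rewrite /Psid /Dd /blockdet (expand_det_row _ ord_max).
rewrite (bigD1 ord_max) //= big1 ?addr0 => [|c cm]; last first.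
  rewrite !mxE /= ltnNge leq_subr /= subKn ?(ltnW lt_in) // upd_same mxE.
  by rewrite (negPf cm) andbF mul0r.
rewrite !mxE /= ltnNge leq_subr /= subKn ?(ltnW lt_in) // upd_same mxE !eqxx mul1r.
rewrite /cofactor addnn -muln2 exprM sqrr_sign mul1r; congr (\det _).
apply/matrixP => s t; rewrite !mxE.
have -> : lift ord_max s = s :> nat by rewrite /= /bump leqNgt ltn_ord.
case: ifP => // si; rewrite upd_neq //; have := ltn_ord s; lia.
Qed.

Lemma PsiE (i : 'I_n) : Psi C n i = Psid (zrow Zg) (urow Ug) elast i.
Proof.
rewrite (Psid_expand _ _ (ltn_ord i)) /Psi; congr (\det _); apply/matrixP => s t; rewrite !mxE.
case: ifP => si; rewrite /entry.
  by rewrite /zrow; case: insub => [s'|]; rewrite !mxE.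
have sn : (s - (n - i) < n)%N by have := ltn_ord s; have := ltn_ord i; lia.
by rewrite (urow_lift _ sn) insubT /= ; congr (Ug _ _); apply: val_inj.
Qed.

Lemma Psi0E : (0 < n)%N -> Psid (zrow Zg) (urow Ug) elast 0 = 1.
Proof.
move=> n0; rewrite (Psid_expand _ _ n0) -det_tr det_trig; first rewrite big1 => [|i _] //.
  rewrite !mxE subn0 ltn_ord (zrowE _ (ltnW (ltn_ord i))) !mxE uvar_index_ge /=.
    by rewrite -val_eqE /= /bump leqNgt ltn_ord eqxx mpolyC1.
  by rewrite /= /bump; have := ltn_ord i; lia.
apply/is_trig_mxP => i j ij; rewrite !mxE subn0 ltn_ord (zrowE _ (ltnW (ltn_ord j))) !mxE.
rewrite uvar_index_ge; last by rewrite /= /bump; have := ltn_ord i; lia.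
by rewrite -val_eqE /= /bump leqNgt ltn_ord gtn_eqF // mpolyC0.
Qed.

Lemma Lker_kern : Lker C r q = kern Zg Ug (expA r q) (expB r q).
Proof.
rewrite /Lker /kern /Lmon; congr (_ * _).
  apply: eq_bigr => i _; rewrite PhiE /expA qnatE rnat_lift //.
rewrite big_mkcond; apply: eq_bigr => i _; rewrite -PsiE /expB qnatE rnat_widen.
case: ifP => // /negbT; rewrite -eqn0Ngt => /eqP i0.
have n0 : (0 < n)%N by have := ltn_ord i; lia.
by rewrite PsiE i0 Psi0E // expr1n.
Qed.

End KernelIdentification.

Section Lagrange.
Variables (C : fieldType) (I : finType) (P : pred I) (x : I -> C).

Let node (Q : pred I) : {poly C} := \prod_(a | Q a) ('X - (x a)%:P).

Let size_node Q : size (node Q) = #|Q|.+1.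
Proof.
by rewrite /node -big_filter size_prod_XsubC -sum1_card -big_filter sum1_size.
Qed.

Let node_monic Q : node Q \is monic.
Proof. by apply: monic_prod_XsubC. Qed.

(** Comparison of leading coefficients in Lagrange's interpolation formula for
    a monic polynomial of degree d at d + 1 nodes. *)
Lemma lagrange_sum (s d : nat) (rho : nat -> C) :
  #|P| = d.+1 -> {in P &, injective x} ->
  \sum_(m | P m) (\prod_(s <= t < s + d) (x m - rho t)) /
     (\prod_(a | P a && (a != m)) (x m - x a)) = 1.
Proof.
move=> cP xinj.
pose p : {poly C} := \prod_(s <= t < s + d) ('X - (rho t)%:P).
have p_monic : p \is monic by apply: monic_prod_XsubC.
have size_p : size p = d.+1 by rewrite size_prod_XsubC size_iota addKn.
pose den m := \prod_(a | P a && (a != m)) (x m - x a).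
have evp m : p.[x m] = \prod_(s <= t < s + d) (x m - rho t).
  by rewrite horner_prod; apply: eq_bigr => t _; rewrite !hornerE.
have ev Q y : (node Q).[y] = \prod_(a | Q a) (y - x a).
  by rewrite horner_prod; apply: eq_bigr => t _; rewrite !hornerE.
have den0 m : P m -> den m != 0.
  move=> Pm; apply/prodf_neq0 => a /andP[Pa am]; rewrite subr_eq0.
  by apply: contraNneq am => /xinj E; rewrite E.
have cardQ m : P m -> #|[pred a | P a && (a != m)]| = d.
  move=> Pm; have := cardD1 m P; rewrite cP [m \in P]Pm add1n => -[->].
  by apply: eq_card => a; rewrite !inE andbC.
pose l : {poly C} := \sum_(m | P m) (p.[x m] / den m) *: node [pred a | P a && (a != m)].
have lp : p = l.
  apply/eqP; rewrite -subr_eq0; apply/negPn/negP => nz.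
  have size_l : (size (p - l)%R <= d.+1)%N.
    rewrite (leq_trans (size_polyD _ _)) // geq_max size_p leqnn size_polyN /=.
    apply: (leq_trans (size_sum _ _ _)); apply/bigmax_leqP => m Pm.
    by rewrite (leq_trans (size_scale_leq _ _)) // size_node cardQ.
  have := @max_poly_roots _ _ [seq x m | m <- enum P] nz.
  rewrite size_map -cardE cP ltnNge size_l => max_roots.
  apply: (negP (isT : ~~ false)); apply: max_roots.
    apply/allP => y /mapP[m]; rewrite mem_enum => Pm ->.
    rewrite rootE hornerD hornerN subr_eq0 horner_sum (bigD1 m) //=.
    rewrite hornerZ ev [X in _ == _ + X]big1 ?addr0 => [|k /andP[Pk km]].
      by rewrite -[X in _ * X]/(den m) divfK // den0.
    rewrite hornerZ ev (bigD1 m) /=; last by rewrite eq_sym km andbT.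
    by rewrite subrr mul0r mulr0.
  rewrite map_inj_in_uniq ?enum_uniq // => a b.
  by rewrite !mem_enum; apply: xinj.
have := congr1 (coefp d) lp; rewrite /coefp /=.
have -> : p`_d = 1 by rewrite -(monicP p_monic) lead_coefE size_p.
rewrite coef_sum => E; rewrite [RHS]E; apply: eq_bigr => m Pm; rewrite coefZ evp.
have -> : (node [pred a | P a && (a != m)])`_d = 1.
  by have /monicP := node_monic [pred a | P a && (a != m)]; rewrite lead_coefE size_node cardQ.
by rewrite mulr1.
Qed.

End Lagrange.

Section Coefficients.
Variables (C : numFieldType) (n : nat) (r : 'I_n.+1 -> int) (q : {ffun 'I_n -> int}).
Hypothesis q_int : interlaces r q.

Local Notation ea := (expA r q).
Local Notation eb := (expB r q).

Definition ycoord (l : nat) : int := qnat q l - l%:Z.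

Local Notation y := ycoord.

Definition clower (m t : nat) : int := y m - (rnat r t - t%:Z + 1).
Definition cupper (m t : nat) : int := y m - (rnat r t - t%:Z).

Lemma ycoordE i : (i.+1 < n)%N -> y i - y i.+1 = (ea i)%:Z + (eb i.+1)%:Z + 1.
Proof.
move=> lt_in; rewrite expAE // ?expBE //; last exact: ltnW.
by rewrite /y -[i.+1]addn1 PoszD; ring.
Qed.

Lemma clowerE m k : (k < n)%N -> clower m k.+1 = (ea k)%:Z + (y m - y k).
Proof. by move=> kn; rewrite expAE // /clower /y -[k.+1]addn1 PoszD; ring. Qed.

Lemma cupperE m k : (k < n)%N -> cupper m k = y m - y k - (eb k)%:Z.
Proof. by move=> kn; rewrite expBE // /cupper /y; ring. Qed.

Lemma ycoord_lt i j : (i < j < n)%N -> y j < y i.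
Proof.
elim: j => [|j IH] H; first lia.
have jn : (j.+1 < n)%N by lia.
have := ycoordE jn => E; have {E} jj : y j.+1 < y j.
  by rewrite -subr_gt0 E ltr_wpDl.
case: (ltngtP i j) => [ij||->] //; last lia.
by apply: lt_trans jj (IH _); lia.
Qed.

Lemma ycoord_inj : {in xpredT &, injective (fun i : 'I_n => (y i)%:~R : C)}.
Proof.
move=> i j _ _ /intr_inj E; apply: val_inj; case: (ltngtP i j) => // ij.
  by have := @ycoord_lt i j; rewrite ij ltn_ord E ltxx => /(_ isT).
by have := @ycoord_lt j i; rewrite ij ltn_ord E ltxx => /(_ isT).
Qed.

Let dy (m a : 'I_n) : C := (y m)%:~R - (y a)%:~R.

Let dy_neq0 m a : a != m -> dy m a != 0.
Proof. by move=> am; rewrite subr_eq0; apply: contraNneq am => /ycoord_inj ->. Qed.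

Lemma AcoefE (m : 'I_n) :
  Acoef C r q m = (\prod_(m.+1 <= t < n.+1) (clower m t)%:~R) / (\prod_(a | a != m) dy m a).
Proof.
rewrite /Acoef; congr (_ / _).
  rewrite big_geq_mkord; apply: eq_bigr => j _; congr (_%:~R).
  by rewrite /clower /y qnatE rnatE; ring.
apply: eq_bigr => a _; rewrite /dy -intrB; congr (_%:~R).
by rewrite /y !qnatE; ring.
Qed.

Lemma BcoefE (m : 'I_n) :
  Bcoef C r q m = (\prod_(0 <= t < m.+1) (cupper m t)%:~R) / (\prod_(a | a != m) dy m a).
Proof.
rewrite /Bcoef; congr (_ / _).
  rewrite (big_nat_widen _ _ n.+1) ?big_mkord; last by rewrite ltnS ltnW.
  by apply: eq_bigr => j _; congr (_%:~R); rewrite /cupper /y qnatE rnatE; ring.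
apply: eq_bigr => a _; rewrite /dy -intrB; congr (_%:~R).
by rewrite /y !qnatE; ring.
Qed.

Lemma Acoef_eq0 (m : 'I_n) : ea m = 0%N -> Acoef C r q m = 0.
Proof.
move=> e0; rewrite AcoefE big_ltn ?ltnS // clowerE // e0 subrr addr0.
by rewrite !mul0r.
Qed.

Lemma Bcoef_eq0 (m : 'I_n) : eb m = 0%N -> Bcoef C r q m = 0.
Proof.
move=> e0; rewrite BcoefE big_nat_recr //= cupperE // e0 !subrr.
by rewrite mulr0 mul0r.
Qed.

Let gapE (m : 'I_n) (a b : nat) : (b <= n)%N ->
  (gap y m a b)%:~R = \prod_(l < n | (a <= l < b)%N) dy m l :> C.
Proof.
move=> bn; rewrite /gap rmorph_prod (big_nat_widen _ _ n) // big_geq_mkord.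
apply: eq_big => [l|l _]; first by rewrite andbC.
by rewrite /= intrB.
Qed.

Lemma sum_Acoef (i : 'I_n) :
  \sum_(m < n | (i <= m)%N)
     Acoef C r q m * (gap y m 0 i * lower_coef m ea (clower m) i)%:~R = (ea i)%:R.
Proof.
pose rho t : C := (rnat r t - t%:Z + 1)%:~R.
have rhoE (m : 'I_n) t : (clower m t)%:~R = (y m)%:~R - rho t by rewrite /clower intrB.
have := @lagrange_sum C _ (fun m : 'I_n => (i <= m)%N) (fun m => (y m)%:~R)
  i.+2 (n - i.+1) rho.
have -> : #|(fun m : 'I_n => (i <= m)%N)| = (n - i.+1).+1.
  rewrite -sum1_card -[LHS](big_geq_mkord _ _ xpredT (fun=> 1%N)) sum_nat_const_nat muln1.
  by have := ltn_ord i; lia.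
move=> /(_ erefl) H; rewrite -[RHS]mulr1 -[X in _ = _ * X]H; last first.
  by move=> a b _ _; apply: ycoord_inj.
rewrite mulr_sumr; apply: eq_bigr => m im; rewrite AcoefE intrM gapE; last exact: ltnW.
rewrite [X in _ / X](bigID (fun a : 'I_n => (a < i)%N)) /=.
have -> : \prod_(a < n | (a != m) && (a < i)%N) dy m a = \prod_(a < n | (a < i)%N) dy m a.
  by apply: eq_bigl => a; rewrite -val_eqE /=; lia.
have -> : \prod_(a < n | (a != m) && ~~ (a < i)%N) dy m a =
          \prod_(a < n | (i <= a)%N && (a != m)) dy m a.
  by apply: eq_bigl => a; rewrite -leqNgt andbC.
set N := \prod_(m.+1 <= t < n.+1) _; set L := \prod_(a < n | (a < i)%N) dy m a.
set D := \prod_(a < n | (i <= a)%N && (a != m)) _; set c := (lower_coef _ _ _ _)%:~R.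
have L0 : L != 0 by apply/prodf_neq0 => a ai; apply: dy_neq0; rewrite -val_eqE /=; lia.
have D0 : D != 0 by apply/prodf_neq0 => a /andP[_]; apply: dy_neq0.
have -> : N / (L * D) * (L * c) = (N * c) / D by field; rewrite ?L0 ?D0.
rewrite mulrA; congr (_ / _); rewrite /N /c /lower_coef.
have -> : (i.+2 + (n - i.+1) = n.+1)%N by have := ltn_ord i; lia.
have PE a b : \prod_(a <= t < b) ((y m)%:~R - rho t) = \prod_(a <= t < b) (clower m t)%:~R.
  by apply: eq_bigr => t _; rewrite rhoE.
rewrite PE; case: eqP => [E|/eqP nim].
  rewrite mulr1 E.
  rewrite [LHS]big_ltn; last exact: (ltn_ord m).
  rewrite clowerE; last exact: ltn_ord.
  by rewrite subrr addr0 pmulrn.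
rewrite intrM mulrCA -pmulrn rmorph_prod; congr (_ * _).
rewrite mulrC -big_cat_nat //=; have := ltn_ord m; lia.
Qed.

Lemma sum_Bcoef (i : 'I_n) :
  \sum_(m < n | (m <= i)%N)
     Bcoef C r q m * (gap y m i.+1 n * upper_coef m eb (cupper m) i)%:~R = - (eb i)%:R.
Proof.
pose rho t : C := (rnat r t - t%:Z)%:~R.
have rhoE (m : 'I_n) t : (cupper m t)%:~R = (y m)%:~R - rho t by rewrite /cupper intrB.
have := @lagrange_sum C _ (fun m : 'I_n => (m <= i)%N) (fun m => (y m)%:~R) 0 i rho.
have -> : #|(fun m : 'I_n => (m <= i)%N)| = i.+1.
  rewrite -sum1_card; transitivity (\sum_(0 <= m < i.+1) 1)%N.
    rewrite (big_nat_widen _ _ n) ?big_mkord //; exact: ltn_ord.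
  by rewrite sum_nat_const_nat muln1.
move=> /(_ erefl) H; rewrite -[RHS]mulr1 -[X in _ = _ * X]H; last first.
  by move=> a b _ _; apply: ycoord_inj.
rewrite mulr_sumr; apply: eq_bigr => m im; rewrite BcoefE intrM gapE //.
rewrite [X in _ / X](bigID (fun a : 'I_n => (i < a)%N)) /=.
have -> : \prod_(a < n | (a != m) && (i < a)%N) dy m a =
          \prod_(a < n | (i < a < n)%N) dy m a.
  by apply: eq_bigl => a; rewrite -val_eqE /= ltn_ord andbT; lia.
have -> : \prod_(a < n | (a != m) && ~~ (i < a)%N) dy m a =
          \prod_(a < n | (a <= i)%N && (a != m)) dy m a.
  by apply: eq_bigl => a; rewrite -leqNgt andbC.
set N := \prod_(0 <= t < m.+1) _; set L := \prod_(a < n | (i < a < n)%N) dy m a.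
set D := \prod_(a < n | (a <= i)%N && (a != m)) _; set c := (upper_coef _ _ _ _)%:~R.
have L0 : L != 0.
  by apply/prodf_neq0 => a ai; apply: dy_neq0; rewrite -val_eqE /=; lia.
have D0 : D != 0 by apply/prodf_neq0 => a /andP[_]; apply: dy_neq0.
have -> : N / (L * D) * (L * c) = (N * c) / D by field; rewrite ?L0 ?D0.
rewrite mulrA; congr (_ / _); rewrite /N /c /upper_coef add0n.
have PE a b : \prod_(a <= t < b) ((y m)%:~R - rho t) = \prod_(a <= t < b) (cupper m t)%:~R.
  by apply: eq_bigr => t _; rewrite rhoE.
rewrite PE; case: eqP => [E|/eqP nim].
  rewrite mulr1 E.
  rewrite [LHS]big_nat_recr; last exact: leq0n.
  rewrite cupperE; last exact: ltn_ord.
  by rewrite subrr sub0r mulrC intrN pmulrn.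
rewrite intrM intrN mulrCA -pmulrn rmorph_prod; congr (_ * _).
by rewrite -big_cat_nat //=; lia.
Qed.

End Coefficients.

(** An additive map applied to the coefficients commutes with the operators
    R_I, whose coefficients are integral. *)
Section CoefficientMaps.
Variables (K K' : comNzRingType) (n : nat) (xi : {additive K -> K'}).
Local Notation M := (map_mpoly xi : Npoly K n -> Npoly K' n).

Lemma map_mpoly_deriv v (f : Npoly K n) : M (mderiv v f) = mderiv v (M f).
Proof.
apply/mpolyP => m.
by rewrite [LHS]mcoeff_map_mpoly !mcoeff_deriv raddfMn mcoeff_map_mpoly.
Qed.

Lemma map_mpolyMX v (f : Npoly K n) : M ('X_v * f) = 'X_v * M f.
Proof.
apply/mpolyP => m; rewrite [LHS]mcoeff_map_mpoly !mcoeffM raddf_sum.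
apply: eq_bigr => k _; rewrite /= !mcoeffX mcoeff_map_mpoly.
by rewrite !mulr_natl raddfMn.
Qed.

Lemma map_mpoly_generic k l (f : Npoly K n) :
  M (generic K n k l * f) = generic K' n k l * M f.
Proof.
rewrite !mxE; case: uvar_index => [v|]; first exact: map_mpolyMX.
by rewrite !mulr_natl raddfMn.
Qed.

Lemma map_mpoly_Rop k l (f : Npoly K n) : M (Rop k l f) = Rop k l (M f).
Proof.
rewrite !RopE raddf_sum; apply: eq_bigr => j _.
rewrite [LHS]map_mpoly_generic; congr (_ * _).
by rewrite /partial; case: uvar_index => [v|]; [exact: map_mpoly_deriv | exact: raddf0].
Qed.

Lemma map_mpoly_Rset I (f : Npoly K n) : M (Rset I f) = Rset I (M f).
Proof.
rewrite /Rset; case: (enum I) => [|i s] //.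
elim: s i => [|j s IH] i //=.
by rewrite map_mpoly_Rop IH.
Qed.

Lemma map_mpoly_int (z : int) (f : Npoly K n) : M (z%:~R * f) = z%:~R * M f.
Proof. by rewrite !mulrzl raddfMz. Qed.

Lemma map_mpoly_chain_sum w k m (f : Npoly K n) :
  M (chain_sum w k m f) = chain_sum w k m (M f).
Proof.
rewrite /chain_sum raddf_sum; apply: eq_bigr => I _.
by rewrite [LHS]map_mpoly_int map_mpoly_Rset.
Qed.

End CoefficientMaps.

Section Identities.
Variables (C : numFieldType) (n : nat) (r : 'I_n.+1 -> int) (q : {ffun 'I_n -> int}).
Hypothesis q_int : interlaces r q.
Variables (K : idomainType) (y : 'M[K]_n.+1) (xi : {additive K -> C}).

Local Notation ea := (expA r q).
Local Notation eb := (expB r q).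
Local Notation Yc := (map_mx (@mpolyC (nvars n) K) y : 'M[Npoly K n]_n.+1).
Local Notation z := (zrow Yc).
Local Notation u := (urow (generic K n)).
Local Notation L := (kern Yc (generic K n)).
Local Notation M := (map_mpoly xi : Npoly K n -> Npoly C n).

Hypothesis Phi_neq0 : forall i, (i < n)%N -> Phid z u i != 0.
Hypothesis Psi_neq0 : forall i, (i < n)%N -> Psid z u elast i != 0.

Lemma sum_sets_chain (k m : nat) (w : nat -> int) (v : 'I_n -> int) (G : Npoly C n) :
  (forall l : 'I_n, v l = w l) ->
  \sum_(I : {set 'I_n} | spans k m I)
     (\prod_(l in segment n k m :\: I) (v l)%:~R) *: Rset I G = chain_sum w k m G.
Proof.
move=> vw; apply: eq_bigr => I _.
rewrite (eq_bigr (fun l : 'I_n => (w l)%:~R)) => [|l _]; last by rewrite vw.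
by rewrite -rmorph_prod scaler_int mulrzl.
Qed.

Variable F : qfamily C n.

Lemma lower_identity :
  (forall m : 'I_n, (0 < ea m)%N ->
     Tminus m F q = M (L (decr ea m) (incr eb m))) ->
  \sum_(m < n) Acoef C r q m *:
    \sum_(I : {set 'I_n} | spans 0 m I)
      (\prod_(l in segment n 0 m :\: I)
          (q m - q l + l%:Z - m%:Z)%:~R) *: Rset I (Tminus m F q) =
  \sum_(0 <= i < n) (ea i)%:R * M (L (decr ea i) eb * Dd z u elast i 0).
Proof.
move=> FE.
pose G i := M (L (decr ea i) eb * Dd z u elast i 0).
pose co (m i : nat) := gap (ycoord q) m 0 i * lower_coef m ea (clower r q m) i.
transitivity (\sum_(m < n) \sum_(i < n | (i <= m)%N)
    (Acoef C r q m * (co m i)%:~R) *: G i).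
  apply: eq_bigr => m _.
  have [e0|e0] := posnP (ea m).
    by rewrite Acoef_eq0 // scale0r big1 // => i _; rewrite mul0r scale0r.
  rewrite (@sum_sets_chain 0 m (fun l => ycoord q m - ycoord q l)) => [|l]; last first.
    by rewrite /ycoord !qnatE; ring.
  rewrite FE // -map_mpoly_chain_sum.
  rewrite (chain_sum_kern_lower Phi_neq0 (@ycoordE _ _ _ q_int)
     (c := clower r q m)) //; last first.
    by move=> k km; rewrite clowerE // (ltn_trans km).
  rewrite (big_nat_widen _ _ n) // big_mkord [X in _ *: X](raddf_sum (map_mpoly xi)) scaler_sumr.
  by apply: eq_bigr => i im; rewrite -[X in _ *: X]/(M _) map_mpoly_int mulrzl -scaler_int scalerA.
rewrite (exchange_big_dep xpredT) //= big_mkord; apply: eq_bigr => i _.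
rewrite -scaler_suml sum_Acoef // -/(G i) mulr_natl scaler_nat //.
Qed.

Lemma upper_identity : (0 < n)%N ->
  (forall m : 'I_n, (0 < eb m)%N ->
     Tplus m F q = M (L (incr ea m) (decr eb m))) ->
  \sum_(m < n) Bcoef C r q m *:
      \sum_(I : {set 'I_n} | spans m n.-1 I)
        (\prod_(l in segment n m n.-1 :\: I)
            (q m - q l - m%:Z + l%:Z + 1)%:~R) *: Rset I (Tplus m F q) =
  - \sum_(0 <= i < n) (eb i)%:R * M (L ea (decr eb i) * Phis z u i i (u n.-1)).
Proof.
move=> n0 FE.
pose G i := M (L ea (decr eb i) * Phis z u i i (u n.-1)).
pose co (m i : nat) := gap (ycoord q) m i.+1 n * upper_coef m eb (cupper r q m) i.
transitivity (\sum_(m < n) \sum_(i < n | (m <= i)%N)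
    (Bcoef C r q m * (co m i)%:~R) *: G i).
  apply: eq_bigr => m _.
  have [e0|e0] := posnP (eb m).
    by rewrite Bcoef_eq0 // scale0r big1 // => i _; rewrite mul0r scale0r.
  rewrite (@sum_sets_chain m n.-1 (fun l => ycoord q m - ycoord q l + 1)) => [|l]; last first.
    by rewrite /ycoord !qnatE; ring.
  rewrite FE // -map_mpoly_chain_sum.
  rewrite (chain_sum_kern_upper Psi_neq0 (@ycoordE _ _ _ q_int)
     (c := cupper r q m)) //; last first.
    by move=> k km; rewrite cupperE //; lia.
  rewrite big_geq_mkord [X in _ *: X](raddf_sum (map_mpoly xi)) scaler_sumr.
  by apply: eq_bigr => i im; rewrite -[X in _ *: X]/(M _) map_mpoly_int mulrzl -scaler_int scalerA.
rewrite (exchange_big_dep xpredT) //= big_mkord -sumrN; apply: eq_bigr => i _.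
by rewrite -scaler_suml sum_Bcoef // -/(G i) mulr_natl scaleNr scaler_nat.
Qed.

End Identities.

Section Fischer.
Variables (C : numClosedFieldType) (k : nat).
Implicit Types P Q : {mpoly C[k]}.

Definition mfact (m : 'X_{1..k}) : nat := (\prod_(i < k) (m i)`!)%N.

Definition fischer Q P : C := \sum_(m <- msupp P) (mfact m)%:R * P@_m * (Q@_m)^*.

Lemma fischerE (s : seq 'X_{1..k}) Q P : uniq s -> {subset msupp P <= s} ->
  fischer Q P = \sum_(m <- s) (mfact m)%:R * P@_m * (Q@_m)^*.
Proof.
move=> us sub; rewrite [RHS](bigID (mem (msupp P))) /= [X in _ + X]big1 ?addr0; last first.
  by move=> m; rewrite -mcoeff_eq0 => /eqP ->; rewrite mulr0 mul0r.
rewrite -big_filter; apply: perm_big; apply: uniq_perm; rewrite ?msupp_uniq ?filter_uniq //.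
move=> m; rewrite mem_filter; case: (boolP (m \in msupp P)) => mP /=; last by [].
by rewrite mcoeff_msupp in mP *; rewrite sub // mcoeff_msupp.
Qed.

Lemma fischer_is_linear Q : linear (fischer Q : _ -> C^o).
Proof.
move=> c P P'; pose s := undup (msupp P ++ msupp P').
have us : uniq s by rewrite undup_uniq.
have sP : {subset msupp P <= s} by move=> m mP; rewrite mem_undup mem_cat mP.
have sP' : {subset msupp P' <= s} by move=> m mP; rewrite mem_undup mem_cat mP orbT.
have sPP' : {subset msupp (c *: P + P') <= s}.
  by move=> m /msuppD_le; rewrite mem_cat => /orP[/msuppZ_le /sP|/sP'].
rewrite (fischerE Q us sP) (fischerE Q us sP') (fischerE Q us sPP').
rewrite scaler_sumr -big_split /=; apply: eq_bigr => m _.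
by rewrite mcoeffD mcoeffZ /GRing.scale /=; ring.
Qed.

HB.instance Definition _ Q :=
  GRing.isLinear.Build C {mpoly C[k]} C^o _ (fischer Q) (fischer_is_linear Q).

Lemma fischer_sym P Q : fischer P Q = (fischer Q P)^*.
Proof.
pose s := undup (msupp P ++ msupp Q).
have us : uniq s by rewrite undup_uniq.
have sP : {subset msupp P <= s} by move=> m mP; rewrite mem_undup mem_cat mP.
have sQ : {subset msupp Q <= s} by move=> m mP; rewrite mem_undup mem_cat mP orbT.
rewrite (fischerE P us sQ) (fischerE Q us sP).
rewrite rmorph_sum; apply: eq_bigr => m _ /=.
by rewrite !rmorphM /= conjCK rmorph_nat mulrAC.
Qed.

Lemma mfact_gt0 m : 0 < (mfact m)%:R :> C.
Proof. by rewrite ltr0n prodn_gt0 // => i; rewrite fact_gt0. Qed.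

Lemma fischer_pos P : fischer P P = 0 -> P = 0.
Proof.
move/eqP; rewrite psumr_eq0 => [|m _]; last first.
  by rewrite -mulrA -normCK mulr_ge0 ?exprn_ge0 // ltW ?mfact_gt0.
move/allP => z; apply/mpolyP => m; rewrite mcoeff0.
case: (boolP (m \in msupp P)) => [mP|/memN_msupp_eq0 //].
have := z m mP; rewrite /= -mulrA -normCK mulf_eq0 (gt_eqF (mfact_gt0 m)) /= expf_eq0 /=.
by rewrite normr_eq0 => /eqP.
Qed.

Lemma fischer_mulX a P Q : fischer Q ('X_a * P) = fischer Q^`M(a) P.
Proof.
pose s := [seq (U_(a) + m)%MM | m <- msupp P].
have us : uniq s by rewrite map_inj_uniq ?msupp_uniq // => m m'; apply: addmI.
rewrite (@fischerE s) //; last first.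
  move=> m /msuppM_le /allpairsP [[m1 m2] /= [m1X m2P ->]].
  by move: m1X; rewrite msuppX inE => /eqP ->; rewrite map_f.
rewrite big_map; apply: eq_bigr => m _.
rewrite [_ * P]mulrC mcoeffMX addmC mcoeff_deriv rmorphMn /= -mulr_natr.
suff -> : (mfact (m + U_(a))%MM)%:R = (mfact m)%:R * (m a).+1%:R :> C by ring.
rewrite -natrM; congr _%:R; rewrite /mfact (bigD1 a) //= [in RHS](bigD1 a) //=.
rewrite mnmDE mnm1E eqxx addn1 factS -mulnA [in RHS]mulnC; congr (_ * (_ * _))%N.
apply: eq_bigr => i ia; rewrite mnmDE mnm1E eq_sym (negPf ia) addn0 //.
Qed.

End Fischer.

Lemma coef1_leibniz (A : comNzRingType) (f : {rmorphism A -> {poly A}}) :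
  (forall x, (f x)`_0 = x) ->
  forall x y, (f (x * y))`_1 = (f x)`_1 * y + x * (f y)`_1.
Proof.
by move=> f0 x y; rewrite rmorphM coefM big_ord_recl big_ord1 /= !f0 addrC.
Qed.

Lemma mxvec_index_eq m n (i i' : 'I_m) (j j' : 'I_n) :
  (mxvec_index i j == mxvec_index i' j') = (i == i') && (j == j').
Proof. by rewrite (inj_eq (@cast_ord_inj _ _ _)) (inj_eq enum_rank_inj) xpair_eqE. Qed.

Section EdirDerivation.
Variables (C : comNzRingType) (N : nat) (k l : 'I_N).

Lemma Edir_mderiv (P : Mpoly C N) :
  Edir k l P = \sum_i genmx C N i k * P^`M(mxvec_index i l).
Proof.
apply/eqP; rewrite -subr_eq0; apply/eqP.
pose d P := Edir k l P - \sum_i genmx C N i k * mderiv (mxvec_index i l) P.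
rewrite -/(d P); apply: (mpoly_derivation_eq0 (phi := idfun)) => {P}.
- move=> P Q; rewrite /d raddfB /=.
  have -> : \sum_i genmx C N i k * (P - Q)^`M(mxvec_index i l) =
    \sum_i genmx C N i k * P^`M(mxvec_index i l) - \sum_i genmx C N i k * Q^`M(mxvec_index i l).
    by rewrite -sumrB; apply: eq_bigr => i _; rewrite mderivB mulrBr.
  by rewrite !opprB addrACA [in RHS]addrACA [- _ + - _ in LHS]addrC.
- move=> f g; rewrite /d.
  have -> : Edir k l (f * g) = Edir k l f * g + f * Edir k l g.
    exact: (@coef1_leibniz _ (shiftp k l) (shiftp0 k l)).
  have -> : \sum_i genmx C N i k * (f * g)^`M(mxvec_index i l) =
    (\sum_i genmx C N i k * f^`M(mxvec_index i l)) * g +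
    f * (\sum_i genmx C N i k * g^`M(mxvec_index i l)).
    rewrite mulr_suml mulr_sumr -big_split; apply: eq_bigr => i _ /=.
    by rewrite mderivM mulrDr !mulrA [f * _]mulrC.
  by rewrite [in RHS]mulrBl [in RHS]mulrBr opprD addrACA.
- move=> c; rewrite /d big1 => [|i _]; last by rewrite mderivC mulr0.
  rewrite /Edir /shiftp mx_evalC /= coefC /=.
  by rewrite subr0.
move=> v; case/mxvec_indexP: v => i j; rewrite /d.
have -> : 'X_(mxvec_index i j) = genmx C N i j by rewrite mxE.
have /matrixP/(_ i j) := mx_eval_gen (polyC \o @mpolyC (N * N) C)
  (map_mx polyC (genmx C N) *m elem k l 'X).
rewrite mxE -/(shiftp k l _) /Edir => ->.
have -> : (map_mx polyC (genmx C N) *m elem k l 'X) i j =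
    (genmx C N i j)%:P + (genmx C N i k *+ (l == j))%:P * 'X.
  rewrite /elem mulmxDr mulmx1 -scalemxAr !mxE; congr (_ + _).
  rewrite (bigD1 k) //= big1 ?addr0 => [|c ck]; last by rewrite !mxE (negPf ck) mulr0.
  by rewrite !mxE eqxx /= eq_sym polyCMn mulr_natr mulrC.
rewrite coefD coefC coefMX /= coefC /= add0r.
have dX c : (genmx C N i j)^`M(mxvec_index c l) = ((i == c) && (j == l))%:R.
  rewrite mxE mderivX mnm1E mxvec_index_eq.
  case: andP => [[/eqP -> /eqP ->]|_]; last by rewrite scale0r.
  by rewrite (_ : (_ - _)%MM = 0%MM) ?mpolyX0 ?scale1r //; apply/mnmP => v; rewrite mnmBE subnn mnm0E.
rewrite (bigD1 i) //= big1 ?addr0 => [|c ci]; last first.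
  by rewrite dX eq_sym (negPf ci) mulr0.
rewrite dX eqxx /= eq_sym; apply/eqP; rewrite subr_eq0; apply/eqP.
by case: eqP => _; rewrite ?mulr1 ?mulr0 ?mulr1n ?mulr0n.
Qed.

End EdirDerivation.

Lemma fischer_Edir (C : numClosedFieldType) N k l (P Q : Mpoly C N) :
  fischer Q (Edir k l P) = fischer (Edir l k Q) P.
Proof.
have gX (i c : 'I_N) : genmx C N i c = 'X_(mxvec_index i c) by rewrite mxE.
rewrite (fischer_sym (Edir l k Q)) !Edir_mderiv (raddf_sum (fischer Q)) (raddf_sum (fischer P)) rmorph_sum /=.
apply: eq_bigr => i _; rewrite !gX !fischer_mulX -fischer_sym //.
Qed.

Section Projection.
Variables (C : numClosedFieldType) (D : nat) (w : 'rV[C]_D).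
Hypothesis w_gt0 : forall i, 0 < w 0 i.
Variables (Y : Type) (v : Y -> 'rV[C]_D).

Local Notation "A ^*m" := (map_mx Num.conj A^T) (at level 8).

Let rows (s : seq Y) : 'M[C]_(size s, D) := \matrix_(a < size s) v (tnth (in_tuple s) a).

Lemma spanning_rows : exists s, forall y, (v y <= rows s)%MS.
Proof.
suff H d s : (D - \rank (rows s) <= d)%N -> exists s, forall y, (v y <= rows s)%MS.
  exact: (H _ [::] (leqnn _)).
elim: d s => [|d IH] s rs.
  exists s => y; apply: submx_full; rewrite /row_full eqn_leq rank_leq_col.
  by rewrite -subn_eq0 -leqn0.
have [[y ny]|all_y] := pselect (exists y, ~ (v y <= rows s)%MS); last first.
  by exists s => y; apply: contrapT => ny; apply: all_y; exists y.
apply: (IH (y :: s)).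
have /rank_ltmx : (rows s < rows (y :: s))%MS.
  apply/andP; split.
    apply/row_subP => a; rewrite rowK.
    have -> : v (tnth (in_tuple s) a) = row (lift ord0 a) (rows (y :: s)).
      by rewrite rowK; congr v; rewrite !(tnth_nth y).
    exact: row_sub.
  apply/negP => le; apply: ny; apply: submx_trans le.
  have -> : v y = row ord0 (rows (y :: s)) by rewrite rowK.
  exact: row_sub.
by move: rs; case: (\rank _) => [|k]; case: (\rank _) => [|k'] // rs kk; lia.
Qed.

Lemma hermitian_kernel k (A : 'M[C]_(k, D)) l (K : 'M[C]_(k, l)) :
  A *m diag_mx w *m A^*m *m K = 0 -> A^*m *m K = 0.
Proof.
move=> AK; apply/matrixP => i j; rewrite [RHS]mxE.
have /matrixP/(_ j j) : K^*m *m (A *m diag_mx w *m A^*m *m K) = 0 by rewrite AK mulmx0.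
set B := A^*m *m K.
have BE : K^*m *m A = B^*m.
  rewrite /B trmx_mul map_mxM; congr (_ *m _); apply/matrixP => a b.
  by rewrite !mxE; apply: esym; apply: conjCK.
rewrite -!mulmxA -/B [X in _ = X -> _]mxE 2!mulmxA BE mxE => /eqP.
rewrite psumr_eq0 => [/allP/(_ i)|c _].
  rewrite mem_index_enum mul_mx_diag !mxE mulrAC mulf_eq0 (gt_eqF (w_gt0 i)) orbF.
  by rewrite mulrC -normCK expf_eq0 normr_eq0 => /(_ isT) /eqP.
rewrite mul_mx_diag !mxE mulrAC [_^* * _]mulrC -normCK mulr_ge0 ?exprn_ge0 //.
exact: ltW.
Qed.

Lemma ortho_proj (F : 'rV[C]_D) : exists s : seq (C * Y), forall y,
  \sum_i w 0 i * (F - \sum_(cy <- s) cy.1 *: v cy.2) 0 i * (v y 0 i)^* = 0.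
Proof.
have [s sP] := spanning_rows.
pose A := rows s; pose M := A *m diag_mx w *m A^*m.
have : (F *m diag_mx w *m A^*m <= M)%MS.
  have K0 : A^*m *m cokermx M = 0 by apply: hermitian_kernel; apply: mulmx_coker.
  by rewrite submxE -(mulmxA (F *m diag_mx w)) K0 mulmx0.
case/submxP => c cE.
exists [seq (c 0 a, tnth (in_tuple s) a) | a <- enum 'I_(size s)] => y.
rewrite big_map big_enum /=.
have -> : \sum_a c 0 a *: v (tnth (in_tuple s) a) = c *m A.
  by rewrite mulmx_sum_row; apply: eq_bigr => a _; rewrite rowK.
have [d dE] := submxP (sP y).
have : (F - c *m A) *m diag_mx w *m (v y)^*m = 0.
  rewrite dE trmx_mul map_mxM mulmxA 2!mulmxBl cE /M !mulmxA.
  by rewrite subrr mul0mx.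
move/matrixP/(_ 0 0); rewrite [RHS]mxE [LHS]mxE => E; rewrite -[RHS]E.
by apply: eq_bigr => i _; rewrite mul_mx_diag !mxE mulrC [w _ _ * _]mulrC mulrC.
Qed.

End Projection.

Section Lift.
Variables (C : numFieldType) (N : nat) (p : 'I_N -> int).

Lemma Wequiv_lift (f : Npoly C N) : in_Vsp p f -> exists d, forall s, (d <= s)%N ->
  exists P, Wequiv p (- s%:Z) P /\ restr P = f.
Proof.
case=> phi [[Pp phiE] phiB fphi]; exists (size Pp) => s ds.
pose P : Mpoly C N := \sum_(i < size Pp) Pp`_i * \det (genmx C N) ^+ (s - i).
have PE g : g \in unitmx -> mx_eval idfun g P = \det g ^+ s * phi g.
  move=> gG; have dg : \det g != 0 by rewrite -unitfE -unitmxE.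
  rewrite phiE // (@horner_coef_wide _ (size Pp)) ?size_poly // mulr_sumr.
  rewrite [LHS](raddf_sum (mx_eval idfun g)); apply: eq_bigr => i _.
  rewrite /= coef_map_id0 ?rmorph0 // rmorphM rmorphXn /= -det_map_mx mx_eval_gen.
  rewrite exprVn [in RHS]mulrCA; congr (_ * _).
  have is_ : (i <= s)%N by apply: leq_trans ds; apply: ltnW.
  by rewrite -[in RHS](subnK is_) exprD mulfK // expf_neq0.
exists P; split.
  move=> b g bB gG; have bG : b \in unitmx by case/andP: bB.
  rewrite !PE ?unitmx_mul ?bG // phiB // det_mulmx exprMn.
  have db : \det b != 0 by rewrite -unitfE -unitmxE.
  have := prod_exprzDr p (- s%:Z) bB; rewrite -exprnN => <-.
  rewrite -!mulrA [\det g ^+ s * (_ * _) in LHS]mulrCA [LHS]mulrCA; congr (_ * _).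
  by rewrite [LHS]mulrCA; congr (_ * _); rewrite mulVKf ?expf_neq0.
apply: Npoly_ext => Z ZN; rewrite eval_at_restr // PE ?unitri_unitmx //.
by rewrite det_unitri // expr1n mul1r fphi.
Qed.

End Lift.

Section ShiftU.
Variables (B : comNzRingType) (n : nat) (Y : 'M[B]_n.+1) (X : 'M[B]_n).
Variables (k l : 'I_n) (s : B).

Lemma urow_elem j :
  urow (X *m elem k l s) j = urow X j *m elem (lift ord_max k) (lift ord_max l) s.
Proof.
rewrite row_elem; have [jn|jn] := ltnP j n; last first.
  by rewrite /urow insubF ?ltnNge ?jn // mxE mulr0 scale0r addr0.
apply/rowP => c; rewrite !mxE; case: (unliftP ord_max c) => [c' ->|->]; last first.
  by rewrite !urow_max (negPf (neq_lift _ _)) andbF mulr0 addr0.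
rewrite !urow_lift /elem mulmxDr mulmx1 -scalemxAr !mxE (inj_eq lift_inj) -mulrA.
congr (_ + _ * _); rewrite (bigD1 k) //= big1 ?addr0 => [|i ik].
  by rewrite !mxE eqxx.
by rewrite !mxE (negPf ik) mulr0.
Qed.

Lemma kern_shift_u ea eb : k != l ->
  kern Y (X *m elem k l s) ea eb =
  kern (Y *m elem (lift ord_max k) (lift ord_max l) (- s)) X ea eb.
Proof.
move=> kl; have kl' : lift ord_max k != lift ord_max l by rewrite (inj_eq lift_inj).
rewrite /kern /Lmon; congr (_ * _); apply: eq_bigr => i _; congr (_ ^+ _).
  rewrite /Phid blockdet_shift // opprK; apply: eq_blockdet => j _.
  exact: urow_elem.
rewrite /Psid /Dd blockdet_shift // opprK; apply: eq_blockdet => j _.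
rewrite /upd; case: eqP => _; last exact: urow_elem.
by rewrite row_elem mxE eq_sym (negPf (neq_lift _ _)) andbF mulr0 scale0r addr0.
Qed.

End ShiftU.

Section LeadingLinear.
Variables (A : nzRingType) (n : nat).

Lemma leU (i j : 'I_n) : (i <= j)%N -> (U_(j)%MM <= U_(i)%MM :> 'X_{1..n})%O.
Proof.
rewrite leq_eqVlt => /orP[/eqP/val_inj -> //|ij]; apply/ltW/ltmcP; rewrite ?mdeg1 //.
exists i => [c ci|]; rewrite !mnm1E; last by rewrite eqxx -val_eqE gtn_eqF.
by rewrite -!val_eqE gtn_eqF ?(ltn_trans ci) // gtn_eqF.
Qed.

Lemma mlead_linear (S : finType) (Q : pred S) (f : S -> 'I_n) (c : S -> A) s0 :
  {in Q &, injective f} -> Q s0 -> (forall s, Q s -> f s0 <= f s)%N -> c s0 != 0 ->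
  let P := \sum_(s | Q s) c s *: 'X_(f s) in
  mlead P = U_(f s0)%MM /\ mleadc P = c s0.
Proof.
move=> f_inj Qs0 f_le cs0 P.
have P0 : P@_(U_(f s0)) = c s0.
  rewrite /P raddf_sum (bigD1 s0) //= big1 => [|s /andP[Qs ss0]]; last first.
    rewrite mcoeffZ mcoeffXU; case: eqP => [E|_]; last by rewrite mulr0.
    by rewrite (f_inj _ _ Qs Qs0 E) eqxx in ss0.
  by rewrite mcoeffZ mcoeffXU eqxx mulr1 addr0.
suff lP : mlead P = U_(f s0)%MM by rewrite lP.
apply/eqP; rewrite eq_le; apply/andP; split; last first.
  by apply: msupp_le_mlead; rewrite mcoeff_msupp P0.
have : mlead P \in msupp P.
  by apply: mlead_supp; apply: contraNneq cs0 => Pz; rewrite -P0 Pz mcoeff0.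
rewrite mcoeff_msupp /P raddf_sum; move: (mlead _) => m.
apply: contraR => mU; apply/eqP/big1 => s Qs; rewrite /= mcoeffZ mcoeffX.
case: eqP => [E|_]; last by rewrite mulr0.
by rewrite -E leU ?f_le in mU.
Qed.

End LeadingLinear.

Section Mu.
Variable n : nat.

(** The minor of X on the first a rows and columns, completed by a permutation
    matrix. *)
Definition mu (K : comNzRingType) (X : 'M[K]_n) (a : nat) : K :=
  \det (\matrix_(s < n, c < n)
    if (s < n - a)%N then (s + c.+1 == n)%N%:R
    else if insub (s - (n - a))%N is Some i then X i c else 0).

Lemma map_mu (K K' : comNzRingType) (f : {rmorphism K -> K'}) (X : 'M[K]_n) a :
  f (mu X a) = mu (map_mx f X) a.
Proof.
rewrite /mu -det_map_mx; congr (\det _); apply/matrixP => s c; rewrite !mxE.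
by case: ifP => _; rewrite ?rmorph_nat //; case: insub => [i|]; rewrite ?mxE ?rmorph0.
Qed.

Lemma mu_unitri (K : comNzRingType) (X : 'M[K]_n) a : (a <= n)%N -> unitri X ->
  exists b : bool, mu X a = (-1) ^+ b.
Proof.
move=> an /andP[/is_trig_mxP tX /forallP X1].
pose sg (s : 'I_n) : nat := if (s < n - a)%N then (n - s.+1)%N else (s - (n - a))%N.
have sgn s : (sg s < n)%N by rewrite /sg; have := ltn_ord s; case: ifP; lia.
have sg_inj : injective (fun s => Ordinal (sgn s)).
  move=> s s' /(congr1 val) /=; rewrite /sg => E; apply: val_inj => /=.
  by have := ltn_ord s; have := ltn_ord s'; move: E; do 2 case: ifP; lia.
pose T : 'M[K]_n := \matrix_(p, c) if (p < a)%N then X p c else (p == c)%:R.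
exists (perm sg_inj).
have detT : \det T = 1.
  rewrite -det_tr det_trig; first rewrite big1 // => i _.
    by rewrite !mxE eqxx (eqP (X1 i)); case: ifP.
  apply/is_trig_mxP => i j ij; rewrite !mxE.
  by have := tX _ _ ij; rewrite mxE => ->; rewrite -val_eqE gtn_eqF // if_same.
rewrite -[RHS]mulr1 -[X in _ = _ * X]detT -det_perm -det_mulmx -row_permE; congr (\det _).
apply/matrixP => s c; rewrite !mxE permE /=.
case: ifP => sna.
  have -> : (sg s < a)%N = false by rewrite /sg sna; apply/negbTE; lia.
  by congr (_%:R); rewrite -val_eqE /= /sg sna; have := ltn_ord s; lia.
have sa : (sg s < a)%N by rewrite /sg sna; have := ltn_ord s; lia.
have sn : (s - (n - a) < n)%N by have := ltn_ord s; lia.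
by rewrite sa insubT; congr (X _ _); apply: val_inj; rewrite /= /sg sna.
Qed.

End Mu.

Section AntiDiagonal.
Variable n : nat.

Definition antiY (K : comNzRingType) : 'M[{mpoly K[n]}]_n.+1 :=
  \matrix_(l, c) if unlift ord_max c is Some c' then (l + c'.+1 == n)%N%:R
    else if insub (n - l.+1)%N is Some j then 'X_j else 0.

Variables (A : idomainType) (X : 'M[A]_n).
Local Notation P := {mpoly A[n]}.
Local Notation XX := (map_mx (@mpolyC n A) X).
Local Notation u := (urow XX).
Local Notation z := (zrow (antiY A)).
Hypothesis mu_neq0 : forall a, (a <= n)%N -> mu X a != 0.

Lemma Psid_anti i : (i < n)%N -> Psid z u elast i = (mu X i)%:MP.
Proof.
move=> lt_in; rewrite (Psid_expand _ _ lt_in) (map_mu (@mpolyC n A)); congr (\det _).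
apply/matrixP => s t; rewrite !mxE; case: ifP => si.
  by rewrite (zrowE _ (ltnW (ltn_ord s))) !mxE liftK.
have sn : (s - (n - i) < n)%N by have := ltn_ord s; lia.
by rewrite (urow_lift _ sn) insubT.
Qed.

Lemma Phid_anti_lead i (lt_in : (i < n)%N) :
  mlead (Phid z u i) = U_(Ordinal lt_in)%MM /\
  exists b : nat, mleadc (Phid z u i) = (-1) ^+ b * mu X i.+1.
Proof.
pose M0 : 'M[A]_n.+1 := \matrix_(s, c)
  if unlift ord_max c is Some c' then
    (if (s < n - i)%N then (s + c'.+1 == n)%N%:R
     else if insub (s - (n - i))%N is Some j then X j c' else 0) else 0.
have rev_lt (s : 'I_n.+1) : (n.-1 - s < n)%N by lia.
pose f (s : 'I_n.+1) := Ordinal (rev_lt s).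
pose c s := cofactor M0 s ord_max.
have PhiE : Phid z u i = \sum_(s : 'I_n.+1 | (s < n - i)%N) c s *: 'X_(f s).
  rewrite /Phid /blockdet (expand_det_col _ ord_max) [RHS]big_mkcond /=.
  apply: eq_bigr => s _; rewrite {1}/block_rows !mxE; case: ifP => si; last first.
    by rewrite urow_max mul0r.
  rewrite (zrowE _ (ltn_ord s)) !mxE unlift_none insubT; first by have := ltn_ord s; lia.
  move=> h; rewrite mulrC -mul_mpolyC; congr (_ * 'X_ _); last by apply: val_inj => /=; lia.
  rewrite /c /cofactor rmorphM rmorph_sign /= -det_map_mx; congr (_ * \det _).
  apply/matrixP => a d; rewrite !mxE liftK; case: ifP => ai.
    by rewrite (zrowE _ (ltn_ord _)) !mxE liftK rmorph_nat.
  have an : (lift s a - (n - i) < n)%N by have := ltn_ord (lift s a); lia.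
  by rewrite (urow_lift _ an) insubT mxE.
have s0n : (n.-1 - i < n.+1)%N by lia.
pose s0 := Ordinal s0n.
have c0 : c s0 = (-1) ^+ (s0 + n) * mu X i.+1.
  rewrite /c /cofactor /mu; congr (_ * \det _); apply/matrixP => s d; rewrite !mxE liftK.
  rewrite /= /bump /=; case: (leqP (n.-1 - i) s) => hs /=.
    have -> : (1 + s < n - i)%N = false by lia.
    have -> : (s < n - i.+1)%N = false by lia.
    by have -> : (1 + s - (n - i) = s - (n - i.+1))%N by lia.
  have -> : (0 + s < n - i)%N by lia.
  by have -> : (s < n - i.+1)%N by lia.
have := @mlead_linear A n [the finType of 'I_n.+1] (fun s => (s < n - i)%N) f c s0.
case.
- move=> s s'; rewrite -!topredE /= => si si' /(congr1 val) /= E; apply: val_inj => /=; lia.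
- by rewrite /=; lia.
- by move=> s si /=; lia.
- by rewrite c0 mulf_neq0 ?signr_eq0 ?mu_neq0.
rewrite PhiE => -> ->; split; last by exists (s0 + n)%N.
by congr (U_(_))%MM; apply: val_inj => /=; lia.
Qed.

Definition minors_monomial (K : comNzRingType) (x : 'M[K]_n) (ea eb : nat -> nat) : K :=
  (\prod_(i < n) mu x i.+1 ^+ ea i) * (\prod_(i < n) mu x i ^+ eb i).

Lemma kern_anti_lead ea eb :
  mlead (kern (antiY A) XX ea eb) = [multinom ea i | i < n] /\
  exists b : nat, mleadc (kern (antiY A) XX ea eb) = (-1) ^+ b * minors_monomial X ea eb.
Proof.
have Phi0 (i : 'I_n) : Phid z u i != 0.
  have [_ [b bE]] := Phid_anti_lead (ltn_ord i).
  by rewrite -mleadc_eq0 bE mulf_neq0 ?signr_eq0 ?mu_neq0.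
have Psi0 (i : 'I_n) : Psid z u elast i != 0.
  by rewrite Psid_anti // mpolyC_eq0 mu_neq0 // ltnW.
have PhiL (i : 'I_n) : mlead (Phid z u i ^+ ea i) = (U_(i) *+ ea i)%MM.
  have [E _] := Phid_anti_lead (ltn_ord i).
  by rewrite mleadX // E; congr (U_(_) *+ _)%MM; apply: val_inj.
have pPhi : \prod_(i < n) Phid z u i ^+ ea i != 0.
  by apply/prodf_neq0 => i _; rewrite expf_neq0.
have pPsi : \prod_(i < n) Psid z u elast i ^+ eb i != 0.
  by apply/prodf_neq0 => i _; rewrite expf_neq0.
have lPhi : mlead (\prod_(i < n) Phid z u i ^+ ea i) = [multinom ea i | i < n].
  rewrite mlead_prod => [|i _ _]; last by rewrite expf_neq0.
  apply/mnmP => j; rewrite mnm_sumE mnmE (bigD1 j) //= big1 ?addn0 => [|i ij].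
    by rewrite PhiL mulmnE mnm1E eqxx mul1n.
  by rewrite PhiL mulmnE mnm1E (negPf ij).
have PsiC : \prod_(i < n) Psid z u elast i ^+ eb i = (\prod_(i < n) mu X i ^+ eb i)%:MP.
  by rewrite rmorph_prod; apply: eq_bigr => i _; rewrite Psid_anti // rmorphXn.
rewrite /kern /Lmon PsiC; rewrite PsiC in pPsi; split.
  by rewrite mleadM // lPhi mleadC addm0.
have [b bE] : exists b : nat, mleadc (\prod_(i < n) Phid z u i ^+ ea i) =
    (-1) ^+ b * \prod_(i < n) mu X i.+1 ^+ ea i.
  rewrite mleadc_prod_proper => [|i _ _]; last by apply/lregP; rewrite mleadc_eq0 expf_neq0.
  have sgn (i : 'I_n) : exists b : nat, mleadc (Phid z u i) == (-1) ^+ b * mu X i.+1.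
    by have [_ [b bE]] := Phid_anti_lead (ltn_ord i); exists b; apply/eqP.
  exists (\sum_(i < n) xchoose (sgn i) * ea i)%N; rewrite -prodrXr -big_split /=.
  apply: eq_bigr => i _; rewrite mleadcX_proper; last by apply/lregP; rewrite mleadc_eq0.
  by rewrite exprM -exprMn; congr (_ ^+ _); apply/eqP/(xchooseP (sgn i)).
exists b; rewrite mleadM // mleadC addm0 mulrC mcoeffCM mulrC.
by rewrite bE mulrA.
Qed.

End AntiDiagonal.

Section Invariants.
Variables (C : numFieldType) (n : nat).
Implicit Types P : Mpoly C n.

Lemma partial_restr (i l : 'I_n) P : (i < l)%N ->
  partial i l (restr P) = restr (P^`M(mxvec_index i l)).
Proof.
move=> il; apply/eqP; rewrite -subr_eq0; apply/eqP.
pose d (Q : Mpoly C n) := partial i l (restr Q) - restr (mderiv (mxvec_index i l) Q).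
rewrite -/(d P); have pE (f : Npoly C n) : partial i l f = mderiv (enum_rank (Sub (i, l) il : upos n)) f.
  by rewrite /partial (uvar_index_lt il).
apply: (mpoly_derivation_eq0 (phi := @restr C n)) => {P}.
- move=> P Q; rewrite /d !pE mderivB !(raddfB (@restr C n)) mderivB.
  by rewrite !opprB addrACA [in RHS]addrACA [- _ + - _ in LHS]addrC.
- move=> f g; rewrite /d !pE (rmorphM (@restr C n)) !mderivM raddfD /= !(rmorphM (@restr C n)).
  by rewrite [in RHS]mulrBl [in RHS]mulrBr opprD addrACA.
- move=> c; have rC : restr (c%:MP : Mpoly C n) = c%:MP by apply: mx_evalC.
  by rewrite /d !pE rC !mderivC (rmorph0 (@restr C n)) subrr.
move=> v; case/mxvec_indexP: v => a b; rewrite /d.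
have -> : restr 'X_(mxvec_index a b) = generic C n a b.
  by rewrite /restr /mx_eval mmapX mmap1U mxvecE.
rewrite partial_generic il /= mderivX mnm1E mxvec_index_eq.
case: andP => [[/eqP -> /eqP ->]|]; last by rewrite scale0r (rmorph0 (@restr C n)) subrr.
rewrite (_ : (_ - _)%MM = 0%MM); last by apply/mnmP => w; rewrite mnmBE subnn mnm0E.
by rewrite mpolyX0 scale1r (rmorph1 (@restr C n)) subrr.
Qed.

Lemma restr_const P : (forall k l : 'I_n, (k < l)%N -> Edir k l P = 0) ->
  exists c, restr P = c%:MP.
Proof.
move=> E0.
have p0 (d : nat) (k l : 'I_n) : (k < d)%N -> (k < l)%N -> partial k l (restr P) = 0.
  elim: d k l => [|d IH] k l // kd kl.
  have := congr1 (@restr C n) (E0 k l kl).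
  rewrite (rmorph0 (@restr C n)) Edir_mderiv (raddf_sum (@restr C n)) /=.
  have gE i : restr (genmx C n i k) = generic C n i k.
    by have /matrixP/(_ i k) := mx_eval_gen (@mpolyC _ C) (generic C n); rewrite mxE.
  rewrite (bigD1 k) //= (rmorphM (@restr C n)) /= gE generic_diag mul1r -partial_restr // => <-.
  rewrite [X in _ + X]big1 ?addr0 // => i ik; rewrite (rmorphM (@restr C n)) /= gE.
  have [ki|ki] := ltnP i k.
    by rewrite -partial_restr ?(ltn_trans ki kl) // IH ?mulr0 ?(ltn_trans ki kl) //; lia.
  by rewrite mxE uvar_index_ge // (negPf ik) mul0r.
exists (restr P)@_0; apply/mpolyP => m; rewrite mcoeffC.
have [->|m0] := eqVneq m 0%MM; first by rewrite mulr1.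
rewrite mulr0; have /existsP[v mv] : [exists v, m v != 0%N].
  by apply: contraNT m0; rewrite negb_exists => /forallP m0; apply/eqP/mnmP => v;
    rewrite mnm0E; apply/eqP; have := m0 v; rewrite negbK.
pose kl := val (enum_val v : upos n); have kl_lt : (kl.1 < kl.2)%N := valP (enum_val v).
have := p0 kl.1.+1 kl.1 kl.2 (ltnSn _) kl_lt.
rewrite /partial (uvar_index_lt kl_lt).
have -> : enum_rank (Sub (kl.1, kl.2) kl_lt : upos n) = v.
  rewrite -[RHS]enum_valK; congr enum_rank; apply: val_inj.
  by rewrite SubK -surjective_pairing.
move/(congr1 (mcoeff (m - U_(v))%MM)); rewrite mcoeff0 mcoeff_deriv.
rewrite submK; last by rewrite lep1mP.
by move/eqP; rewrite mulrn_eq0 /= => /eqP.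
Qed.

Variable q : 'I_n -> int.

Lemma Wequiv_restr0 z P : Wequiv q z P -> restr P = 0 -> P = 0.
Proof.
move=> WP P0; apply: dense_BN => b Z bB ZN.
rewrite WP ?unitri_unitmx // -eval_at_restr // P0.
by rewrite /eval_at meval0 mulr0.
Qed.

End Invariants.

(** Weights of the monomials under right multiplication by diagonal matrices. *)
Section ColumnWeight.
Variables (C : comNzRingType) (N : nat).

Definition colweight (m : 'X_{1..N * N}) : nat := \sum_i \sum_(j < N) m (mxvec_index i j) * j.

Lemma colweightD m m' : colweight (m + m')%MM = (colweight m + colweight m')%N.
Proof.
rewrite -big_split; apply: eq_bigr => i _; rewrite -big_split; apply: eq_bigr => j _ /=.
by rewrite mnmDE mulnDl.
Qed.

Lemma colweightU i j : colweight U_(mxvec_index i j) = j.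
Proof.
rewrite /colweight (bigD1 i) //= [X in (_ + X)%N]big1 ?addn0 => [|i' ii'].
  rewrite (bigD1 j) //= [X in (_ + X)%N]big1 ?addn0 => [|j' jj'].
    by rewrite mnm1E eqxx mul1n.
  by rewrite mnm1E mxvec_index_eq [j == _]eq_sym (negPf jj') andbF.
by apply: big1 => j' _; rewrite mnm1E mxvec_index_eq [i == _]eq_sym (negPf ii').
Qed.

Lemma Edir_weight (k l : 'I_N) d (P : Mpoly C N) : (k < l)%N ->
  (forall m, P@_m != 0 -> (colweight m < d.+1)%N) ->
  forall m, (Edir k l P)@_m != 0 -> (colweight m < d)%N.
Proof.
move=> kl wP m; rewrite Edir_mderiv raddf_sum => /eqP nz.
have [i iP] : exists i, (genmx C N i k * P^`M(mxvec_index i l))@_m != 0.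
  apply/existsP; apply: contraT; rewrite negb_exists => /forallP z; case: nz.
  by apply: big1 => i _; apply/eqP; have := z i; rewrite negbK.
have : m \in msupp (genmx C N i k * P^`M(mxvec_index i l)) by rewrite mcoeff_msupp.
move/msuppM_le/allpairsP => [[m1 m2] /= [m1X m2P ->]].
move: m1X m2P; rewrite mxE msuppX inE => /eqP ->.
rewrite mcoeff_msupp mcoeff_deriv => nz2.
have : P@_(m2 + U_(mxvec_index i l)) != 0 by apply: contraNneq nz2 => ->; rewrite mul0rn.
by move/wP; rewrite !colweightD !colweightU; lia.
Qed.

End ColumnWeight.

Lemma map_genmx (K K' : comNzRingType) (f : {rmorphism K -> K'}) N :
  map_mx (map_mpoly f) (genmx K N) = genmx K' N.
Proof. by apply/matrixP => i j; rewrite !mxE map_mpolyX. Qed.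

Section WeightedKernel.
Variables (n : nat) (ea eb : nat -> nat) (e : nat).

Definition wkern (K : comNzRingType) (Y : 'M[K]_n.+1) (X : 'M[K]_n) : K :=
  kern Y X ea eb * \det X ^+ e.

Lemma map_wkern (K K' : comNzRingType) (f : {rmorphism K -> K'}) Y X :
  f (wkern Y X) = wkern (map_mx f Y) (map_mx f X).
Proof. by rewrite /wkern rmorphM rmorphXn /= map_kern -det_map_mx. Qed.

Lemma wkern_trig_u (K : comNzRingType) Y (b X : 'M[K]_n) : is_trig_mx b ->
  wkern Y (b *m X) =
  (\prod_l b l l ^+ (\sum_(i < n | (l <= i)%N) ea i + \sum_(i < n | (l < i)%N) eb i + e)%N)
  * wkern Y X.
Proof.
move=> tb; rewrite /wkern kern_trig_u // det_mulmx det_trig // exprMn mulrACA.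
congr (_ * _); rewrite -prodrXl -big_split; apply: eq_bigr => l _.
by rewrite /= [in RHS]exprD.
Qed.

Lemma wkern_trig_z (K : comNzRingType) (b Y : 'M[K]_n.+1) X : is_trig_mx b ->
  wkern (b *m Y) X =
  (\prod_j b j j ^+ (\sum_(i < n | (j < n - i)%N) (ea i + eb i))) * wkern Y X.
Proof. by move=> tb; rewrite /wkern kern_trig_z // mulrA. Qed.

Lemma wkern_shift_u (K : comNzRingType) (Y : 'M[K]_n.+1) X k l s : k != l ->
  wkern Y (X *m elem k l s) =
  wkern (Y *m elem (lift ord_max k) (lift ord_max l) (- s)) X.
Proof. by move=> kl; rewrite /wkern kern_shift_u // det_mulmx det_elem // mulr1. Qed.

(** The kernel at Y, as a polynomial in the entries of X. *)
Definition Lx (K : comNzRingType) (Y : 'M[K]_n.+1) : Mpoly K n :=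
  wkern (map_mx (@mpolyC (n * n) K) Y) (genmx K n).

Lemma map_Lx (K K' : comNzRingType) (f : {rmorphism K -> K'}) (Y : 'M[K]_n.+1) :
  map_mpoly f (Lx Y) = Lx (map_mx f Y).
Proof. by rewrite /Lx map_wkern map_genmx map_constmx. Qed.

Lemma Lx_eval (K S : comNzRingType) (f : {rmorphism K -> S}) (Y : 'M[K]_n.+1) (g : 'M[S]_n) :
  mx_eval f g (Lx Y) = wkern (map_mx f Y) g.
Proof.
rewrite /Lx map_wkern mx_eval_gen; congr wkern.
by apply/matrixP => i j; rewrite !mxE; apply: mx_evalC.
Qed.

Lemma Lx_trig (K : comNzRingType) (b Y : 'M[K]_n.+1) : is_trig_mx b ->
  Lx (b *m Y) =
  (\prod_j b j j ^+ (\sum_(i < n | (j < n - i)%N) (ea i + eb i))) *: Lx Y.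
Proof.
move=> tb; rewrite /Lx map_mxM wkern_trig_z; last first.
  by apply/is_trig_mxP => i j ij; rewrite mxE (is_trig_mxP tb) // mpolyC0.
rewrite -mul_mpolyC rmorph_prod; congr (_ * _); apply: eq_bigr => j _.
by rewrite mxE -rmorphXn.
Qed.

End WeightedKernel.

Section Orthogonal.
Variables (C : numClosedFieldType) (n : nat) (T : finType).
Variables (ea eb : T -> nat -> nat) (e : nat) (chi : nat -> nat).
Hypothesis chiE : forall t (j : nat), (j <= n)%N ->
  (\sum_(i < n | (j < n - i)%N) (ea t i + eb t i) = chi j)%N.
Local Notation Lt t := (Lx (ea t) (eb t) e).

Definition kernel_orth (h : T -> Mpoly C n) : Prop :=
  forall y : 'M[C]_n.+1, \sum_t fischer (h t) (Lt t y) = 0.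

Lemma fischer_specialize (h : T -> Mpoly C n) : exists G : Mpoly C n.+1,
  forall y, mx_eval idfun y G = \sum_t fischer (h t) (Lt t y).
Proof.
pose g t : Mpoly (Mpoly C n.+1) n := Lt t (genmx C n.+1).
exists (\sum_t \sum_(m <- msupp (h t)) ((mfact m)%:R * ((h t)@_m)^*)%:MP * (g t)@_m) => y.
rewrite (raddf_sum (mx_eval idfun y)); apply: eq_bigr => t _ /=.
rewrite (raddf_sum (mx_eval idfun y)) fischer_sym /fischer rmorph_sum.
apply: eq_bigr => m _ /=.
have -> : Lt t y = map_mpoly (mx_eval idfun y) (g t) by rewrite map_Lx mx_eval_gen.
rewrite mcoeff_map_mpoly (rmorphM (mx_eval idfun y)) /= mx_evalC /=.
by rewrite !rmorphM /= conjCK rmorph_nat.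
Qed.

(** The points b Z, with b lower triangular and Z unitriangular, are dense. *)
Lemma kernel_orth_unitri (h : T -> Mpoly C n) :
  (forall y, unitri y -> \sum_t fischer (h t) (Lt t y) = 0) -> kernel_orth h.
Proof.
move=> h0; have [G GE] := fischer_specialize h; suff G0 : G = 0.
  by move=> y; rewrite -GE G0 rmorph0.
apply: dense_BN => b Z /andP[tb _] ZN; rewrite GE.
transitivity ((\prod_(j < n.+1) b j j ^+ chi j) * \sum_t fischer (h t) (Lt t Z)).
  rewrite mulr_sumr; apply: eq_bigr => t _; rewrite Lx_trig // linearZ; congr (_ * _).
  by apply: eq_bigr => j _; rewrite chiE //; have := ltn_ord j.
by rewrite h0 ?mulr0.
Qed.

Lemma horner_shiftp (k l : 'I_n) t y (s : C) : k != l ->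
  (shiftp k l (Lt t y)).[s%:MP] =
  Lt t (y *m elem (lift ord_max k) (lift ord_max l) (- s)).
Proof.
move=> kl; rewrite -[LHS]/((horner_eval s%:MP \o shiftp k l) (Lt t y)).
rewrite /Lx map_wkern.
have -> : map_mx (horner_eval s%:MP \o shiftp k l) (genmx C n) = genmx C n *m elem k l s%:MP.
  rewrite map_mx_comp [map_mx (shiftp k l) _]mx_eval_gen map_mxM; congr (_ *m _).
    by apply/matrixP => i j; rewrite !mxE /= /horner_eval hornerC.
  apply/matrixP => i j; rewrite !mxE /= /horner_eval hornerD hornerM hornerX.
  by rewrite !hornerMn -polyC1 !hornerC.
have -> : map_mx (horner_eval s%:MP \o shiftp k l) (map_mx (@mpolyC _ C) y) =
    map_mx (@mpolyC _ C) y.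
  by apply/matrixP => i j; rewrite !mxE /= /horner_eval /shiftp mx_evalC /= hornerC.
have -> : map_mx (@mpolyC _ C) (y *m elem (lift ord_max k) (lift ord_max l) (- s)) =
    map_mx (@mpolyC (n * n) C) y *m elem (lift ord_max k) (lift ord_max l) (- s%:MP).
  rewrite map_mxM; congr (_ *m _); apply/matrixP => i j; rewrite /elem !mxE.
  by rewrite rmorphD rmorphM rmorphN !rmorph_nat.
exact: wkern_shift_u.
Qed.

Lemma kernel_orth_Edir (k l : 'I_n) h : k != l ->
  kernel_orth h -> kernel_orth (fun t => Edir k l (h t)).
Proof.
move=> kl h0 y.
pose S t := shiftp l k (Lt t y).
pose p : {poly C} := \sum_t \poly_(i < size (S t)) fischer (h t) (S t)`_i.
have p0 : p = 0.
  apply: poly_eq0 => s; rewrite horner_sum.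
  rewrite -[RHS](h0 (y *m elem (lift ord_max l) (lift ord_max k) (- s))).
  apply: eq_bigr => t _; rewrite -horner_shiftp 1?eq_sym // horner_poly horner_coef.
  rewrite [RHS](raddf_sum (fischer (h t))); apply: eq_bigr => i _ /=.
  by rewrite -rmorphXn /= [(S t)`_i * _]mulrC mul_mpolyC linearZ mulrC.
transitivity (p`_1); last by rewrite p0 coef0.
rewrite coef_sum; apply: eq_bigr => t _; rewrite coef_poly -fischer_Edir.
case: ltnP => // St; rewrite /Edir -/(S t) [in LHS]nth_default //.
exact: raddf0.
Qed.

End Orthogonal.

Section Signs.
Variable B : comNzRingType.

Definition is_sign (x : B) : Prop := exists b : nat, x = (-1) ^+ b.

Lemma is_sign1 : is_sign 1.
Proof. by exists 0%N; rewrite expr0. Qed.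

Lemma is_signM x y : is_sign x -> is_sign y -> is_sign (x * y).
Proof. by move=> [b ->] [c ->]; exists (b + c)%N; rewrite exprD. Qed.

Lemma is_signX x k : is_sign x -> is_sign (x ^+ k).
Proof. by move=> [b ->]; exists (b * k)%N; rewrite exprM. Qed.

Lemma is_sign_prod (I : finType) (F : I -> B) : (forall i, is_sign (F i)) ->
  is_sign (\prod_i F i).
Proof.
move=> sF; elim/big_ind: _ => // [|x y]; [exact: is_sign1 | exact: is_signM].
Qed.

End Signs.

Section Leading.
Variables (C : numFieldType) (n : nat) (ea eb : nat -> nat) (e : nat).

Lemma map_antiY (K K' : comNzRingType) (f : {rmorphism K -> K'}) :
  map_mx (map_mpoly f) (antiY n K) = antiY n K'.
Proof.
apply/matrixP => i j; rewrite !mxE; case: unlift => [c|]; first exact: rmorph_nat.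
by case: insub => [c|]; [exact: map_mpolyX | exact: rmorph0].
Qed.

Definition Lanti : {mpoly (Mpoly C n)[n]} :=
  wkern ea eb e (antiY n (Mpoly C n)) (map_mx (@mpolyC n (Mpoly C n)) (genmx C n)).

Definition expo : 'X_{1..n} := [multinom ea i | i < n].

Lemma mu_genmx_neq0 a : (a <= n)%N -> mu (genmx C n) a != 0.
Proof.
move=> an; apply/eqP => /(congr1 (mx_eval idfun 1%:M)).
rewrite rmorph0 (map_mu (mx_eval idfun 1%:M)) mx_eval_gen.
have [b ->] := mu_unitri an (unitri1 C n).
by move/eqP; rewrite signr_eq0.
Qed.

Lemma det_genmx_neq0 : \det (genmx C n) != 0.
Proof.
apply/eqP => /(congr1 (mx_eval idfun 1%:M)).
by rewrite rmorph0 -det_map_mx mx_eval_gen det1 => /eqP; rewrite oner_eq0.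
Qed.

Lemma Lanti_lead : mlead Lanti = expo /\
  exists b : nat, Lanti@_expo =
    (-1) ^+ b * minors_monomial (genmx C n) ea eb * \det (genmx C n) ^+ e.
Proof.
have [lE [b bE]] := kern_anti_lead mu_genmx_neq0 ea eb.
have dE : \det (map_mx (@mpolyC n (Mpoly C n)) (genmx C n)) ^+ e =
    (\det (genmx C n) ^+ e)%:MP by rewrite det_map_mx -rmorphXn.
have k0 : kern (antiY n (Mpoly C n)) (map_mx (@mpolyC n (Mpoly C n)) (genmx C n)) ea eb != 0.
  rewrite -mleadc_eq0 bE mulf_neq0 ?signr_eq0 // /minors_monomial.
  by rewrite mulf_neq0 //; apply/prodf_neq0 => i _; rewrite expf_neq0 // mu_genmx_neq0 // ltnW.
split.
  rewrite /Lanti /wkern dE mleadM //; first by rewrite lE mleadC addm0.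
  by rewrite mpolyC_eq0 expf_neq0 // det_genmx_neq0.
exists b; rewrite -bE lE /Lanti /wkern dE.
by rewrite mulrC mcoeffCM mulrC.
Qed.

Lemma restr_Lanti_lead : exists b : nat, restr (Lanti@_expo) = (-1) ^+ b.
Proof.
have [_ [b ->]] := Lanti_lead; rewrite !(rmorphM (@restr C n)) !(rmorphXn (@restr C n)).
have gE : map_mx (@restr C n) (genmx C n) = generic C n by apply: mx_eval_gen.
have gU : unitri (generic C n).
  apply/andP; split; last by apply/forallP => i; rewrite generic_diag.
  by apply/is_trig_mxP => i j ij; rewrite mxE generic_lt.
have muS a : (a <= n)%N -> is_sign (restr (mu (genmx C n) a)).
  move=> an; rewrite (map_mu (@restr C n)) gE.
  by have [c ->] := mu_unitri an gU; exists c.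
apply: is_signM; first apply: is_signM.
- by exists b; rewrite (rmorphN1 (@restr C n)).
- rewrite !(rmorph_prod (@restr C n)).
  apply: is_signM; apply: is_sign_prod => i; rewrite (rmorphXn (@restr C n)).
    by apply/is_signX/muS.
  by apply/is_signX/muS/ltnW.
apply: is_signX; rewrite -(det_map_mx (@restr C n)) gE -det_tr det_trig.
  by rewrite big1 => [|i _]; [exact: is_sign1 | rewrite mxE generic_diag].
by case/andP: gU.
Qed.

Lemma Lanti_eval v : Lanti.@[fun i => (v i)%:MP] =
  Lx ea eb e (map_mx (meval v) (antiY n C)).
Proof.
pose f : {rmorphism {mpoly (Mpoly C n)[n]} -> Mpoly C n} := meval (fun i => (v i)%:MP).
have Y_eq : map_mx f (antiY n (Mpoly C n)) =
    map_mx (@mpolyC (n * n) C) (map_mx (meval v) (antiY n C)).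
  apply/matrixP => i j; rewrite !mxE; case: unlift => [c|]; first by rewrite !rmorph_nat.
  by case: insub => [c|]; rewrite /= ?mevalXU // !rmorph0.
have X_eq : map_mx f (map_mx (@mpolyC n (Mpoly C n)) (genmx C n)) = genmx C n.
  by apply/matrixP => i j; rewrite !mxE /= mevalC.
rewrite -[LHS]/(f Lanti) (map_wkern ea eb e f) Y_eq X_eq.
by [].
Qed.

Lemma mx_eval_Lanti g : mx_eval idfun g (Lanti@_expo) =
  (wkern ea eb e (antiY n C) (map_mx (@mpolyC n C) g))@_expo.
Proof.
rewrite -mcoeff_map_mpoly; congr (_@_expo).
by rewrite (map_wkern ea eb e (map_mpoly (mx_eval idfun g))) map_antiY map_constmx mx_eval_gen.
Qed.

End Leading.

Lemma meval_map_fischer (C : numClosedFieldType) k n (Q : {mpoly C[k]})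
    (P : {mpoly {mpoly C[k]}[n]}) v :
  (map_mpoly (fischer Q) P).@[v] = fischer Q P.@[fun i => (v i)%:MP].
Proof.
elim/mpolyind: P => [|c m P _ _ IH]; first by rewrite !raddf0.
rewrite !raddfD /= IH; congr (_ + _).
have -> : map_mpoly (fischer Q) (c *: 'X_[m]) = fischer Q c *: 'X_[m].
  apply/mpolyP => m'; rewrite mcoeff_map_mpoly !mcoeffZ !mcoeffX.
  by case: eqP => _; rewrite ?mulr1 // !mulr0 raddf0.
rewrite !mevalZ !mevalX.
have -> : \prod_(i < n) (v i)%:MP ^+ m i = (\prod_(i < n) v i ^+ m i)%:MP :> {mpoly C[k]}.
  by rewrite rmorph_prod; apply: eq_bigr => i _; rewrite rmorphXn.
by rewrite [c * _]mulrC mul_mpolyC linearZ mulrC.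
Qed.

Section Completeness.
Variables (C : numClosedFieldType) (n : nat) (T : finType).
Variables (ea eb : T -> nat -> nat) (e : nat) (chi : nat -> nat).
Variables (qt : T -> 'I_n -> int) (s : int).
Hypothesis chiE : forall t (j : nat), (j <= n)%N ->
  (\sum_(i < n | (j < n - i)%N) (ea t i + eb t i) = chi j)%N.
Hypothesis wtE : forall t (l : 'I_n),
  (\sum_(i < n | (l <= i)%N) ea t i + \sum_(i < n | (l < i)%N) eb t i + e)%N%:Z = qt t l - s.
Hypothesis ea_inj : forall t t', (forall i : 'I_n, ea t i = ea t' i) -> t = t'.
Local Notation Lt t := (Lx (ea t) (eb t) e).
Local Notation top t := ((Lanti C n (ea t) (eb t) e)@_(expo n (ea t))).

Let weightE t (b : 'M[C]_n) :
  \prod_l b l l ^+ (\sum_(i < n | (l <= i)%N) ea t i + \sum_(i < n | (l < i)%N) eb t i + e)%N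
  = \prod_l b l l ^ (qt t l - s).
Proof. by apply: eq_bigr => l _; rewrite -wtE. Qed.

Lemma Wequiv_Lx t y : Wequiv (C := C) (qt t) s (Lt t y).
Proof.
move=> b g /andP[tb _] _; rewrite !(Lx_eval (ea t) (eb t) e idfun).
by rewrite wkern_trig_u // weightE.
Qed.

Lemma Wequiv_top t : Wequiv (C := C) (qt t) s (top t).
Proof.
move=> b g /andP[tb _] _; rewrite !mx_eval_Lanti map_mxM (wkern_trig_u (ea t) (eb t)); last first.
  by apply/is_trig_mxP => i j ij; rewrite mxE (is_trig_mxP tb) // mpolyC0.
rewrite -weightE -mcoeffCM rmorph_prod; congr ((_ * _)@_ _); apply: eq_bigr => l _.
by rewrite mxE rmorphXn.
Qed.

Lemma kernel_orth_highest h : kernel_orth ea eb e h -> (forall t, Wequiv (C := C) (qt t) s (h t)) ->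
  (forall t (k l : 'I_n), (k < l)%N -> Edir k l (h t) = 0) -> forall t, h t = 0.
Proof.
move=> h0 hW hE t1; apply/eqP/negPn/negP => ht1.
case: (@arg_maxP _ _ _ t1 (fun t => h t != 0) (fun t => expo n (ea t)) ht1) => t0 ht0 t0max.
pose LL t := Lanti C n (ea t) (eb t) e.
have orth m : \sum_t fischer (h t) (LL t)@_m = 0.
  pose p : {mpoly C[n]} := \sum_t map_mpoly (fischer (h t)) (LL t).
  have p0 : p = 0.
    apply: mpoly_eq0 => v; rewrite (raddf_sum (meval v)).
    rewrite -[RHS](h0 (map_mx (meval v) (antiY n C))); apply: eq_bigr => t _ /=.
    by rewrite -Lanti_eval meval_map_fischer.
  have := congr1 (mcoeff m) p0; rewrite mcoeff0 (raddf_sum (mcoeff m)) => pm.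
  by rewrite -[RHS]pm; apply: eq_bigr => t _; rewrite /= mcoeff_map_mpoly.
have ft0 : fischer (h t0) (top t0) = 0.
  rewrite -[RHS](orth (expo n (ea t0))) (bigD1 t0) //= big1 ?addr0 // => t tt0.
  have [->|ht] := eqVneq (h t) 0; first by rewrite fischer_sym raddf0 rmorph0.
  rewrite mcoeff_gt_mlead ?raddf0 // (Lanti_lead C n (ea t) (eb t) e).1 lt_neqAle.
  apply/andP; split; last exact: t0max.
  apply: contraNneq tt0 => E; apply/eqP/ea_inj => i.
  by move/(congr1 (fun m : 'X_{1..n} => m i)): E; rewrite !mnmE.
have [c cE] := restr_const (hE t0).
have [b bE] := restr_Lanti_lead C n (ea t0) (eb t0) e.
have hT : h t0 = (c * (-1) ^+ b) *: top t0.
  apply/eqP; rewrite -subr_eq0 addrC -scaleNr; apply/eqP.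
  apply: (@Wequiv_restr0 C n (qt t0) s); first by apply: Wequiv_lin; [exact: Wequiv_top | exact: hW].
  rewrite -mul_mpolyC (raddfD (@restr C n)) /= (rmorphM (@restr C n)) /=.
  have rC x : restr (x%:MP : Mpoly C n) = x%:MP by apply: mx_evalC.
  rewrite rC bE cE mpolyCN mpolyCM mulNr -mulrA.
  have -> : ((-1) ^+ b)%:MP = (-1) ^+ b :> Npoly C n by rewrite rmorph_sign.
  by rewrite -expr2 sqrr_sign mulr1 addNr.
move: ft0; rewrite hT fischer_sym linearZ rmorphM => /eqP.
rewrite mulf_eq0 !conjC_eq0 => /orP[/eqP c0|/eqP/fischer_pos T0].
  by rewrite hT c0 scale0r eqxx in ht0.
by rewrite hT T0 scaler0 eqxx in ht0.
Qed.

Lemma kernel_orth_eq0 h : kernel_orth ea eb e h ->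
  (forall t, Wequiv (C := C) (qt t) s (h t)) -> forall t, h t = 0.
Proof.
pose b := (\max_t \max_(m <- msupp (h t)) colweight m)%N.
have : forall t m, (h t)@_m != 0 -> (colweight m < b.+1)%N.
  move=> t m; rewrite -mcoeff_msupp => mh; rewrite ltnS.
  apply: leq_trans (leq_bigmax t).
  by rewrite (big_rem m) //= leq_max leqnn.
move: b.+1 => d {b}; elim: d h => [|d IH] h hd h0 hW t.
  by apply/mpolyP => m; rewrite mcoeff0; apply/eqP; apply: contraT => /(hd t).
apply: kernel_orth_highest => // {}t k l kl.
have nkl : k != l by rewrite -val_eqE ltn_eqF.
apply: (IH (fun t => Edir k l (h t))).
- by move=> t' m; apply: Edir_weight kl _ m; apply: hd.
- exact: kernel_orth_Edir.
by move=> t'; apply: Wequiv_Edir.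
Qed.

Lemma kernel_span (P : T -> Mpoly C n) :
  (forall t, Wequiv (C := C) (qt t) s (P t)) ->
  exists cs : seq (C * {Z : 'M[C]_n.+1 | unitri Z}),
    forall t, P t = \sum_(cz <- cs) cz.1 *: Lt t (val cz.2).
Proof.
move=> PW.
pose g t : Mpoly (Mpoly C n.+1) n := Lt t (genmx C n.+1).
pose M := undup (flatten [seq msupp (P t) ++ msupp (g t) | t <- enum T]).
have LE t (y : 'M[C]_n.+1) : Lt t y = map_mpoly (mx_eval idfun y) (g t) by rewrite map_Lx mx_eval_gen.
have MP t : {subset msupp (P t) <= M}.
  move=> m mP; rewrite mem_undup; apply/flattenP; exists (msupp (P t) ++ msupp (g t)).
    by apply/mapP; exists t; rewrite ?mem_enum.
  by rewrite mem_cat mP.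
have ML t (y : 'M[C]_n.+1) : {subset msupp (Lt t y) <= M}.
  move=> m; rewrite LE mcoeff_msupp mcoeff_map_mpoly => nz.
  rewrite mem_undup; apply/flattenP; exists (msupp (P t) ++ msupp (g t)).
    by apply/mapP; exists t; rewrite ?mem_enum.
  rewrite mem_cat; apply/orP; right; rewrite mcoeff_msupp.
  by apply: contraNneq nz => ->; apply/eqP/(rmorph0 (mx_eval idfun y)).
pose I := (T * 'I_(size M))%type.
pose mon (i : I) := tnth (in_tuple M) i.2.
pose vec (Q : T -> Mpoly C n) : 'rV[C]_#|{: I}| := \row_k (Q (enum_val k).1)@_(mon (enum_val k)).
pose w : 'rV[C]_#|{: I}| := \row_k (mfact (mon (enum_val k)))%:R.
have w_gt0 k : 0 < w 0 k by rewrite mxE mfact_gt0.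
have [cs csP] := ortho_proj w_gt0 (fun Z : {Z : 'M[C]_n.+1 | unitri Z} => vec (fun t => Lt t (val Z))) (vec P).
exists cs.
pose h t := P t - \sum_(cz <- cs) cz.1 *: Lt t (val cz.2).
suff h0 t : h t = 0 by move=> t; apply/eqP; rewrite -subr_eq0 -/(h t) h0.
apply: (@kernel_orth_eq0 h _ _ t) => [|{}t]; last first.
  rewrite /h addrC -scaleN1r.
  apply: Wequiv_lin (PW t); elim/big_ind: _ => [|p1 p2 W1 W2|cz _].
  - exact: Wequiv0.
  - by rewrite -[p1]scale1r; apply: Wequiv_lin.
  by rewrite -[X in Wequiv _ _ X]addr0; apply: Wequiv_lin (Wequiv_Lx _ _) (Wequiv0 _ _).
apply: (kernel_orth_unitri chiE) => y yN.
have hE k : (vec P - \sum_(cz <- cs) cz.1 *: vec (fun t => Lt t (val cz.2))) 0 k =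
    (h (enum_val k).1)@_(mon (enum_val k)).
  rewrite !mxE summxE /h mcoeffB (raddf_sum (mcoeff _)); congr (_ - _).
  by apply: eq_bigr => cz _; rewrite !mxE /= mcoeffZ.
apply: (can_inj (@conjCK C)); rewrite rmorph0 rmorph_sum -[RHS](csP (exist _ y yN)).
transitivity (\sum_t \sum_(a < size M) (mfact (tnth (in_tuple M) a))%:R *
    (h t)@_(tnth (in_tuple M) a) * ((Lt t y)@_(tnth (in_tuple M) a))^*).
  apply: eq_bigr => t' _; rewrite /= (fischerE _ (undup_uniq _) (@ML t' y)) rmorph_sum [LHS]big_tnth.
  by apply: eq_bigr => a _; rewrite /= !rmorphM /= conjCK rmorph_nat mulrAC.
rewrite pair_bigA /= (eq_bigl (mem {: I})) //= big_enum_val; apply: eq_bigr => k _.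
by rewrite hE !mxE.
Qed.

End Completeness.

Lemma mcoeff_map_mpoly0 (A B : nzRingType) k (f : A -> B) (P : {mpoly A[k]}) m :
  f 0 = 0 -> (map_mpoly f P)@_m = f P@_m.
Proof.
move=> f0; rewrite /map_mpoly /mmap raddf_sum /=.
have E m' : ((f P@_m')%:MP * mmap1 (fun i => 'X_i) m')@_m = f P@_m' * (m' == m)%:R.
  by rewrite mmap1_id mcoeffCM mcoeffX.
under eq_bigr => m' _ do rewrite E.
have [mP|mP] := boolP (m \in msupp P).
  rewrite (bigD1_seq m) ?msupp_uniq //= eqxx mulr1 big1 ?addr0 // => m' /negPf ->.
  by rewrite mulr0.
rewrite (memN_msupp_eq0 mP) f0 big_seq big1 // => m' m'P.
by case: eqP => [E'|_]; rewrite ?mulr0 // -E' m'P in mP *.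
Qed.

Lemma insubd0 (C : numFieldType) n (p : 'I_n -> int) : insubd (0 : Vsp C p) 0 = 0.
Proof.
rewrite /insubd; case: insubP => [u _ u0|//]; apply: val_inj.
by rewrite u0.
Qed.

Section FullKernel.
Variables (C : numFieldType) (n : nat) (r : 'I_n.+1 -> int) (q : {ffun 'I_n -> int}).

(** The kernel as a function of a full matrix Y instead of a unitriangular one. *)
Definition Lfull (ea eb : nat -> nat) : Npoly (Mpoly C n.+1) n :=
  kern (map_mx (@mpolyC (nvars n) _) (genmx C n.+1)) (generic (Mpoly C n.+1) n) ea eb.

Lemma Lker_restr : Lker C r q = map_mpoly (@restr C n.+1) (Lfull (expA r q) (expB r q)).
Proof.
have E : map_mx (@restr C n.+1) (genmx C n.+1) = generic C n.+1 by apply: mx_eval_gen.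
by rewrite Lker_kern /Lfull (map_mpoly_kern (@restr C n.+1)) E.
Qed.

Lemma map_eval_Lfull (g : 'M[C]_n.+1) ea eb :
  map_mpoly (mx_eval idfun g) (Lfull ea eb) =
  kern (map_mx (@mpolyC (nvars n) C) g) (generic C n) ea eb.
Proof. by rewrite /Lfull map_mpoly_kern mx_eval_gen. Qed.

Hypothesis q_int : interlaces r q.

Lemma Lfull_coef_Wequiv m :
  Wequiv (rstar r) (- rnat r 0) ((Lfull (expA r q) (expB r q))@_m).
Proof.
move=> b g /andP[tb _] _; rewrite -!mcoeff_map_mpoly !map_eval_Lfull map_mxM kern_trig_z.
  rewrite -mcoeffCM rmorph_prod; congr ((_ * _)@_m); apply: eq_bigr => j _ /=.
  rewrite mxE -rmorphXn; congr (_%:MP); rewrite exprnP; congr (_ ^ _).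
  rewrite sum_expAB //; last by have := ltn_ord j.
  rewrite /rstar opprK [RHS]addrC; congr (_ - _); rewrite /rnat; congr r; apply: val_inj.
  by rewrite /= inordK ?subSS // ltnS leq_subr.
by apply/is_trig_mxP => i j ij; rewrite mxE (is_trig_mxP tb) // mpolyC0.
Qed.

Lemma Lker_coef_Vsp m : (Lker C r q)@_m \in Vsp_pred (rstar r).
Proof.
apply/asboolP; rewrite Lker_restr mcoeff_map_mpoly.
exact: Wequiv_Vsp (Lfull_coef_Wequiv m).
Qed.

End FullKernel.

Section EvalComb.
Variables (C : numFieldType) (n : nat) (p : 'I_n -> int) (cs : seq (C * {Z : 'M[C]_n | unitri Z})).

Definition eval_comb (f : Vsp C p) : C^o :=
  \sum_(cz <- cs) cz.1 * eval_at (val f) (val cz.2).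

Lemma eval_comb_is_linear : linear eval_comb.
Proof.
move=> a f g; rewrite /eval_comb scaler_sumr -big_split; apply: eq_bigr => cz _.
have -> : val (a *: f + g) = a *: val f + val g by rewrite linearP.
by rewrite /eval_at mevalD mevalZ mulrDr [_ *: _]mulrCA.
Qed.

HB.instance Definition _ :=
  GRing.isLinear.Build C (Vsp C p) C^o _ eval_comb eval_comb_is_linear.

End EvalComb.

Lemma pairL_surj (C : numClosedFieldType) n (r : 'I_n.+1 -> int) (F : qfamily C n) :
  GTspace r F -> exists xi : Vdual C (rstar r), pairL xi = F.
Proof.
move=> GF.
pose B := (\sum_(j < n) `|(r (widen_ord (leqnSn n) j) - r (lift ord0 j))|)%N.
pose qof (f : {ffun 'I_n -> 'I_B.+1}) : {ffun 'I_n -> int} :=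
  [ffun j => r (lift ord0 j) + (f j : nat)%:Z].
pose T := {f : {ffun 'I_n -> 'I_B.+1} | interlaces r (qof f)}.
pose qt (t : T) : {ffun 'I_n -> int} := qof (val t).
have qtP t : interlaces r (qt t) by apply: (valP t).
have qtE (q : {ffun 'I_n -> int}) : interlaces r q -> exists t, qt t = q.
  move=> /[dup] qr /forallP q_int; pose f := [ffun j : 'I_n => inord `|q j - r (lift ord0 j)|%N : 'I_B.+1].
  have fq : qof f = q.
    apply/ffunP => j; rewrite !ffunE inordK; last first.
      rewrite ltnS /B (bigD1 j) //=; apply: leq_trans (leq_addr _ _).
      by have /andP[] := q_int j; lia.
    have /andP[lq _] := q_int j.
    by rewrite gez0_abs ?subr_ge0 // addrCA subrr addr0.
  have fr : interlaces r (qof f) by rewrite fq.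
  by exists (exist _ f fr).
pose chi (j : nat) := `|rnat r 0 - rnat r (n - j)|%N.
have chiE t (j : nat) : (j <= n)%N ->
    (\sum_(i < n | (j < n - i)%N) (expA r (qt t) i + expB r (qt t) i) = chi j)%N.
  by move=> jn; rewrite /chi -(sum_expAB (qtP t)).
have ea_inj t t' : (forall i : 'I_n, expA r (qt t) i = expA r (qt t') i) -> t = t'.
  move=> E; apply/val_inj/ffunP => j; apply: val_inj => /=.
  have A (x : int) (k : nat) : absz ((x + k%:Z - x)%R) = k by rewrite addrAC subrr add0r.
  by have := E j; rewrite /expA !qnatE rnat_lift !ffunE !A.
have [d dP] : exists d : T -> nat, forall t s, (d t <= s)%N ->
    exists P, Wequiv (C := C) (qt t) (- s%:Z) P /\ restr P = F (qt t).
  have : forall t, exists d, forall s, (d <= s)%N ->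
    exists P, Wequiv (C := C) (qt t) (- s%:Z) P /\ restr P = F (qt t).
    by move=> t; apply: Wequiv_lift; have := GF (qt t); rewrite qtP.
  by case/choice => d dP; exists d.
pose e := (\max_t d t + `|rnat r n|)%N.
pose s : int := rnat r n - e%:Z.
have wtE t (l : 'I_n) : (\sum_(i < n | (l <= i)%N) expA r (qt t) i +
    \sum_(i < n | (l < i)%N) expB r (qt t) i + e)%N%:Z = qt t l - s.
  by rewrite PoszD sum_expA_expB // qnatE /s; lia.
have [P PP] : exists P : T -> Mpoly C n, forall t,
    Wequiv (C := C) (qt t) s (P t) /\ restr (P t) = F (qt t).
  suff : forall t, exists P, Wequiv (C := C) (qt t) s P /\ restr P = F (qt t).
    by case/choice => P PP; exists P.
  move=> t; have := @dP t `|s|%N.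
  have -> : - (`|s|%N)%:Z = s by rewrite /s /e; lia.
  by apply; have := @leq_bigmax _ d t; rewrite /s /e; lia.
have [cs csP] := @kernel_span C n T (fun t => expA r (qt t)) (fun t => expB r (qt t)) e chi
  (fun t => qt t : _ -> int) s chiE wtE ea_inj P (fun t => (PP t).1).
exists (eval_comb (p := rstar r) cs); apply/funext => q; rewrite /pairL.
case: ifP => q_int; last by have := GF q; rewrite q_int.
have [t qE] := qtE q q_int; rewrite -qE -(PP t).2 csP.
rewrite (raddf_sum (@restr C n)); apply/mpolyP => m.
rewrite mcoeff_map_mpoly0; last by rewrite insubd0 raddf0.
have vE : val (insubd (0 : Vsp C (rstar r)) (Lker C r (qt t))@_m) = (Lker C r (qt t))@_m.
  by rewrite insubdK //; apply: Lker_coef_Vsp.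
rewrite [LHS]/(eval_comb cs (insubd _ _)) /eval_comb vE.
rewrite raddf_sum; apply: eq_bigr => -[c [Z ZN]] _ /=.
have -> : restr (c *: Lx (expA r (qt t)) (expB r (qt t)) e Z) =
    c *: kern (map_mx (@mpolyC (nvars n) C) Z) (generic C n) (expA r (qt t)) (expB r (qt t)).
  rewrite -!mul_mpolyC (rmorphM (@restr C n)) /= [restr c%:MP]mx_evalC; congr (_ * _).
  rewrite [LHS](Lx_eval _ _ _ (@mpolyC _ C)) /wkern.
  have -> : \det (generic C n) = 1.
    rewrite -det_tr det_trig; first by rewrite big1 // => i _; rewrite mxE generic_diag.
    by apply/is_trig_mxP => i j ij; rewrite mxE generic_lt.
  by rewrite expr1n mulr1.
rewrite mcoeffZ; congr (_ * _).
have := map_mpoly_kern (meval (fun i => Z (val (enum_val i)).1 (val (enum_val i)).2))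
  (generic C n.+1) (expA r (qt t)) (expB r (qt t)).
by rewrite map_generic_unitri // Lker_kern => <-; rewrite mcoeff_map_mpoly.
Qed.

Section CoefficientFunctional.
Variables (C : fieldType) (k : nat).

Definition coef_functional (x : seq (C * 'X_{1..k})) (P : {mpoly C[k]}) : C :=
  \sum_(cm <- x) cm.1 * P@_cm.2.

Lemma coef_functional_is_additive x : additive (coef_functional x).
Proof.
move=> P Q; rewrite /coef_functional -sumrB; apply: eq_bigr => cm _.
by rewrite mcoeffB mulrBr.
Qed.

HB.instance Definition _ x :=
  GRing.isAdditive.Build {mpoly C[k]} C (coef_functional x) (coef_functional_is_additive x).

(** A function on finitely many polynomials that respects their linear
    relations is a linear form in the coefficients. *)
Lemma coef_functional_extend (S : seq {mpoly C[k]}) (g : {mpoly C[k]} -> C) :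
  (forall a : 'I_(size S) -> C, \sum_i a i *: S`_i = 0 -> \sum_i a i * g S`_i = 0) ->
  exists x, forall P, P \in S -> coef_functional x P = g P.
Proof.
move=> gS; pose M := undup (flatten [seq msupp P | P <- S]).
have MS P : P \in S -> {subset msupp P <= M}.
  by move=> PS m mP; rewrite mem_undup; apply/flattenP; exists (msupp P) => //; apply: map_f.
pose A : 'M[C]_(size M, size S) := \matrix_(j, i) (S`_i)@_(tnth (in_tuple M) j).
pose v : 'rV[C]_(size S) := \row_i g S`_i.
have : (v <= A)%MS.
  rewrite submxE; apply/eqP/rowP => c; rewrite [RHS]mxE mxE.
  pose a i := cokermx A i c.
  transitivity (\sum_i a i * g S`_i); first by apply: eq_bigr => i _; rewrite mxE mulrC.
  apply: gS; apply/mpolyP => m; rewrite mcoeff0 raddf_sum /=.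
  have [mM|mM] := boolP (m \in M); last first.
    apply: big1 => i _; rewrite mcoeffZ memN_msupp_eq0 ?mulr0 //.
    by apply: contraNN mM; apply: MS; apply: mem_nth.
  have jM : (index m M < size M)%N by rewrite index_mem.
  have /matrixP/(_ (Ordinal jM) c) := mulmx_coker A; rewrite [RHS]mxE mxE => E.
  rewrite -[RHS]E; apply: eq_bigr => i _; rewrite mcoeffZ mulrC mxE; congr (_@_ _ * _).
  by rewrite (tnth_nth 0%MM) /= nth_index.
case/submxP => x xE; exists [seq (x 0 j, tnth (in_tuple M) j) | j <- enum 'I_(size M)] => P PS.
rewrite /coef_functional big_map big_enum /=.
have iS : (index P S < size S)%N by rewrite index_mem.
have /matrixP/(_ 0 (Ordinal iS)) := xE; rewrite !mxE /= nth_index // => ->.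
by apply: eq_bigr => j _; rewrite mxE /= nth_index.
Qed.

End CoefficientFunctional.

Lemma restrZ (C : numFieldType) N c (P : Mpoly C N) : restr (c *: P) = c *: restr P.
Proof.
rewrite -!mul_mpolyC (rmorphM (@restr C N)); congr (_ * _).
exact: mx_evalC.
Qed.

Section PairingFunctional.
Variables (C : numFieldType) (n : nat) (r : 'I_n.+1 -> int) (xi : Vdual C (rstar r)).
Local Notation W := (Wequiv (C := C) (rstar r) (- rnat r 0)).
Local Notation Lq q := (Lfull C n (expA r q) (expB r q)).

Let g (P : Mpoly C n.+1) : C := xi (insubd 0 (restr P)).

Lemma pairing_relations (S : seq (Mpoly C n.+1)) : (forall P, P \in S -> W P) ->
  forall a : 'I_(size S) -> C, \sum_i a i *: S`_i = 0 -> \sum_i a i * g S`_i = 0.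
Proof.
move=> SW a aS.
have vE (i : 'I_(size S)) : val (insubd (0 : Vsp C (rstar r)) (restr S`_i)) = restr S`_i.
  by rewrite insubdK //; apply/asboolP; apply: (@Wequiv_Vsp _ _ _ (- rnat r 0)); apply/SW/mem_nth.
transitivity (xi (\sum_i a i *: insubd (0 : Vsp C (rstar r)) (restr S`_i))).
  have xiZ (c : C) x : xi (c *: x) = c * xi x by rewrite linearZ.
  by rewrite raddf_sum; apply: eq_bigr => i _; rewrite [RHS]xiZ.
rewrite (_ : \sum_i _ = 0) ?raddf0 //; apply: val_inj.
transitivity (restr (\sum_i a i *: S`_i)); last by rewrite aS (rmorph0 (@restr C n.+1)).
rewrite raddf_sum (raddf_sum (@restr C n.+1)).
apply: eq_bigr => i _.
have vZ (c : C) (x : Vsp C (rstar r)) : val (c *: x) = c *: val x by rewrite linearZ.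
by rewrite [LHS]vZ vE; apply: esym; apply: restrZ.
Qed.

Lemma pairing_functional (k l : 'I_n.+1) (q0 : {ffun 'I_n -> int}) (qs : seq {ffun 'I_n -> int}) :
  k != l -> interlaces r q0 -> {in qs, forall q : {ffun 'I_n -> int}, interlaces r q} ->
  exists eta : {additive Mpoly C n.+1 -> C},
    (forall q, q \in qs -> pairL xi q = map_mpoly eta (Lq q)) /\
    pairL (Edual k l xi) q0 = - map_mpoly eta (map_mpoly (Edir k l) (Lq q0)).
Proof.
move=> kl q0_int qs_int.
pose E0 := map_mpoly (Edir k l) (Lq q0).
pose coefs (P : Npoly (Mpoly C n.+1) n) := [seq P@_m | m <- msupp P].
pose S := coefs E0 ++ flatten [seq coefs (Lq q) | q <- qs].
have g0 : g 0 = 0 by rewrite /g (rmorph0 (@restr C n.+1)) insubd0 raddf0.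
have E0W m : W (E0@_m).
  by rewrite mcoeff_map_mpoly; apply/Wequiv_Edir/Lfull_coef_Wequiv.
have SW P : P \in S -> W P.
  rewrite mem_cat => /orP[/mapP[m _ ->] //|/flattenP[s /mapP[q qq ->] /mapP[m _ ->]]].
  by apply: Lfull_coef_Wequiv; apply: qs_int.
have [x xS] := coef_functional_extend (pairing_relations SW).
pose eta := coef_functional x.
have coefE (Q : Npoly (Mpoly C n.+1) n) m : {subset coefs Q <= S} ->
    (map_mpoly eta Q)@_m = g (Q@_m).
  move=> QS; rewrite mcoeff_map_mpoly; have [mQ|mQ] := boolP (m \in msupp Q).
    by apply/xS/QS; apply: map_f.
  by rewrite memN_msupp_eq0 // g0; apply: (raddf0 (coef_functional x)).
exists eta; split.
  move=> q qq; have q_int := qs_int q qq; rewrite /pairL q_int.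
  apply/mpolyP => m; rewrite mcoeff_map_mpoly0; last by rewrite insubd0 raddf0.
  rewrite coefE; last first.
    move=> P PQ; rewrite mem_cat; apply/orP; right; apply/flattenP.
    by exists (coefs (Lq q)) => //; apply: map_f.
  by rewrite Lker_restr mcoeff_map_mpoly.
have EactE P : W P -> xi (Eact k l (insubd 0 (restr P))) = g (Edir k l P).
  move=> WP; rewrite /g; congr (xi _); apply: val_inj.
  have WE : W (Edir k l P) by apply: Wequiv_Edir.
  have inV Q : W Q -> restr Q \in Vsp_pred (rstar r) by move=> WQ; apply/asboolP/(Wequiv_Vsp WQ).
  rewrite [RHS]insubdK ?inV //; apply: (Eact_restr kl WP).
  by rewrite insubdK ?inV.
rewrite /pairL q0_int; apply/mpolyP => m.
rewrite mcoeff_map_mpoly0; last first.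
  rewrite /Edual -[in insubd 0 0](rmorph0 (@restr C n.+1)) EactE; last exact: Wequiv0.
  by rewrite raddf0 g0 oppr0.
rewrite mcoeffN coefE => [|P PQ]; last by rewrite mem_cat PQ.
rewrite /Edual Lker_restr mcoeff_map_mpoly EactE; last exact: Lfull_coef_Wequiv.
by rewrite mcoeff_map_mpoly.
Qed.

End PairingFunctional.

Section Neighbours.
Variables (n : nat) (r : 'I_n.+1 -> int) (q : {ffun 'I_n -> int}) (m : 'I_n).
Hypothesis q_int : interlaces r q.

Definition qminus : {ffun 'I_n -> int} := [ffun j => q j - (j == m)%:R].
Definition qplus : {ffun 'I_n -> int} := [ffun j => q j + (j == m)%:R].

Lemma qnat_minus i : (i < n)%N -> qnat qminus i = qnat q i - (i == m :> nat)%:R.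
Proof.
move=> lt_in; have E1 := qnatE qminus (Ordinal lt_in); have E2 := qnatE q (Ordinal lt_in).
by rewrite /= in E1 E2; rewrite E1 E2 ffunE.
Qed.

Lemma qnat_plus i : (i < n)%N -> qnat qplus i = qnat q i + (i == m :> nat)%:R.
Proof.
move=> lt_in; have E1 := qnatE qplus (Ordinal lt_in); have E2 := qnatE q (Ordinal lt_in).
by rewrite /= in E1 E2; rewrite E1 E2 ffunE.
Qed.

Lemma interlaces_minus : (0 < expA r q m)%N -> interlaces r qminus.
Proof.
have := expAE q_int (ltn_ord m); rewrite qnatE rnat_lift => mE m0.
apply/forallP => j; have /forallP/(_ j)/andP[lj uj] := q_int; rewrite ffunE.
case: eqP => [jm|_]; last by rewrite subr0 lj.
by rewrite jm in lj uj *; lia.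
Qed.

Lemma interlaces_plus : (0 < expB r q m)%N -> interlaces r qplus.
Proof.
have := expBE q_int (ltn_ord m); rewrite qnatE rnat_widen => mE m0.
apply/forallP => j; have /forallP/(_ j)/andP[lj uj] := q_int; rewrite ffunE.
case: eqP => [jm|_]; last by rewrite addr0 lj.
by rewrite jm in lj uj *; lia.
Qed.

Lemma expAB_minus i : (0 < expA r q m)%N -> (i < n)%N ->
  expA r qminus i = decr (expA r q) m i /\ expB r qminus i = incr (expB r q) m i.
Proof.
move=> m0 lt_in; have iA := expAE q_int lt_in; have iB := expBE q_int lt_in.
have iA' := expAE (interlaces_minus m0) lt_in; have iB' := expBE (interlaces_minus m0) lt_in.
move: iA' iB'; rewrite qnat_minus // /decr /incr; case: eqP => [E|_]; last by lia.
by move: m0; rewrite -E; lia.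
Qed.

Lemma expAB_plus i : (0 < expB r q m)%N -> (i < n)%N ->
  expA r qplus i = incr (expA r q) m i /\ expB r qplus i = decr (expB r q) m i.
Proof.
move=> m0 lt_in; have iA := expAE q_int lt_in; have iB := expBE q_int lt_in.
have iA' := expAE (interlaces_plus m0) lt_in; have iB' := expBE (interlaces_plus m0) lt_in.
move: iA' iB'; rewrite qnat_plus // /decr /incr; case: eqP => [E|_]; last by lia.
by move: m0; rewrite -E; lia.
Qed.

End Neighbours.

Lemma eq_kern (B : comNzRingType) n (Y : 'M[B]_n.+1) X ea eb ea' eb' :
  (forall i, (i < n)%N -> ea i = ea' i /\ eb i = eb' i) ->
  kern Y X ea eb = kern Y X ea' eb'.
Proof.
move=> E; rewrite /kern /Lmon; congr (_ * _); apply: eq_bigr => i _; congr (_ ^+ _).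
  by case: (E i (ltn_ord i)).
by case: (E i (ltn_ord i)).
Qed.

Lemma coef_t_shiftp (C : comNzRingType) n (k l : 'I_n.+1) (P : Npoly (Mpoly C n.+1) n) :
  coef_t 1 (map_mpoly (shiftp k l) P) = map_mpoly (Edir k l) P.
Proof.
apply/mpolyP => m; rewrite [LHS]mcoeff_map_mpoly [RHS]mcoeff_map_mpoly.
by rewrite mcoeff_map_mpoly.
Qed.

Section Generators.
Variables (C : numClosedFieldType) (n : nat) (r : 'I_n.+1 -> int) (F : qfamily C n).
Hypothesis F_Vr : GTspace r F.
Variable q : {ffun 'I_n -> int}.
Hypothesis q_int : interlaces r q.
Hypothesis n_gt0 : (0 < n)%N.

Let y := genmx C n.+1.

Let y_spec (y0 : 'M[C]_n.+1) : exists f : {rmorphism Mpoly C n.+1 -> C}, map_mx f y = y0.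
Proof. by exists (mx_eval idfun y0); apply: mx_eval_gen. Qed.

Let shift_gen (k l : 'I_n.+1) : map_mx (shiftp k l) y = map_mx polyC y *m elem k l 'X.
Proof. exact: mx_eval_gen. Qed.

Let pairE : pairL (pairL_inv r F) = F.
Proof.
have [xi xiE] := pairL_surj F_Vr.
by rewrite /pairL_inv; case: xgetP => [xi' _ //|/(_ xi)].
Qed.

Lemma Fop_lower : Fop r ord0 ord_max F q =
    \sum_(m < n) Acoef C r q m *:
      \sum_(I : {set 'I_n} | spans 0 m I)
        (\prod_(l in segment n 0 m :\: I)
            (q m - q l + l%:Z - m%:Z)%:~R) *: Rset I (Tminus m F q).
Proof.
have kl : ord0 != ord_max :> 'I_n.+1 by apply/eqP => -[]; lia.
pose qs := [seq qminus q m | m : 'I_n <- enum 'I_n & (0 < expA r q m)%N].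
have qs_int : {in qs, forall q' : {ffun 'I_n -> int}, interlaces r q'}.
  by move=> q' /mapP[m]; rewrite mem_filter => /andP[m0 _] ->; apply: interlaces_minus.
have [eta [etaE EdualE]] := pairing_functional (pairL_inv r F) kl q_int qs_int.
rewrite (lower_identity q_int (y := y) (xi := eta)).
- rewrite /Fop EdualE -coef_t_shiftp.
  rewrite (deriv_kern_lower (shift_gen ord0 ord_max)) //.
  rewrite raddfN opprK raddf_sum; apply: eq_bigr => i _ /=.
  by rewrite !mulr_natl raddfMn.
- by move=> i lt_in; apply: (Phid_generic_neq0 y_spec).
move=> m m0; rewrite /Tminus -/(qminus q m) -pairE etaE; last first.
  by apply: map_f; rewrite mem_filter m0 mem_enum.
congr (map_mpoly eta _); apply: eq_kern => i lt_in; exact: expAB_minus.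
Qed.

Lemma Fop_upper : Fop r ord_max (inord n.-1) F q =
    - \sum_(m < n) Bcoef C r q m *:
      \sum_(I : {set 'I_n} | spans m n.-1 I)
        (\prod_(l in segment n m n.-1 :\: I)
            (q m - q l - m%:Z + l%:Z + 1)%:~R) *: Rset I (Tplus m F q).
Proof.
have kl : ord_max != inord n.-1 :> 'I_n.+1.
  by apply/eqP => /(congr1 val); rewrite /= inordK; lia.
pose qs := [seq qplus q m | m : 'I_n <- enum 'I_n & (0 < expB r q m)%N].
have qs_int : {in qs, forall q' : {ffun 'I_n -> int}, interlaces r q'}.
  by move=> q' /mapP[m]; rewrite mem_filter => /andP[m0 _] ->; apply: interlaces_plus.
have [eta [etaE EdualE]] := pairing_functional (pairL_inv r F) kl q_int qs_int.
rewrite (upper_identity q_int (y := y) (xi := eta)) //.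
- rewrite /Fop EdualE -coef_t_shiftp.
  rewrite (deriv_kern_upper (shift_gen ord_max (inord n.-1))) //.
  rewrite raddfN !opprK raddf_sum; apply: eq_bigr => i _ /=.
  by rewrite !mulr_natl raddfMn.
- by move=> i lt_in; apply: (Psid_generic_neq0 y_spec).
move=> m m0; rewrite /Tplus -/(qplus q m) -pairE etaE; last first.
  by apply: map_f; rewrite mem_filter m0 mem_enum.
congr (map_mpoly eta _); apply: eq_kern => i lt_in; exact: expAB_plus.
Qed.

End Generators.

Theorem theorem1p5 (R : realType) (n : nat) (n_ge1 : (1 <= n)%N)
    (r : 'I_n.+1 -> int) (r_sig : signature r)
    (F : qfamily R[i] n) (F_Vr : GTspace r F)
    (q : {ffun 'I_n -> int}) (q_int : interlaces r q) :
  Fop r ord0 ord_max F q =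
    \sum_(m < n) Acoef R[i] r q m *:
      \sum_(I : {set 'I_n} | spans 0 m I)
        (\prod_(l in segment n 0 m :\: I)
            (q m - q l + l%:Z - m%:Z)%:~R) *: Rset I (Tminus m F q)
  /\
  Fop r ord_max (inord n.-1) F q =
    - \sum_(m < n) Bcoef R[i] r q m *:
      \sum_(I : {set 'I_n} | spans m n.-1 I)
        (\prod_(l in segment n m n.-1 :\: I)
            (q m - q l - m%:Z + l%:Z + 1)%:~R) *: Rset I (Tplus m F q).
Proof. by split; [exact: Fop_lower | exact: Fop_upper]. Qed.
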